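(* A graph $G$ belongs to $\mathcal{G}$ if and only if, for a suitable ordering of its vertices, its adjacency matrix is one of the following; moreover the spectra are as indicated. (i) $\begin{bmatrix} O & J-I_m\\ J-I_m & O\end{bmatrix}$ with $m\geq 3$; spectrum $\{\pm(m-1),\,1^{m-1},\,-1^{m-1}\}$. (ii) $\begin{bmatrix} J-I_a & J\\ J & R_{2k}\end{bmatrix}$ with $a\geq 1$, $k\geq 2$; spectrum $\{\tfrac a2\pm\tfrac12\sqrt{a^2+8ak-4a+4},\,1^{k-1},\,-1^{a+k-1}\}$. (iii) $\begin{bmatrix} R_{2\ell} & J\\ J & R_{2m}\end{bmatrix}$ with $\ell\geq m\geq 2$; spectrum $\{1\pm 2\sqrt{\ell m},\,1^{\ell+m-2},\,-1^{\ell+m}\}$. (iv) $\begin{bmatrix} O & N\\ N^\top & O\end{bmatrix}$ where either $N=\begin{bmatrix} 1 & \mathbf{1}^\top\\ \mathbf{1} & I_4\end{bmatrix}$ (a $5\times5$ matrix), with spectrum $\{\pm3,\,1^4,\,-1^4\}$, or $N=\begin{bmatrix} J-I_3 & J\\ O & J-I_3\end{bmatrix}$ (a $6\times 6$ matrix), with spectrum $\{\pm4,\,1^5,\,-1^5\}$. (v) $\begin{bmatrix} J-I_a & J & \mathbf{1}\\ J & J-I_b & \mathbf{0}\\ \mathbf{1}^\top & \mathbf{0}^\top & 0\end{bmatrix}$ with $(a,b)=(6,5)$, $(4,6)$ or $(3,8)$; spectra $\{4\pm2\sqrt{10},\,1^1,\,-1^9\}$, $\{(7\pm\sqrt{129})/2,\,1^1,\,-1^8\}$,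 $\{4\pm\sqrt{37},\,1^1,\,-1^9\}$ respectively. (vi) $\begin{bmatrix} J-I_a & J & O\\ J & O & J-I_m\\ O & J-I_m & O\end{bmatrix}$ with $(a,m)=(3,5)$ or $(4,4)$; spectra $\{(1\pm\sqrt{129})/2,\,1^5,\,-1^6\}$ and $\{1\pm2\sqrt7,\,1^4,\,-1^6\}$ respectively.
   Context: Graphs are finite, simple and undirected; the spectrum of a graph is the multiset of eigenvalues of its adjacency matrix, with multiplicities written as exponents. $\mathcal{G}$ denotes the set of connected graphs whose adjacency matrix has exactly two eigenvalues (counted with multiplicity) different from $\pm1$, one equal to some $r>1$ and the other equal to some $s<-1$, all remaining eigenvalues being $1$ or $-1$. $J$ denotes an all-ones matrix, $O$ a zero matrix, $I_n$ the identity matrix of order $n$, $\mathbf{1}$ and $\mathbf{0}$ all-ones and all-zero column vectors (of the sizes dictated by the block structure), and $R_n$ the reverse identity matrix of order $n$ (the $n\times n$ matrix with ones exactly on the anti-diagonal), so $R_{2k}$ is the adjacency matrix of $k$ disjoint edges. *)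

(* Defs.v *)
(* Graphs on vertex set 'I_n are symmetric irreflexive
   boolean relations; adjacency matrices and spectra are taken over algC
   (algebraic complex numbers, an algebraically closed numeric field). *)
From HB Require Import structures.
From mathcomp Require Import all_boot all_order all_algebra all_fingroup all_field.
Set Implicit Arguments.
Unset Strict Implicit.
Unset Printing Implicit Defensive.
Import Order.TTheory GRing.Theory Num.Theory.
Local Open Scope ring_scope.

Definition adjmx (n : nat) (e : rel 'I_n) : 'M[algC]_n :=
  \matrix_(i, j) (e i j)%:R.

Definition has_spectrum (n : nat) (A : 'M[algC]_n) (s : seq algC) : Prop :=
  char_poly A = \prod_(x <- s) ('X - x%:P).

Definition inG (n : nat) (e : rel 'I_n) : Prop :=
  (forall i j : 'I_n, connect e i j) /\
  exists s : seq algC, has_spectrum (adjmx e) s /\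
    exists r t : algC, 1 < r /\ t < -1 /\
      perm_eq [seq x <- s | (x != 1) && (x != -1)] [:: r; t].

Definition Jm (m n : nat) : 'M[algC]_(m, n) := const_mx 1.
Definition JI (n : nat) : 'M[algC]_n := Jm n n - 1%:M.
Definition Rrev (n : nat) : 'M[algC]_n := \matrix_(i, j) ((i + j == n.-1)%N)%:R.

Definition formI (m : nat) : 'M[algC]_(m + m) := block_mx 0 (JI m) (JI m) 0.
Definition formII (a k : nat) : 'M[algC]_(a + 2 * k) :=
  block_mx (JI a) (Jm a (2 * k)) (Jm (2 * k) a) (Rrev (2 * k)).
Definition formIII (l m : nat) : 'M[algC]_(2 * l + 2 * m) :=
  block_mx (Rrev (2 * l)) (Jm (2 * l) (2 * m)) (Jm (2 * m) (2 * l)) (Rrev (2 * m)).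
Definition N5 : 'M[algC]_(1 + 4) := block_mx 1 (Jm 1 4) (Jm 4 1) 1%:M.
Definition N6 : 'M[algC]_(3 + 3) := block_mx (JI 3) (Jm 3 3) 0 (JI 3).
Definition formIV5 : 'M[algC]_(5 + 5) := block_mx 0 N5 N5^T 0.
Definition formIV6 : 'M[algC]_(6 + 6) := block_mx 0 N6 N6^T 0.
Definition formV (a b : nat) : 'M[algC]_((a + b) + 1) :=
  block_mx (block_mx (JI a) (Jm a b) (Jm b a) (JI b))
           (col_mx (Jm a 1) 0) (row_mx (Jm 1 a) 0) 0.
Definition formVI (a m : nat) : 'M[algC]_((a + m) + m) :=
  block_mx (block_mx (JI a) (Jm a m) (Jm m a) 0)
           (col_mx 0 (JI m)) (row_mx 0 (JI m)) 0.

Definition is_form (n : nat) (A : 'M[algC]_n) : Prop :=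
  (exists m (E : (m + m)%N = n), (3 <= m)%N /\ A = castmx (E, E) (formI m))
  \/ (exists a k (E : (a + 2 * k)%N = n),
        (1 <= a)%N /\ (2 <= k)%N /\ A = castmx (E, E) (formII a k))
  \/ (exists l m (E : (2 * l + 2 * m)%N = n),
        (m <= l)%N /\ (2 <= m)%N /\ A = castmx (E, E) (formIII l m))
  \/ (exists E : (5 + 5)%N = n, A = castmx (E, E) formIV5)
  \/ (exists E : (6 + 6)%N = n, A = castmx (E, E) formIV6)
  \/ (exists a b (E : ((a + b) + 1)%N = n),
        ((a, b) = (6, 5) \/ (a, b) = (4, 6) \/ (a, b) = (3, 8))%N /\
        A = castmx (E, E) (formV a b))
  \/ (exists a m (E : ((a + m) + m)%N = n),
        ((a, m) = (3, 5) \/ (a, m) = (4, 4))%N /\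
        A = castmx (E, E) (formVI a m)).

Definition reordered_adj (n : nat) (e : rel 'I_n) (s : 'S_n) : 'M[algC]_n :=
  \matrix_(i, j) adjmx e (s i) (s j).

(* Main.v *)
(* If G has spectrum {r, t, 1^k, (-1)^l} with r > 1 and t < -1, then A^2 - I is
   positive semidefinite of rank two, while A + I and I - A each have exactly one
   negative eigenvalue and so satisfy a reverse Cauchy-Schwarz inequality.
   In a triangle-free G the off-diagonal entries of A^2 - I vanish along edges;
   the rank condition then makes G bipartite with prescribed codegrees on each
   side, and double counting leaves (i) and (iv).  If G has a triangle, testing
   A + I on small configurations shows that the traces of outside vertices on a
   maximum clique K are two complementary halves of K or empty.  Coordinates of
   A^2 - I in the basis given by one clique vertex of each half then turn all
   degrees into Diophantine equations whose solutions are (ii), (iii), (v), (vi).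
   The spectra come from A = P + u c with P u = u P', which gives
   char(A) char(P') = char(P) char(P' + c u). *)
Require Import Defs.
From HB Require Import structures.
From mathcomp Require Import all_boot all_order all_algebra all_fingroup all_field.
From mathcomp Require Import spectral sesquilinear.
From mathcomp Require Import zify ring lra.
Set Implicit Arguments.
Unset Strict Implicit.
Unset Printing Implicit Defensive.
Import Order.TTheory GRing.Theory Num.Theory.
Local Open Scope ring_scope.

(** On a clique A + I is an all-ones block, so differences of clique vertices are null vectors of A
    + I; adding them to an outside vertex adjusts its products without any other cost, and this is
    what confines the traces. A - I is positive on a triangle, so a second positive vector
    orthogonal or nearly orthogonal to it is impossible, and this bounds the edges outside K. After
    that only counts matter. Let g = |K| - 2 and let n1, n2 be the numbers of outside vertices over
    the two halves. One clique vertex of each half gives the Gram block with rows (g + n1, g) and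
    (g, g + n2), whose determinant D = g n1 + g n2 + n1 n2 is positive. Each remaining Gram entry,
    multiplied by D, is thus a polynomial in neighbour counts, and comparing it with its direct
    count yields the equations. Since h <= n for every neighbour count h into a set of size n,
    rewriting them in the slacks n - h turns them into relations between nonnegative terms, which
    leaves few solutions. Some of these fit no graph and fall only to a further count, a false-twin
    argument or parity. *)

Definition codeg (T : finType) (e : rel T) (x y : T) : nat :=
  #|[set z | e x z && e y z]|.

Definition gram (T : finType) (e : rel T) (x y : T) : int :=
  (codeg e x y)%:Z - (x == y)%:Z.

(** With numeral weights and known adjacencies the double sum is a closed term, so both sides of a
    test inequality can be evaluated by computation. *)
Definition qform (T : finType) (e : rel T) (c : int) (f g : seq (int * T)) : int :=
  \sum_(p <- f) \sum_(q <- g)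
    p.1 * q.1 * ((e p.2 q.2)%:Z + c * (p.2 == q.2)%:Z).

(* What the classification uses of the spectral hypothesis.  The Gram form is
   A^2 - I; integer combinations of vertices are lists of weighted vertices, on
   which [qform e c] is the form A + c I; [good_plus] and [good_minus] are the
   reverse Cauchy-Schwarz inequalities of A + I and I - A. *)
Record good_graph (T : finType) (e : rel T) : Prop := GoodGraph {
  good_sym : symmetric e;
  good_irr : irreflexive e;
  good_conn : forall x y, connect e x y;
  good_psd : forall x y, gram e x y ^+ 2 <= gram e x x * gram e y y;
  good_rank_le2 : forall p q x y,
    gram e p p * (gram e q q * gram e x y - gram e q y * gram e x q)
    - gram e p q * (gram e p q * gram e x y - gram e p y * gram e x q)
    + gram e p x * (gram e p q * gram e q y - gram e p y * gram e q q) = 0;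
  good_rank_ge2 : exists x y, gram e x y ^+ 2 != gram e x x * gram e y y;
  good_plus : forall f g, qform e 1 f f < 0 ->
    qform e 1 f f * qform e 1 g g <= qform e 1 f g ^+ 2;
  good_minus : forall f g, 0 < qform e (-1) f f ->
    qform e (-1) f f * qform e (-1) g g <= qform e (-1) f g ^+ 2 }.

(** * The spectral hypothesis *)

(** A Hermitian form with at most one negative direction [i0] is not negative definite on any plane.
    The combination [z] of [x] and [y] that vanishes at [i0] satisfies [0 <= Q z z], whereas
    completing the square shows that a failure of the inequality would make [Q x x * Q z z]
    positive. *)
Lemma lorentz (I : finType) (c x y : I -> algC) (i0 : I)
    (Q := fun u v : I -> algC => \sum_i c i * (u i)^* * v i) :
  (forall i, i != i0 -> 0 <= c i) ->
  Q x x \is Num.real -> Q y y \is Num.real -> Q x y \is Num.real ->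
  Q y x = Q x y -> Q x x < 0 -> Q x x * Q y y <= Q x y ^+ 2.
Proof.
move=> c_ge0 xxR yyR xyR yxE xx_lt0.
rewrite real_leNgt ?rpredM ?rpredX //; apply/negP => ltQ.
pose al := y i0; pose be := - x i0.
pose z i := al * x i + be * y i.
have be_neq0 : be != 0.
  apply/eqP => be0; have x0 : x i0 = 0 by apply/eqP; rewrite -oppr_eq0; apply/eqP.
  suff: 0 <= Q x x by rewrite lt_geF.
  rewrite /Q; apply: sumr_ge0 => i _; have [->|ni] := eqVneq i i0.
    by rewrite x0 mulr0.
  by rewrite -mulrA mulr_ge0 ?c_ge0 // mulrC mul_conjC_ge0.
have zz_ge0 : 0 <= Q z z.
  rewrite /Q; apply: sumr_ge0 => i _; have [->|ni] := eqVneq i i0.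
    by rewrite (_ : z i0 = 0) ?mulr0 // /z /al /be mulNr mulrC subrr.
  by rewrite -mulrA mulr_ge0 ?c_ge0 // mulrC mul_conjC_ge0.
have zzE : Q z z = al^* * al * Q x x + (al^* * be + be^* * al) * Q x y + be^* * be * Q y y.
  rewrite mulrDl -{2}yxE /Q !mulr_sumr -!big_split /=; apply: eq_bigr => i _.
  by rewrite /z rmorphD !rmorphM /=; ring.
have xxC : (Q x x)^* = Q x x by apply/CrealP.
have xyC : (Q x y)^* = Q x y by apply/CrealP.
have key : Q x x * Q z z = (al * Q x x + be * Q x y) * (al * Q x x + be * Q x y)^*
    + be * be^* * (Q x x * Q y y - Q x y ^+ 2).
  rewrite zzE rmorphD !rmorphM /= xxC xyC.
  by move: (Q x x) (Q x y) (Q y y) => X Y Z; ring.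
have le0 : Q x x * Q z z <= 0 by apply: mulr_le0_ge0; rewrite // ltW.
suff gt0 : 0 < Q x x * Q z z by rewrite (lt_geF gt0) in le0.
rewrite key ltr_wpDl ?mul_conjC_ge0 // mulr_gt0 ?mul_conjC_gt0 //.
by rewrite subr_gt0.
Qed.

(** The unitary diagonalization written entrywise, so that later arguments are identities between
    sums over eigenvalue indices. The diagonal agrees with the listed multiset because both give the
    same product of linear factors. *)
Lemma spectral_decomposition n (A : 'M[algC]_n) (s : seq algC) :
  A^T = A -> (forall i j, A i j \is Num.real) -> has_spectrum A s ->
  exists (d : 'I_n -> algC) (P : 'M[algC]_n),
    [/\ forall i j, A i j = \sum_k d k * (P k i)^* * P k j,
        forall i j, \sum_k (P k i)^* * P k j = (i == j)%:R,
        forall k l, \sum_i P k i * (P l i)^* = (k == l)%:R &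
        perm_eq [seq d k | k : 'I_n] s].
Proof.
move=> Asym Areal Aspec.
have Anorm : A \is normalmx.
  apply/normalmxP; rewrite Asym (_ : map_mx _ A = A) //.
  by apply/matrixP => i j; rewrite mxE; apply/CrealP.
have Pu := spectral_unitarymx A.
have /orthomx_spectralP AE := Anorm.
set P := spectralmx A in Pu AE; set d := spectral_diag A in AE.
have Pinv := invmx_unitary Pu.
have Punit := unitarymx_unit Pu.
exists (fun k => d 0 k), P; split.
- move=> i j; rewrite {1}AE Pinv mxE; apply: eq_bigr => k _.
  by rewrite mul_mx_diag !mxE; ring.
- move=> i j; have := congr1 (fun B : 'M_n => B i j) (mulVmx Punit).
  rewrite Pinv !mxE => <-; apply: eq_bigr => k _; by rewrite !mxE.
- move=> i j; have := congr1 (fun B : 'M_n => B i j) (unitarymxP Pu).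
  rewrite !mxE => <-; apply: eq_bigr => k _; by rewrite !mxE.
apply/prod_XsubC_eq; rewrite -Aspec big_map big_enum /=.
pose c := char_poly (diag_mx d).
have -> : \prod_(i : 'I_n) ('X - (d 0 i)%:P) = c.
  rewrite /c char_poly_trig ?diag_mx_is_trig //; apply: eq_bigr => i _.
  by rewrite mxE eqxx mulr1n.
have invP : map_mx polyC (invmx P) *m map_mx polyC P = 1%:M.
  by rewrite -map_mxM mulVmx // map_scalar_mx.
have Ppoly B : char_poly_mx (invmx P *m B *m P) =
    map_mx polyC (invmx P) *m char_poly_mx B *m map_mx polyC P.
  rewrite /char_poly_mx mulmxBr mulmxBl !map_mxM /=.
  by rewrite mul_mx_scalar -scalemxAl invP scalemx1.
rewrite /char_poly {1}AE Ppoly !det_mulmx mulrAC -det_mulmx invP.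
by rewrite det1 mul1r.
Qed.

Lemma castmx_char_poly n m (E : n = m) (A : 'M[algC]_n) :
  char_poly (castmx (E, E) A) = char_poly A.
Proof. by case: m / E; rewrite castmx_id. Qed.

Lemma char_poly_reorder n (A : 'M[algC]_n) (s : 'S_n) :
  char_poly (\matrix_(i, j) A (s i) (s j)) = char_poly A.
Proof.
rewrite /char_poly.
have -> : char_poly_mx (\matrix_(i, j) A (s i) (s j)) =
    row_perm s (col_perm s (char_poly_mx A)).
  by apply/matrixP => i j; rewrite !mxE (inj_eq perm_inj).
rewrite row_permE col_permE !det_mulmx !det_perm odd_permV mulrC -mulrA.
by rewrite -signr_addb addbb mulr1.
Qed.

Lemma spectral_term (R : comPzRingType) (d c u v P Q : R) :
  u * v * (d * P * Q + c * (P * Q)) = (d + c) * (u * P) * (v * Q).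
Proof. by ring. Qed.

(** Cauchy-Binet for two weighted vectors; when the r and s are conjugates of the p and q, the minor
    is [a * b] times a squared modulus. *)
Lemma gram2_det (R : comPzRingType) (a b p1 p2 q1 q2 r1 r2 s1 s2 : R) :
  (a * r1 * p1 + b * s1 * q1) * (a * r2 * p2 + b * s2 * q2)
  - (a * r1 * p2 + b * s1 * q2) * (a * r2 * p1 + b * s2 * q1)
  = a * b * ((r1 * s2 - r2 * s1) * (p1 * q2 - p2 * q1)).
Proof. by ring. Qed.

Lemma gram3_det (R : comPzRingType) (a b p1 p2 p3 q1 q2 q3 r1 r2 r3 s1 s2 s3 : R)
    (G := fun r s p q : R => a * r * p + b * s * q) :
  G r1 s1 p1 q1 * (G r2 s2 p2 q2 * G r3 s3 p3 q3 - G r2 s2 p3 q3 * G r3 s3 p2 q2)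
  - G r2 s2 p1 q1 * (G r1 s1 p2 q2 * G r3 s3 p3 q3 - G r1 s1 p3 q3 * G r3 s3 p2 q2)
  + G r3 s3 p1 q1 * (G r1 s1 p2 q2 * G r2 s2 p3 q3 - G r1 s1 p3 q3 * G r2 s2 p2 q2)
  = 0.
Proof. by rewrite /G; ring. Qed.

Lemma inG_good_graph n (e : rel 'I_n) :
  symmetric e -> irreflexive e -> inG e -> good_graph e.
Proof.
move=> e_sym e_irr [e_conn [s [Aspec [r [t [r_gt1 [t_ltN1 s_rt]]]]]]].
have Asym : (adjmx e)^T = adjmx e.
  by apply/matrixP => i j; rewrite !mxE e_sym.
have Areal i j : adjmx e i j \is Num.real by rewrite mxE realn.
have [d [P [AE Pcol Prow dperm]]] := spectral_decomposition Asym Areal Aspec.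
have r_t : r != t.
  by rewrite gt_eqF // (lt_trans t_ltN1) // (lt_trans (ltrN10 _)) // (lt_trans ltr01).
have [ir [it [dr dt ir_it dE]]] : exists ir it, [/\ d ir = r, d it = t, ir != it &
    forall k, k != ir -> k != it -> d k = 1 \/ d k = -1].
  set I := [seq k <- enum 'I_n | (d k != 1) && (d k != -1)].
  have dI : perm_eq [seq d k | k <- I] [:: r; t].
    rewrite -(filter_map _ (fun x => (x != 1) && (x != -1))).
    by apply: perm_trans s_rt; apply: perm_filter.
  have /mapP[ir irI rE] : r \in [seq d k | k <- I] by rewrite (perm_mem dI) mem_head.
  have /mapP[it itI tE] : t \in [seq d k | k <- I].
    by rewrite (perm_mem dI) !inE eqxx orbT.
  have ir_it : ir != it by apply: contraNneq r_t; rewrite rE tE => ->.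
  exists ir, it; split=> // k k_ir k_it.
  have [kI|] := boolP (k \in I).
    have u3 : uniq [:: ir; it; k].
      by rewrite /= !inE negb_or ir_it eq_sym k_ir eq_sym k_it.
    have sub3 : {subset [:: ir; it; k] <= I}.
      by move=> x; rewrite !inE => /or3P[] /eqP->.
    by have := uniq_leq_size u3 sub3; rewrite -(size_map d I) (perm_size dI).
  rewrite mem_filter mem_enum andbT negb_and !negbK.
  by case/orP=> /eqP ->; [left|right].
pose ca : algC := r ^+ 2 - 1; pose cb : algC := t ^+ 2 - 1.
have ca_gt0 : 0 < ca by rewrite subr_gt0 exprn_egt1.
have cb_gt0 : 0 < cb by rewrite subr_gt0 -sqrrN exprn_egt1 // ltrNr.
pose p := P ir; pose q := P it.
have A2E x y : (codeg e x y)%:R = \sum_k d k ^+ 2 * (P k x)^* * P k y :> algC.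
  have -> : (codeg e x y)%:R = \sum_z adjmx e x z * adjmx e z y :> algC.
    rewrite /codeg -sum1_card natr_sum big_mkcond /=; apply: eq_bigr => z _.
    by rewrite inE !mxE [e z y]e_sym; case: (e x z); case: (e y z); rewrite ?mulr0 ?mul0r ?mulr1.
  under eq_bigr do rewrite !AE mulr_suml.
  rewrite exchange_big /=; apply: eq_bigr => k _.
  transitivity (\sum_l d k * (P k x)^* * d l * P l y * (k == l)%:R).
    under [RHS]eq_bigr do rewrite -Prow mulr_sumr.
    rewrite exchange_big /=; apply: eq_bigr => z _; rewrite mulr_sumr.
    have ac (a1 a2 a3 a4 a5 a6 : algC) :
      a1 * a5 * a3 * (a2 * a6 * a4) = a1 * a5 * a2 * a4 * (a3 * a6) by ring.
    by apply: eq_bigr => l _; apply: ac.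
  rewrite (bigD1 k) //= eqxx big1 ?addr0; first last.
    by move=> l /negPf lk; rewrite eq_sym lk mulr0.
  by rewrite mulr1 expr2 -!mulrA; congr (_ * _); rewrite mulrCA.
(* A^2 - I vanishes on the eigenspaces of 1 and -1, so only the indices of [r] and [t] survive. *)
have gramE x y : (gram e x y)%:~R = ca * (p x)^* * p y + cb * (q x)^* * q y :> algC.
  rewrite /gram rmorphB /= -!pmulrn A2E -Pcol -sumrB.
  rewrite (bigD1 ir) //= (bigD1 it) 1?eq_sym //= big1 ?addr0.
    by rewrite dr dt !mulrBl !mul1r.
  move=> k /andP[k_ir k_it].
  by case: (dE k k_ir k_it) => ->; rewrite ?sqrrN expr1n mul1r subrr.
pose xi f k : algC := \sum_(u <- f) (u : int * 'I_n).1%:~R * P k u.2.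
have qformE c f g : (qform e c f g)%:~R =
    \sum_k (d k + c%:~R) * (xi f k)^* * xi g k :> algC.
  rewrite /qform rmorph_sum /=.
  transitivity (\sum_(u <- f) \sum_(v <- g) \sum_k
      (d k + c%:~R) * (u.1%:~R * (P k u.2)^*) * (v.1%:~R * P k v.2)); last first.
    under [LHS]eq_bigr => u _ do rewrite exchange_big /=.
    rewrite exchange_big /=; apply: eq_bigr => k _.
    rewrite /xi rmorph_sum /= -mulrA mulr_suml mulr_sumr; apply: eq_bigr => u _.
    rewrite rmorphM rmorph_int !mulr_sumr; apply: eq_bigr => v _.
    by rewrite mulrA.
  apply: eq_bigr => u _; rewrite rmorph_sum /=; apply: eq_bigr => v _.
  rewrite !rmorphM rmorphD rmorphM /= -!pmulrn -Pcol.
  have -> : (e u.2 v.2)%:R = adjmx e u.2 v.2 by rewrite mxE.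
  rewrite AE mulr_sumr -big_split /= mulr_sumr; apply: eq_bigr => k _.
  exact: spectral_term.
have qform_sym c f g : qform e c f g = qform e c g f.
  rewrite /qform exchange_big; apply: eq_bigr => u _; apply: eq_bigr => v _.
  by rewrite [v.1 * _]mulrC e_sym [v.2 == _]eq_sym.
have gram_sym x y : gram e x y = gram e y x.
  by rewrite /gram /codeg eq_sym; under eq_finset do rewrite andbC.
split=> //.
- move=> x y; rewrite -(ler_int algC) rmorphXn rmorphM /= -subr_ge0 expr2.
  rewrite {2}(gram_sym x y) !gramE gram2_det.
  apply: mulr_ge0; first by rewrite mulr_ge0 ?ltW.
  rewrite (_ : (p x)^* * (q y)^* - (p y)^* * (q x)^* = (p x * q y - p y * q x)^*).
    by rewrite mulrC mul_conjC_ge0.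
  by rewrite rmorphB !rmorphM.
- move=> x1 x2 x y.
  have := gram3_det ca cb (p x1) (p x2) (p y) (q x1) (q x2) (q y)
    (p x1)^* (p x2)^* (p x)^* (q x1)^* (q x2)^* (q x)^*.
  rewrite /= -!gramE -!(rmorphM, rmorphB, rmorphD) /=.
  by move/eqP; rewrite intr_eq0 (gram_sym x2 x1) (gram_sym x x1) => /eqP.
(* If all 2 x 2 minors vanished, the eigenvectors [p] and [q] would be proportional; being
   orthogonal, they would force [q] = 0, although [q] has norm one. *)
- have [/existsP[x /existsP[y xy]]|] := boolP [exists x, [exists y,
    gram e x y ^+ 2 != gram e x x * gram e y y]]; first by exists x, y.
  rewrite negb_exists => /forallP all0.
  have pq0 x y : p x * q y = p y * q x.
    have := all0 x; rewrite negb_exists => /forallP/(_ y); rewrite negbK => /eqP xy.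
    have : (gram e x x)%:~R * (gram e y y)%:~R - (gram e x y)%:~R * (gram e y x)%:~R = 0 :> algC.
      by rewrite -!rmorphM -rmorphB /= (gram_sym y x) -expr2 xy subrr.
    rewrite !gramE gram2_det => /eqP; rewrite !mulf_eq0 gt_eqF // gt_eqF //=.
    rewrite (_ : (p x)^* * (q y)^* - (p y)^* * (q x)^* = (p x * q y - p y * q x)^*).
      by rewrite conjC_eq0 orbb subr_eq0 => /eqP.
    by rewrite rmorphB !rmorphM.
  have q0 y : q y = 0.
    have /eqP := Prow ir ir; rewrite eqxx => /eqP p1.
    rewrite -[q y]mulr1 -[1]p1 mulr_sumr.
    transitivity (p y * \sum_x q x * (p x)^*).
      rewrite mulr_sumr; apply: eq_bigr => x _.
      by rewrite mulrA [q y * _]mulrC pq0 mulrA.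
    by rewrite Prow eq_sym (negPf ir_it) mulr0.
  have := Prow it it; rewrite eqxx big1 => [/eqP|i _]; first by rewrite eq_sym oner_eq0.
  by rewrite -/q q0 mul0r.
- move=> f g; rewrite -(ltr_int algC) -(ler_int algC) rmorphM rmorphXn /=.
  rewrite !qformE; apply: (lorentz (i0 := it)).
  + move=> k k_it; have [->|k_ir] := eqVneq k ir.
      by rewrite dr ltW // addr_gt0 // (lt_trans ltr01).
    by case: (dE k k_ir k_it) => ->; rewrite ?subrr ?addNr // addr_ge0.
  + by rewrite -qformE rpred_int.
  + by rewrite -qformE rpred_int.
  + by rewrite -qformE rpred_int.
  + by rewrite -!qformE qform_sym.
(* The form is negated to I - A, whose only negative coefficient is 1 - r. *)
- move=> f g; rewrite -[_ < _]oppr_lt0 -mulrNN -sqrrN.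
  rewrite -(ltr_int algC) -(ler_int algC) rmorphM rmorphXn /=.
  have mqE h l : (- qform e (-1) h l)%:~R =
      \sum_k (1 - d k) * (xi h k)^* * xi l k :> algC.
    rewrite rmorphN /= qformE -sumrN; apply: eq_bigr => k _.
    by rewrite (_ : (-1)%:~R = -1 :> algC) // -!mulNr opprB.
  rewrite !mqE; apply: (lorentz (i0 := ir)).
  + move=> k k_ir; have [->|k_it] := eqVneq k it.
      by rewrite dt subr_ge0 ltW // (lt_trans t_ltN1) // (lt_trans (ltrN10 _)).
    by case: (dE k k_ir k_it) => ->; rewrite ?subrr ?opprK // addr_ge0.
  + by rewrite -mqE rpred_int.
  + by rewrite -mqE rpred_int.
  + by rewrite -mqE rpred_int.
  + by rewrite -!mqE qform_sym.
Qed.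

(** * Graphs with a triangle *)

Section GoodGraph.

Variables (T : finType) (e : rel T).
Hypothesis ge : good_graph e.

Let e_sym : symmetric e := good_sym ge.
Let e_irr : irreflexive e := good_irr ge.

Lemma gram_sym x y : gram e x y = gram e y x.
Proof.
by rewrite /gram /codeg eq_sym; under eq_finset do rewrite andbC.
Qed.

Lemma edge_neq x y : e x y -> x != y.
Proof. by apply: contraTneq => ->; rewrite e_irr. Qed.

Lemma gram_neq x y : x != y -> gram e x y = (codeg e x y)%:Z.
Proof. by move=> /negPf xy; rewrite /gram xy subr0. Qed.

Lemma gramxx x : gram e x x = #|[set z | e x z]|%:Z - 1.
Proof.
by rewrite /gram /codeg eqxx; under eq_finset do rewrite andbb.
Qed.

(* Two vertices with the same neighbourhood of size d would have Gram
   determinant (d-1)^2 - d^2 < 0. *)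
Lemma no_false_twins x y : e x =1 e y -> (exists z, e x z) -> x = y.
Proof.
move=> xy [z0 xz0]; apply/eqP/negPn/negP => x_y.
have := good_psd ge x y; rewrite gram_neq // !gramxx /codeg.
have -> : [set z | e x z && e y z] = [set z | e x z].
  by apply/setP => z; rewrite !inE xy andbb.
have -> : [set z | e y z] = [set z | e x z] by apply/setP => z; rewrite !inE xy.
have : (0 < #|[set z | e x z]|)%N by apply/card_gt0P; exists z0; rewrite inE.
by set d := #|_|; nia.
Qed.

Lemma closed_set_full (S : pred T) x0 : S x0 ->
  (forall x y, S x -> e x y -> S y) -> forall x, S x.
Proof.
move=> Sx0 Scl x; have /connectP[p] := good_conn ge x0 x.
elim: p x0 Sx0 => [|z p IHp] x0 Sx0 /=; first by move=> _ ->.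
by case/andP => /(Scl _ _ Sx0) Sz /IHp; apply.
Qed.

(** For A + I the vectors k2 - k1 and k3 - k1 are isotropic and orthogonal to each other. Three
    distinct points (e v k, e w k) of the unit square are affinely independent, so adding
    combinations of these differences to [v] and [w] prescribes their mutual products and norms. The
    result is a pair of orthogonal vectors of norm -1, against [good_plus]. *)
Lemma clique_traces k1 k2 k3 v w :
  e k1 k2 -> e k1 k3 -> e k2 k3 -> v != w ->
  v \notin [:: k1; k2; k3] -> w \notin [:: k1; k2; k3] ->
  (e v k1, e w k1) != (e v k2, e w k2) ->
  (e v k1, e w k1) != (e v k3, e w k3) ->
  (e v k2, e w k2) != (e v k3, e w k3) -> False.
Proof.
move=> e12 e13 e23 v_w; rewrite !inE !negb_or.
move=> /and3P[v1 v2 v3] /and3P[w1 w2 w3].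
pose a1 := (e v k1)%:Z; pose a2 := (e v k2)%:Z - a1; pose a3 := (e v k3)%:Z - a1.
pose b1 := (e w k1)%:Z; pose b2 := (e w k2)%:Z - b1; pose b3 := (e w k3)%:Z - b1.
(* [del] is the determinant of the products of k2 - k1 and k3 - k1 with [v] and [w], equal to 1 or
   -1. By Cramer's rule [s] and [t] give the combination whose products with [v] and [w] are [p] and
   [q]. *)
pose del := a2 * b3 - a3 * b2.
pose s p q := del * (p * b3 - q * a3); pose t p q := del * (q * a2 - p * b2).
pose mk p q z := [:: (1, z); (- s p q - t p q, k1); (s p q, k2); (t p q, k3)].
(* Both vectors get norm 1 - 2 = -1, and the parameter [- e v w] in the second cancels their
   product. *)
have := @good_plus _ _ ge (mk (-1) 0 v) (mk (- (e v w)%:Z) (-1) w).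
rewrite /mk /s /t /del /qform !big_cons !big_nil /=.
rewrite !e_irr !eqxx [e k2 k1]e_sym [e k3 k1]e_sym [e k3 k2]e_sym e12 e13 e23.
rewrite [e k1 v]e_sym [e k2 v]e_sym [e k3 v]e_sym.
rewrite [e k1 w]e_sym [e k2 w]e_sym [e k3 w]e_sym.
rewrite [k2 == k1]eq_sym [k3 == k1]eq_sym [k3 == k2]eq_sym.
rewrite [k1 == v]eq_sym [k2 == v]eq_sym [k3 == v]eq_sym.
rewrite [k1 == w]eq_sym [k2 == w]eq_sym [k3 == w]eq_sym.
rewrite !(negPf (edge_neq e12), negPf (edge_neq e13), negPf (edge_neq e23)).
rewrite (negPf v_w) (negPf v1) (negPf v2) (negPf v3) (negPf w1) (negPf w2) (negPf w3).
rewrite /a2 /a3 /b2 /b3 /a1 /b1.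
by case: (e v k1); case: (e v k2); case: (e v k3); case: (e w k1); case: (e w k2);
  case: (e w k3); case: (e v w); vm_compute => // /(_ isT).
Qed.

End GoodGraph.

(* A maximum clique K together with the traces of the other vertices on it:
   [Some (b, true)] labels the two halves K_b of K, [Some (b, false)] the
   outside vertices V_b with trace K_b, and [None] those with empty trace. *)
Definition label : finType := option (bool * bool).

Record clique_labelling (T : finType) (e : rel T) (lab : T -> label) : Prop :=
  CliqueLabelling {
  lab_clique : forall x y b b', lab x = Some (b, true) -> lab y = Some (b', true) ->
    x != y -> e x y;
  lab_trace : forall x y b b', lab x = Some (b, true) -> lab y = Some (b', false) ->
    e x y = (b == b');
  lab_no_trace : forall x y b, lab x = Some (b, true) -> lab y = None -> e x y = false;
  lab_clique_neq0 : forall b : bool, exists x, lab x = Some (b, true);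
  lab_big : (2 < #|[set x | lab x == Some (true, true)]|
               + #|[set x | lab x == Some (false, true)]|)%N;
  lab_max : forall (b : bool) x y, #|[set x | lab x == Some (~~ b, true)]| = 1%N ->
    lab x = Some (b, false) -> lab y = Some (b, false) -> ~~ e x y;
  lab_outside : exists b x, lab x = Some (b, false) }.

(** * Labelling by traces on a maximum clique *)

Section CliqueLabelling.

Variables (T : finType) (e : rel T).
Hypothesis ge : good_graph e.

Let e_sym : symmetric e := good_sym ge.
Let e_irr : irreflexive e := good_irr ge.

Definition clique (K : {set T}) := [forall x in K, forall y in K, (x != y) ==> e x y].

Lemma cliqueP (K : {set T}) :
  reflect {in K &, forall x y, x != y -> e x y} (clique K).
Proof.
apply: (iffP forall_inP) => [H x y xK yK|H x xK].
  by have /forall_inP/(_ _ yK)/implyP := H x xK.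
by apply/forall_inP => y yK; apply/implyP; apply: H.
Qed.

Lemma clique_setU1 (K : {set T}) x : clique K -> {in K, forall y, e x y} ->
  clique (x |: K).
Proof.
move=> /cliqueP Kc xK; apply/cliqueP => y z /setU1P[->|yK] /setU1P[->|zK].
- by rewrite eqxx.
- by move=> _; apply: xK.
- by move=> _; rewrite e_sym; apply: xK.
- exact: Kc.
Qed.

(** In a complete graph every Gram entry equals |T| - 2, so the Gram form would have rank at most
    one. *)
Lemma not_complete : exists x y, x != y /\ ~~ e x y.
Proof.
have [/existsP[x /existsP[y /andP[]]]|] := boolP [exists x, exists y, (x != y) && ~~ e x y].
  by exists x, y.
rewrite negb_exists => /forallP all_e.
have eE x y : e x y = (x != y).
  have := all_e x; rewrite negb_exists => /forallP/(_ y).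
  rewrite negb_and negbK; case: eqVneq => [->|_] /=; first by rewrite e_irr.
  by rewrite negbK.
have gE x y : gram e x y = #|T|%:Z - 2.
  have [->|x_y] := eqVneq x y.
    rewrite gramxx; have -> : [set z | e y z] = [set~ y].
      by apply/setP => z; rewrite !inE eE eq_sym.
    have := cardsC1 y; have : (0 < #|T|)%N by apply/card_gt0P; exists y.
    lia.
  rewrite gram_neq // /codeg; have -> : [set z | e x z && e y z] = ~: [set x; y].
    by apply/setP => z; rewrite !inE !eE negb_or ![z == _]eq_sym.
  have := cardsC [set x; y]; rewrite cards2 x_y; lia.
by have [x [y]] := good_rank_ge2 ge; rewrite !gE expr2 eqxx.
Qed.

Lemma exists_clique_labelling x y z : e x y -> e x z -> e y z ->
  exists lab, clique_labelling e lab.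
Proof.
move=> exy exz eyz.
have c3 : clique [set x; y; z].
  apply/cliqueP => u v; rewrite !inE -!orbA.
  by case/or3P=> /eqP->; case/or3P=> /eqP->; rewrite ?eqxx // e_sym.
have [K cK Kmax] := @arg_maxnP _ [set x; y; z] clique (fun K => #|K|) c3.
have {}Kmax C : clique C -> (#|C| <= #|K|)%N by move=> /Kmax.
have K3 : (2 < #|K|)%N.
  apply: leq_trans (Kmax _ c3).
  rewrite setUC cardsU1 cards2 !inE ![z == _]eq_sym.
  by rewrite !(negPf (edge_neq ge _)).
have /cliqueP Ke := cK.
have Kfull v : v \notin K -> exists2 k, k \in K & ~~ e v k.
  move=> vK; apply/exists_inP; rewrite -negb_forall_in; apply/negP => /forall_inP vKe.
  by have := Kmax _ (clique_setU1 cK vKe); rewrite cardsU1 vK ltnn.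
have [k0 k0K] : exists k, k \in K by apply/card_gt0P; apply: ltn_trans K3.
have [v vK [k1 k1K evk1]] : exists2 v, v \notin K & exists2 k, k \in K & e v k.
  have [/existsP[v /andP[vK /exists_inP vk]]|] :=
    boolP [exists v, (v \notin K) && [exists k in K, e v k]]; first by exists v.
  rewrite negb_exists => /forallP noK.
  have Kall : forall u, u \in K.
    apply: (closed_set_full ge (S := mem K) k0K) => u w uK euw /=.
    apply/negPn/negP => wK; have /negP := noK w; apply; rewrite wK.
    by apply/exists_inP; exists u; rewrite // e_sym.
  have [u [w [u_w /negP[]]]] := not_complete.
  by apply: Ke; rewrite ?Kall.
have [k2 k2K evk2] := Kfull v vK.
have out u k : u \notin K -> k \in K -> u != k
  by move=> uK kK; apply: contraNneq uK => ->.
have two w : w \notin K -> (exists2 k, k \in K & e w k) ->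
    {in K, forall k, e w k = e v k} \/ {in K, forall k, e w k = ~~ e v k}.
  move=> wK [l1 l1K ewl1]; have [l2 l2K ewl2] := Kfull w wK.
  have [->|v_w] := eqVneq w v; first by left.
  have tri p q r : p \in K -> q \in K -> r \in K ->
      (e v p, e w p) != (e v q, e w q) -> (e v p, e w p) != (e v r, e w r) ->
      (e v q, e w q) != (e v r, e w r) -> False.
    move=> pK qK rK pq pr qr; rewrite eq_sym in v_w.
    have dif p' q' : (e v p', e w p') != (e v q', e w q') -> p' != q'.
      by apply: contraNneq => ->.
    apply: (clique_traces ge (k1 := p) (k2 := q) (k3 := r) (v := v) (w := w)) => //;
      rewrite ?Ke ?dif // !inE !negb_or !out //.
  have [/forall_inP same|] := boolP [forall k in K, e w k == e v k].
    by left=> k /same/eqP.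
  rewrite negb_forall_in => /exists_inP[p pK wp].
  right=> q qK; apply/eqP/negPn/negP => wq.
  (* The traces differ at [p] and agree at [q], so exactly one of [v], [w] has the same adjacency to
     both. Its trace is nonempty and proper, so some clique vertex has the other adjacency and
     supplies the third distinct pair. *)
  have [r [rK pr qr]] : exists r, [/\ r \in K, (e v p, e w p) != (e v r, e w r) &
      (e v q, e w q) != (e v r, e w r)].
    case: (eqVneq (e v p) (e v q)) => [vpq|vpq].
      case: (boolP (e v p)) => vp; [exists k2|exists k1]; split=> //;
        by rewrite xpair_eqE negb_and -?vpq ?(negPf evk2) ?evk1 ?(negPf vp) ?vp.
    have wpq : e w p = e w q.
      by move: wp wq vpq; case: (e w p); case: (e v p); case: (e w q); case: (e v q).
    case: (boolP (e w p)) => wp'; [exists l2|exists l1]; split=> //;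
      by rewrite xpair_eqE negb_and -?wpq ?(negPf ewl2) ?ewl1 ?(negPf wp') ?wp' orbT.
  apply: (tri p q r) => //; rewrite xpair_eqE negb_and.
  by move: wp wq; case: (e w p); case: (e v p); case: (e w q); case: (e v q).
(* [k1] lies in the trace of [v], so adjacency to [k1] tells which of the two complementary traces
   [u] has. *)
pose lab u : label := if u \in K then Some (e v u, true)
  else if [exists k in K, e u k] then Some (e u k1, false) else None.
have labK b u : lab u = Some (b, true) <-> u \in K /\ e v u = b.
  rewrite /lab; case: ifP => uK; first by split=> [[<-]|[_ ->]].
  by case: ifP => _; split=> // -[].
have labV b u : lab u = Some (b, false) -> u \notin K /\ {in K, forall k, e u k = (e v k == b)}.
  rewrite /lab; case: ifP => // /negbT uK; case: ifP => // /exists_inP uk [<-].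
  split=> //; case: (two u uK uk) => uE k kK.
    by rewrite !uE // evk1; case: (e v k).
  by rewrite !uE // evk1; case: (e v k).
have labZ u : lab u = None -> u \notin K /\ {in K, forall k, e u k = false}.
  rewrite /lab; case: ifP => // /negbT uK; case: ifP => // /negbT.
  by rewrite negb_exists_in => /forall_inP nu _; split=> // k /nu/negPf.
exists lab; split.
- by move=> p q b b' /labK[pK _] /labK[qK _]; apply: Ke.
- by move=> p q b b' /labK[pK <-] /labV[_ qE]; rewrite e_sym qE.
- by move=> p q b /labK[pK _] /labZ[_ qE]; rewrite e_sym qE.
- case; first by exists k1; apply/labK.
  by exists k2; apply/labK; split=> //; apply: negPf.
- apply: leq_trans K3 _; rewrite -(cardsID [set u | e v u] K).
  apply: leq_add; apply: subset_leq_card; apply/subsetP => u; rewrite !inE.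
    by case/andP => uK vu; apply/eqP/labK.
  by case/andP => vu uK; apply/eqP/labK; split=> //; apply: negPf.
(* When K_{~~ b} is the single vertex [k], exchanging [k] for the two ends of an edge inside V_b
   would enlarge K. *)
- move=> b p q /eqP/cards1P[k kE] /labV[pK pE] /labV[qK qE]; apply/negP => epq.
  have kP u : u \in K -> (e v u == ~~ b) = (u == k).
    move=> uK; have := in_set1 u k; rewrite -kE inE => <-.
    by apply/eqP/eqP => [vu|/labK[]//]; apply/labK.
  have kK : k \in K by have := set11 k; rewrite -kE inE => /eqP/labK[].
  have cl : clique (p |: (q |: (K :\ k))).
    apply: clique_setU1; first apply: clique_setU1.
    - by apply/cliqueP => u w /setD1P[_ uK] /setD1P[_ wK]; apply: Ke.
    - move=> u /setD1P[uk uK]; rewrite qE //; have := kP u uK; rewrite (negPf uk).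
      by case: (e v u); case: (b).
    - move=> u /setU1P[-> //|/setD1P[uk uK]]; rewrite pE //.
      by have := kP u uK; rewrite (negPf uk); case: (e v u); case: (b).
  have := Kmax _ cl; rewrite !cardsU1 !inE (negPf pK) (negPf qK) (negPf (edge_neq ge epq)).
  by rewrite !andbF /= (cardsD1 k K) kK /= add1n add1n ltnn.
- exists true, v; rewrite /lab (negPf vK) evk1 ifT //; apply/exists_inP.
  by exists k1.
Qed.

End CliqueLabelling.

Lemma edgeE (T : finType) (e : rel T) (ge : good_graph e) x y : e x y ->
  (e x y = true) * (e y x = true) * ((x == y) = false) * ((y == x) = false).
Proof.
move=> xy; have /negPf n := edge_neq ge xy.
by rewrite (good_sym ge y) xy [y == x]eq_sym n.
Qed.

Lemma nonedgeE (T : finType) (e : rel T) (ge : good_graph e) x y : x != y -> e x y = false ->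
  (e x y = false) * (e y x = false) * ((x == y) = false) * ((y == x) = false).
Proof. by move=> /negPf n xy; rewrite (good_sym ge y) xy [y == x]eq_sym n. Qed.

(** * Edges among the vertices outside the clique *)

Section LabelledGraph.

Variables (T : finType) (e : rel T) (lab : T -> label).
Hypotheses (ge : good_graph e) (hl : clique_labelling e lab).

Let e_sym : symmetric e := good_sym ge.
Let e_irr : irreflexive e := good_irr ge.

Local Notation nK b := #|[set x | lab x == Some (b, true)]|.

Lemma lab_neq x y l l' : lab x = l -> lab y = l' -> l != l' -> x != y.
Proof. by move=> <- <-; apply: contraNneq => ->. Qed.

Lemma nK_gt0 (b : bool) : (0 < nK b)%N.
Proof. by have [x xb] := lab_clique_neq0 hl b; apply/card_gt0P; exists x; rewrite inE xb. Qed.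

Lemma nK_big (b : bool) : (2 < nK b + nK (~~ b))%N.
Proof. by have := lab_big hl; case: b; rewrite //= addnC. Qed.

Lemma nK_triangle : exists p q r b1 b2 b3,
  [/\ lab p = Some (b1, true), lab q = Some (b2, true), lab r = Some (b3, true),
      p != q & p != r /\ q != r].
Proof.
have [b b2] : exists b, (1 < nK b)%N.
  have [?|le1] := ltnP 1 (nK true); first by exists true.
  exists false; have := nK_big true => /=.
  by move: le1; lia.
have /card_gt1P[p [q [+ + pq]]] := b2; rewrite !inE => /eqP pb /eqP qb.
have [r rb] := lab_clique_neq0 hl (~~ b).
exists p, q, r, b, b, (~~ b); split=> //.
by split; apply: (lab_neq _ rb); eauto; case: (b).
Qed.

(** For A - I a triangle of K and the connected triple u, x, y would be two positive vectors; with
    no edges between them they would also be orthogonal. *)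
Lemma empty_trace_deg u : lab u = None ->
  (#|[set z | (lab z == None) && e u z]| <= 1)%N.
Proof.
move=> u0; rewrite leqNgt; apply/negP => /card_gt1P[x [y [+ + xy]]].
rewrite !inE => /andP[/eqP x0 ux] /andP[/eqP y0 uy].
have [p [q [r [b1 [b2 [b3 [pl ql rl pq [pr qr]]]]]]]] := nK_triangle.
have KZ k z b : lab k = Some (b, true) -> lab z = None ->
    (e k z = false) * (e z k = false) * ((k == z) = false) * ((z == k) = false).
  move=> kb z0; apply: nonedgeE; rewrite ?(lab_no_trace hl kb z0) //.
  exact: (lab_neq kb z0).
have epq := lab_clique hl pl ql pq; have epr := lab_clique hl pl rl pr.
have eqr := lab_clique hl ql rl qr.
have := @good_minus _ _ ge [:: (1, p); (1, q); (1, r)] [:: (1, u); (1, x); (1, y)].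
rewrite /qform !big_cons !big_nil /= !eqxx !e_irr.
rewrite !(edgeE ge epq, edgeE ge epr, edgeE ge eqr, edgeE ge ux, edgeE ge uy).
rewrite !(KZ _ _ _ pl u0, KZ _ _ _ ql u0, KZ _ _ _ rl u0, KZ _ _ _ pl x0, KZ _ _ _ ql x0).
rewrite !(KZ _ _ _ rl x0, KZ _ _ _ pl y0, KZ _ _ _ ql y0, KZ _ _ _ rl y0).
rewrite [e y x]e_sym [y == x]eq_sym (negPf xy).
by case: (e x y); vm_compute => /(_ isT).
Qed.

Lemma lab_adj (b : bool) k v : lab k = Some (b, true) -> lab v = Some (b, false) -> e k v.
Proof. by move=> kb vb; rewrite (lab_trace hl kb vb) eqxx. Qed.

Lemma lab_nadj (b : bool) k v : lab k = Some (~~ b, true) -> lab v = Some (b, false) ->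
  (e k v = false) * (e v k = false) * ((k == v) = false) * ((v == k) = false).
Proof.
move=> kb vb; apply: nonedgeE => //; first by apply: (lab_neq kb vb); case: (b).
by rewrite (lab_trace hl kb vb); case: (b).
Qed.

(** If K_{~~ b} is a singleton, [lab_max] leaves no edge in V_b. Otherwise, with p, q in K_{~~ b}
    and k in K_b, the vector 4p + 4q + k has norm 15 for A - I, v + x + y has norm at least 1, and
    their product is 3, so the square 9 is too small. *)
Lemma half_deg (b : bool) v : lab v = Some (b, false) ->
  (#|[set z | (lab z == Some (b, false)) && e v z]| <= 1)%N.
Proof.
move=> vb; rewrite leqNgt; apply/negP => /card_gt1P[x [y [+ + xy]]].
rewrite !inE => /andP[/eqP xb vx] /andP[/eqP yb vy].
have [k kb] := lab_clique_neq0 hl b.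
have [le1|] := leqP (nK (~~ b)) 1.
  have /(lab_max hl)/(_ vb xb) : nK (~~ b) = 1%N.
    by apply/eqP; rewrite eqn_leq le1 nK_gt0.
  by rewrite vx.
move=> /card_gt1P[p [q [+ + pq]]]; rewrite !inE => /eqP pb /eqP qb.
have kp : e k p by apply: (lab_clique hl kb pb (lab_neq kb pb _)); case: (b).
have kq : e k q by apply: (lab_clique hl kb qb (lab_neq kb qb _)); case: (b).
have epq := lab_clique hl pb qb pq.
have := @good_minus _ _ ge [:: (4, p); (4, q); (1, k)] [:: (1, v); (1, x); (1, y)].
rewrite /qform !big_cons !big_nil /= !eqxx !e_irr.
rewrite !(edgeE ge kp, edgeE ge kq, edgeE ge epq, edgeE ge vx, edgeE ge vy).
rewrite !(edgeE ge (lab_adj kb vb), edgeE ge (lab_adj kb xb), edgeE ge (lab_adj kb yb)).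
rewrite !(lab_nadj pb vb, lab_nadj pb xb, lab_nadj pb yb).
rewrite !(lab_nadj qb vb, lab_nadj qb xb, lab_nadj qb yb).
rewrite [e y x]e_sym [y == x]eq_sym (negPf xy).
by case: (e x y); vm_compute => /(_ isT).
Qed.

(** [lab_max] excludes size one. Three vertices p, q, r of K_{~~ b} would give p + q + r of norm 3
    and 4v + 4x + k of norm 15 for A - I with product 3, and 45 > 9. *)
Lemma half_edge_size (b : bool) v x : lab v = Some (b, false) -> lab x = Some (b, false) ->
  e v x -> nK (~~ b) = 2%N.
Proof.
move=> vb xb vx; have [k kb] := lab_clique_neq0 hl b.
have n1 : nK (~~ b) != 1%N.
  by apply/eqP => /(lab_max hl)/(_ vb xb); rewrite vx.
have n2 : (1 < nK (~~ b))%N by rewrite ltn_neqAle eq_sym n1 nK_gt0.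
apply/eqP; rewrite eqn_leq n2 andbT leqNgt; apply/negP.
move=> /card_gt2P[p [q [r [[+ + +] [pq qr rp]]]]].
rewrite !inE => /eqP pb /eqP qb /eqP rb.
have kz z : lab z = Some (~~ b, true) -> e k z.
  by move=> zb; apply: (lab_clique hl kb zb); apply: (lab_neq kb zb); case: (b).
have epq := lab_clique hl pb qb pq; have eqr := lab_clique hl qb rb qr.
have erp := lab_clique hl rb pb rp.
have := @good_minus _ _ ge [:: (1, p); (1, q); (1, r)] [:: (4, v); (4, x); (1, k)].
rewrite /qform !big_cons !big_nil /= !eqxx !e_irr.
rewrite !(edgeE ge (kz _ pb), edgeE ge (kz _ qb), edgeE ge (kz _ rb)).
rewrite !(edgeE ge epq, edgeE ge eqr, edgeE ge erp, edgeE ge vx).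
rewrite !(edgeE ge (lab_adj kb vb), edgeE ge (lab_adj kb xb)).
rewrite !(lab_nadj pb vb, lab_nadj pb xb, lab_nadj qb vb, lab_nadj qb xb).
rewrite !(lab_nadj rb vb, lab_nadj rb xb).
by vm_compute => /(_ isT).
Qed.

(* With K_{~~ b} = {p, q}, the vector p + q - v - x is isotropic for A - I and
   orthogonal to the positive vector of the triangle k p q, hence in the
   radical of that form. *)
Lemma half_edge_adj (b : bool) v x w : lab v = Some (b, false) -> lab x = Some (b, false) ->
  e v x -> lab w = Some (~~ b, false) -> e v w.
Proof.
move=> vb xb vx wb; have [k kb] := lab_clique_neq0 hl b.
have /card_gt1P : (1 < nK (~~ b))%N by rewrite (half_edge_size vb xb vx).
move=> [p [q [+ + pq]]]; rewrite !inE => /eqP pb /eqP qb.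
have kz z : lab z = Some (~~ b, true) -> e k z.
  by move=> zb; apply: (lab_clique hl kb zb); apply: (lab_neq kb zb); case: (b).
have epq := lab_clique hl pb qb pq.
have kb' : lab k = Some (~~ ~~ b, true) by rewrite negbK.
have nwv : w != v by apply: (lab_neq wb vb); case: (b).
have nwx : w != x by apply: (lab_neq wb xb); case: (b).
apply/negPn/negP => /negPf nvw.
have := @good_minus _ _ ge [:: (1, k); (1, p); (1, q)]
  [:: (2, p); (2, q); (-2, v); (-2, x); (1, w)].
rewrite /qform !big_cons !big_nil /= !eqxx !e_irr.
rewrite !(edgeE ge (kz _ pb), edgeE ge (kz _ qb)).
rewrite !(edgeE ge epq, edgeE ge vx).
rewrite !(edgeE ge (lab_adj kb vb), edgeE ge (lab_adj kb xb)).
rewrite !(lab_nadj pb vb, lab_nadj pb xb, lab_nadj qb vb, lab_nadj qb xb).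
rewrite !(lab_nadj kb' wb, edgeE ge (lab_adj pb wb), edgeE ge (lab_adj qb wb)).
rewrite [e w v]e_sym [e x w]e_sym nvw [v == w]eq_sym [x == w]eq_sym.
rewrite (negPf nwv) (negPf nwx).
by case: (e w x); vm_compute => /(_ isT).
Qed.

(** The radical vector p + q - v - x must be orthogonal to [u] too, which says that neither [v] nor
    [x] is adjacent to [u]. In the test, [u] minus twice this vector has norm at least 3 and is
    orthogonal to the triangle. *)
Lemma half_edge_nadj (b : bool) v x u : lab v = Some (b, false) -> lab x = Some (b, false) ->
  e v x -> lab u = None -> e v u = false.
Proof.
move=> vb xb vx u0; have [k kb] := lab_clique_neq0 hl b.
have /card_gt1P : (1 < nK (~~ b))%N by rewrite (half_edge_size vb xb vx).
move=> [p [q [+ + pq]]]; rewrite !inE => /eqP pb /eqP qb.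
have kz z : lab z = Some (~~ b, true) -> e k z.
  by move=> zb; apply: (lab_clique hl kb zb); apply: (lab_neq kb zb); case: (b).
have epq := lab_clique hl pb qb pq.
have KZ z b' : lab z = Some (b', true) ->
    (e z u = false) * (e u z = false) * ((z == u) = false) * ((u == z) = false).
  move=> zb; apply: nonedgeE; rewrite ?(lab_no_trace hl zb u0) //.
  exact: (lab_neq zb u0).
have nuv : u != v by apply: (lab_neq u0 vb).
have nux : u != x by apply: (lab_neq u0 xb).
apply: negbTE; apply/negP => vu.
have := @good_minus _ _ ge [:: (1, k); (1, p); (1, q)]
  [:: (-2, p); (-2, q); (2, v); (2, x); (1, u)].
rewrite /qform !big_cons !big_nil /= !eqxx !e_irr.
rewrite !(edgeE ge (kz _ pb), edgeE ge (kz _ qb)).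
rewrite !(edgeE ge epq, edgeE ge vx, edgeE ge vu).
rewrite !(edgeE ge (lab_adj kb vb), edgeE ge (lab_adj kb xb)).
rewrite !(lab_nadj pb vb, lab_nadj pb xb, lab_nadj qb vb, lab_nadj qb xb).
rewrite !(KZ _ _ pb, KZ _ _ qb, KZ _ _ kb).
rewrite [e u x]e_sym [x == u]eq_sym (negPf nux).
by case: (e x u); vm_compute => /(_ isT).
Qed.

End LabelledGraph.

(** * Gram entries as neighbour counts *)

Section Counting.

Variables (T : finType) (e : rel T) (lab : T -> label).
Hypotheses (ge : good_graph e) (hl : clique_labelling e lab).

Let e_sym : symmetric e := good_sym ge.
Let e_irr : irreflexive e := good_irr ge.

Local Notation nK b := #|[set x | lab x == Some (b, true)]|.
Local Notation nV b := #|[set x | lab x == Some (b, false)]|.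
Local Notation dV b x := #|[set z | (lab z == Some (b, false)) && e x z]|.
Local Notation dZ x := #|[set z | (lab z == None) && e x z]|.

Lemma card_split (b : bool) (P : pred T) : #|[set z | P z]| =
  (#|[set z | (lab z == Some (b, true)) && P z]|
   + #|[set z | (lab z == Some (~~ b, true)) && P z]|
   + #|[set z | (lab z == Some (b, false)) && P z]|
   + #|[set z | (lab z == Some (~~ b, false)) && P z]|
   + #|[set z | (lab z == None) && P z]|)%N.
Proof.
rewrite -!sum1_card; rewrite ![\sum_(z in _) 1%N]big_mkcond -!big_split /=.
apply: eq_bigr => z _; rewrite !inE.
by case: (lab z) b => [[[] []]|] []; case: (P z).
Qed.

Lemma piece_all l (P : pred T) : (forall z, lab z = l -> P z) ->
  #|[set z | (lab z == l) && P z]| = #|[set z | lab z == l]|.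
Proof.
by move=> Pl; apply: eq_card => z; rewrite !inE; case: eqP => // /Pl.
Qed.

Lemma piece_none l (P : pred T) : (forall z, lab z = l -> P z = false) ->
  #|[set z | (lab z == l) && P z]| = 0%N.
Proof.
by move=> Pl; apply: eq_card0 => z; rewrite !inE; case: eqP => // /Pl ->.
Qed.

Lemma piece_sub1 l x (P : pred T) : lab x = l -> (forall z, lab z = l -> P z = (z != x)) ->
  (#|[set z | (lab z == l) && P z]|).+1 = #|[set z | lab z == l]|.
Proof.
move=> xl Pl; rewrite (cardsD1 x [set z | lab z == l]) inE xl eqxx add1n; congr _.+1.
by apply: eq_card => z; rewrite !inE andbC; case: eqP => [/Pl ->|]; rewrite ?andbF.
Qed.

Lemma clique_adj x z (b : bool) (b' : bool) : lab x = Some (b, true) -> lab z = Some (b', true) ->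
  e x z = (z != x).
Proof.
move=> xb zb; have [->|zx] := eqVneq z x; first by rewrite e_irr.
by apply: (lab_clique hl xb zb); rewrite eq_sym.
Qed.

Lemma gram_KK (b : bool) x : lab x = Some (b, true) ->
  gram e x x = (nK b)%:Z + (nK (~~ b))%:Z - 2 + (nV b)%:Z.
Proof.
move=> xb; rewrite gramxx (card_split b).
have K1 := piece_sub1 xb (fun z zb => clique_adj xb zb).
rewrite [X in (_ + X + _ + _ + _)%N]piece_all; last first.
  move=> z zb; rewrite (clique_adj xb zb) eq_sym; apply: (lab_neq xb zb).
  by case: (b).
rewrite [X in (_ + _ + X + _ + _)%N]piece_all; last first.
  by move=> z; apply: (lab_adj hl xb).
rewrite [X in (_ + _ + _ + X + _)%N]piece_none; last first.
  by move=> z zb; rewrite (lab_trace hl xb zb); case: (b).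
rewrite [X in (_ + _ + _ + _ + X)%N]piece_none; last first.
  by move=> z; apply: (lab_no_trace hl xb).
by move: K1; lia.
Qed.

Lemma gram_KK' (b : bool) x y : lab x = Some (b, true) -> lab y = Some (~~ b, true) ->
  gram e x y = (nK b)%:Z + (nK (~~ b))%:Z - 2.
Proof.
move=> xb yb; have xy : x != y by apply: (lab_neq xb yb); case: (b).
rewrite gram_neq // /codeg (card_split b).
have nxz z : lab z = Some (~~ b, true) -> (z != x).
  by move=> zb; rewrite eq_sym; apply: (lab_neq xb zb); case: (b).
have nyz z : lab z = Some (b, true) -> (z != y).
  by move=> zb; apply: (lab_neq zb yb); case: (b).
have xz z b' : lab z = Some (b', true) -> e x z && e y z = (z != x) && (z != y).
  by move=> zb; rewrite (clique_adj xb zb) (clique_adj yb zb).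
have K1 := @piece_sub1 _ x (fun z => e x z && e y z) xb.
have K2 := @piece_sub1 _ y (fun z => e x z && e y z) yb.
rewrite -K1; last by move=> z zb; rewrite (xz z b) // nyz ?andbT.
rewrite -K2; last by move=> z zb; rewrite (xz z (~~ b)) // nxz.
rewrite [X in (_ + _ + X + _ + _)%N]piece_none; last first.
  by move=> z zb; rewrite (lab_trace hl yb zb) andbC; case: (b).
rewrite [X in (_ + _ + _ + X + _)%N]piece_none; last first.
  by move=> z zb; rewrite (lab_trace hl xb zb); case: (b).
rewrite [X in (_ + _ + _ + _ + X)%N]piece_none; last first.
  by move=> z zb; rewrite (lab_no_trace hl xb zb).
lia.
Qed.

Lemma gram_VK (b : bool) v x : lab v = Some (b, false) -> lab x = Some (b, true) ->
  gram e v x = (nK b)%:Z - 1 + (dV b v)%:Z.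
Proof.
move=> vb xb; have vx : v != x by apply: (lab_neq vb xb); case: (b).
rewrite gram_neq // /codeg (card_split b).
rewrite -(@piece_sub1 _ x (fun z => e v z && e x z) xb); last first.
  by move=> z zb; rewrite e_sym (lab_adj hl zb vb) (clique_adj xb zb).
rewrite [X in (_ + X + _ + _ + _)%N]piece_none; last first.
  by move=> z zb; rewrite (lab_nadj ge hl zb vb).
rewrite [X in (_ + _ + _ + X + _)%N]piece_none; last first.
  by move=> z zb; rewrite (lab_trace hl xb zb) andbC; case: (b).
rewrite [X in (_ + _ + _ + _ + X)%N]piece_none; last first.
  by move=> z zb; rewrite (lab_no_trace hl xb zb) andbF.
have -> : [set z | (lab z == Some (b, false)) && (e v z && e x z)] =
    [set z | (lab z == Some (b, false)) && e v z].
  apply/setP => z; rewrite !inE; case: eqP => //= zb.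
  by rewrite (lab_adj hl xb zb) andbT.
lia.
Qed.

Lemma gram_VK' (b : bool) v x : lab v = Some (b, false) -> lab x = Some (~~ b, true) ->
  gram e v x = (nK b)%:Z + (dV (~~ b) v)%:Z.
Proof.
move=> vb xb; have vx : v != x by apply: (lab_neq vb xb); case: (b).
rewrite gram_neq // /codeg (card_split b).
rewrite [X in (X + _ + _ + _ + _)%N]piece_all; last first.
  move=> z zb; rewrite e_sym (lab_adj hl zb vb) (clique_adj xb zb).
  by apply: (lab_neq zb xb); case: (b).
rewrite [X in (_ + X + _ + _ + _)%N]piece_none; last first.
  by move=> z zb; rewrite (lab_nadj ge hl zb vb).
rewrite [X in (_ + _ + X + _ + _)%N]piece_none; last first.
  by move=> z zb; rewrite (lab_nadj ge hl xb zb) andbF.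
rewrite [X in (_ + _ + _ + _ + X)%N]piece_none; last first.
  by move=> z zb; rewrite (lab_no_trace hl xb zb) andbF.
have -> : [set z | (lab z == Some (~~ b, false)) && (e v z && e x z)] =
    [set z | (lab z == Some (~~ b, false)) && e v z].
  apply/setP => z; rewrite !inE; case: eqP => //= zb.
  by rewrite (lab_adj hl xb zb) andbT.
lia.
Qed.

Lemma gram_ZK (b : bool) u x : lab u = None -> lab x = Some (b, true) ->
  gram e u x = (dV b u)%:Z.
Proof.
move=> u0 xb; have ux : u != x by apply: (lab_neq u0 xb).
rewrite gram_neq // /codeg (card_split b).
rewrite [X in (X + _ + _ + _ + _)%N]piece_none; last first.
  by move=> z zb; rewrite e_sym (lab_no_trace hl zb u0).
rewrite [X in (_ + X + _ + _ + _)%N]piece_none; last first.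
  by move=> z zb; rewrite e_sym (lab_no_trace hl zb u0).
rewrite [X in (_ + _ + _ + X + _)%N]piece_none; last first.
  by move=> z zb; rewrite (lab_trace hl xb zb) andbC; case: (b).
rewrite [X in (_ + _ + _ + _ + X)%N]piece_none; last first.
  by move=> z zb; rewrite (lab_no_trace hl xb zb) andbF.
rewrite !add0n !addn0; congr (Posz _); apply: eq_card => z; rewrite !inE.
by case: eqP => //= zb; rewrite (lab_adj hl xb zb) andbT.
Qed.

Lemma gram_VV (b : bool) v : lab v = Some (b, false) ->
  gram e v v = (nK b)%:Z + (dV b v)%:Z + (dV (~~ b) v)%:Z + (dZ v)%:Z - 1.
Proof.
move=> vb; rewrite gramxx (card_split b).
rewrite [X in (X + _ + _ + _ + _)%N]piece_all; last first.
  by move=> z zb; rewrite e_sym (lab_adj hl zb vb).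
rewrite [X in (_ + X + _ + _ + _)%N]piece_none; last first.
  by move=> z zb; rewrite (lab_nadj ge hl zb vb).
lia.
Qed.

Lemma gram_ZZ (b : bool) u : lab u = None ->
  gram e u u = (dV b u)%:Z + (dV (~~ b) u)%:Z + (dZ u)%:Z - 1.
Proof.
move=> u0; rewrite gramxx (card_split b).
rewrite [X in (X + _ + _ + _ + _)%N]piece_none; last first.
  by move=> z zb; rewrite e_sym (lab_no_trace hl zb u0).
rewrite [X in (_ + X + _ + _ + _)%N]piece_none; last first.
  by move=> z zb; rewrite e_sym (lab_no_trace hl zb u0).
lia.
Qed.

Lemma gram_outside (b : bool) x y : x != y ->
  (forall b' z, lab z = Some (b', true) -> e x z && e y z = false) ->
  gram e x y = (#|[set z | (lab z == Some (b, false)) && (e x z && e y z)]|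
    + #|[set z | (lab z == Some (~~ b, false)) && (e x z && e y z)]|
    + #|[set z | (lab z == None) && (e x z && e y z)]|)%N%:Z.
Proof.
move=> xy nK; rewrite gram_neq // /codeg (card_split b).
by rewrite [X in (X + _ + _ + _ + _)%N]piece_none ?[X in (_ + X + _ + _ + _)%N]piece_none //;
  exact: nK.
Qed.

(* Vertices of the two halves of the clique have independent Gram vectors, so
   the rank condition expresses every Gram entry through the entries against
   these two. *)
Lemma gram_coordinates (b : bool) p q x y : lab p = Some (b, true) -> lab q = Some (~~ b, true) ->
  let g := (nK b)%:Z + (nK (~~ b))%:Z - 2 in
  let n1 := (nV b)%:Z in let n2 := (nV (~~ b))%:Z in
  (g * n1 + g * n2 + n1 * n2) * gram e x y =
  g * (gram e x p - gram e x q) * (gram e y p - gram e y q)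
  + n2 * (gram e x p * gram e y p) + n1 * (gram e x q * gram e y q).
Proof.
move=> pb qb g n1 n2; have := good_rank_le2 ge p q x y.
have qb' : lab q = Some (~~ b, true) by [].
rewrite (gram_KK pb) (gram_KK qb') (gram_KK' pb qb) negbK.
rewrite !(gram_sym e p) !(gram_sym e q) -/n1 -/n2.
rewrite [(nK (~~ b))%:Z + _]addrC -/g.
move: (gram e x y) (gram e x p) (gram e y p) (gram e x q) (gram e y q) => X a c b' d.
by move=> H; apply/eqP; rewrite -subr_eq0 -H; apply/eqP; ring.
Qed.

End Counting.

(** * Diophantine equations of the triangle case *)

Section Arithmetic.
Local Open Scope nat_scope.
Implicit Types (a c g m n h k : nat).

(** With a = k + 3 and c = m + 1 the equation becomes (k + 1)(m - 3) = 4, and the three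
    factorizations give the three pairs. *)
Lemma pendant_sizes a c : 0 < a -> 0 < c -> 2 < a + c ->
  (a + c - 2) * (a - 1) = (a + c - 2) + a ^ 2 ->
  [\/ (a, c) = (6, 5), (a, c) = (4, 6) | (a, c) = (3, 8)].
Proof.
move=> a0 c0 ac; rewrite -mulnn => E; have a3 : 2 < a.
  rewrite ltnNge; apply/negP => a2; have [|] : a = 1 \/ a = 2 by lia.
    by move=> Ea; rewrite Ea subnn muln0 in E; lia.
  by move=> Ea; rewrite Ea (_ : 2 - 1 = 1) // in E; lia.
have [k Ek] : exists k, a = k + 3 by exists (a - 3); lia.
have [m Em] : exists m, c + k + 1 = m + 2 + k by exists (c - 1); lia.
subst a; have {Em} Em : c = m + 1 by lia.
subst c.
rewrite (_ : k + 3 + (m + 1) - 2 = k + m + 2) in E; last lia.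
rewrite (_ : k + 3 - 1 = k + 2) in E; last lia.
have k4 : k * m + m = 3 * k + 7 by lia.
have m3 : 3 < m.
  rewrite ltnNge; apply/negP => m3; have : k * m <= k * 3 by rewrite leq_mul2l m3 orbT.
  lia.
have k3 : k <= 3.
  have : k * 4 <= k * m by rewrite leq_mul2l m3 orbT.
  lia.
have : k = 0 \/ k = 1 \/ k = 2 \/ k = 3 by lia.
case=> [|[|[|]]] Ek; subst k.
- by constructor 3; congr (_, _); lia.
- by constructor 2; congr (_, _); lia.
- by exfalso; lia.
- by constructor 1; congr (_, _); lia.
Qed.

(** This is the norm equation of a vertex with empty trace and no neighbour of its own kind; h1 and
    h2 are its degrees into the two outside sets. In the slacks x, y it equates D with a sum of
    nonnegative terms. Exactly one of h1, h2 is then nonzero, and it is full or one short of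
    full. *)
Lemma empty_trace_sizes g n1 n2 h1 h2 : 0 < g -> 0 < n1 -> 0 < n2 -> h1 <= n1 -> h2 <= n2 ->
  ((g * n1 + g * n2 + n1 * n2)%:Z * (h1%:Z + h2%:Z - 1) = g%:Z * (h1%:Z - h2%:Z) ^+ 2
    + n2%:Z * h1%:Z ^+ 2 + n1%:Z * h2%:Z ^+ 2)%R ->
  [\/ [/\ h1 = n1, h2 = 0 & g * n1 + g * n2 + n1 * n2 = g * n1 * n2],
      [/\ h1 = 0, h2 = n2 & g * n1 + g * n2 + n1 * n2 = g * n1 * n2],
      (g, n1, n2, h1, h2) = (1, 4, 1, 3, 0) \/ (g, n1, n2, h1, h2) = (2, 3, 2, 2, 0) |
      (g, n1, n2, h1, h2) = (1, 1, 4, 0, 3) \/ (g, n1, n2, h1, h2) = (2, 2, 3, 0, 2)].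
Proof.
move=> g0 n10 n20 /subnKC; move: (n1 - h1) => x xE /subnKC; move: (n2 - h2) => y yE.
subst n1 n2; rewrite !expr2 => E0.
have {E0} E : (g + (h2 + y)) * (h1 * x) + (g + (h1 + x)) * (h2 * y)
    + g * ((h2 + y) * h1 + (h1 + x) * h2 + 2 * h1 * h2)
    = g * (h1 + x) + g * (h2 + y) + (h1 + x) * (h2 + y) by lia.
(* Here p is the nonzero degree and q its slack. Once q = 1 the equation reads g z (p - 1) = g + z,
   so p = 3 with g = z = 1, or p = 2 with g = z = 2. *)
have one_sided p q z : 0 < p -> 0 < q -> 0 < z ->
    (g + z) * (p * q) + g * (z * p) = g * (p + q) + g * z + (p + q) * z ->
    (g, p + q, z, p) = (1, 4, 1, 3) \/ (g, p + q, z, p) = (2, 3, 2, 2).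
  move=> p0 q0 z0 H.
  have [k Ek] : exists k, p = k + 2.
    case: p p0 H => [//|[|p]] _ H; last by exists p; lia.
    by exfalso; nia.
  have {}q0 : q = 1.
    case: q q0 H => [//|[//|q]] _ H; exfalso; subst p.
    by nia.
  subst p q.
  have [m Em] : exists m, g = m + 1 by exists (g - 1); lia.
  have [r Er] : exists r, z = r + 1 by exists (z - 1); lia.
  subst g z.
  have : (k + 1) * (m + 1) * (r + 1) = m + r + 2 by lia.
  case: k {H p0} => [|[|k]] H.
  - have /eqP : m * r = 1 by lia.
    by rewrite muln_eq1 => /andP[/eqP-> /eqP->]; right.
  - left; have {}H : (m = 0 /\ r = 0) by nia.
    by case: H => -> ->.
  - by exfalso; nia.
have [h1_0|h1_0] := posnP h1; have [h2_0|h2_0] := posnP h2.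
- by exfalso; subst h1 h2; nia.
- subst h1; have [y0|y0] := posnP y.
    by subst y; constructor 2; split=> //; lia.
  constructor 4; have x0 : 0 < x by move: n10.
  have H : (g + x) * (h2 * y) + g * (x * h2) = g * (h2 + y) + g * x + (h2 + y) * x by lia.
  by have [[-> -> -> ->]|[-> -> -> ->]] := one_sided h2 y x h2_0 y0 x0 H; [left|right].
- subst h2; have [x0|x0] := posnP x.
    by subst x; constructor 1; split=> //; lia.
  constructor 3; have z0 : 0 < y by move: n20.
  have H : (g + y) * (h1 * x) + g * (y * h1) = g * (h1 + x) + g * y + (h1 + x) * y by lia.
  by have [[-> -> -> ->]|[-> -> -> ->]] := one_sided h1 x y h1_0 x0 z0 H; [left|right].
exfalso.
have {h1_0} [p Ep] : exists p, h1 = p + 1 by exists (h1 - 1); lia.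
have {h2_0} [q Eq] : exists q, h2 = q + 1 by exists (h2 - 1); lia.
have {g0} [m Em] : exists m, g = m + 1 by exists (g - 1); lia.
subst h1 h2 g; clear one_sided n10 n20.
case: x E => [|x]; case: y => [|y] E.
- by nia.
- by nia.
- by nia.
- by nia.
Qed.

(** The equation says 1/g + 1/n1 + 1/n2 = 1; every entry then lies between 2 and 6, and a finite
    check remains. *)
Lemma empty_trace_triples g n1 n2 : 0 < g -> 0 < n1 -> 0 < n2 ->
  g * n1 + g * n2 + n1 * n2 = g * n1 * n2 ->
  (g, n1, n2) \in [:: (3,3,3); (2,4,4); (4,2,4); (4,4,2); (2,3,6); (2,6,3); (3,2,6);
                     (3,6,2); (6,2,3); (6,3,2)].
Proof.
move=> g0 n10 n20 E.
have big p q r : 0 < p -> 0 < q -> 0 < r -> p * q + p * r + q * r = p * q * r -> 1 < p.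
  by case: p => [|[|p]] // _ q0 r0; lia.
have bound p q r : 1 < p -> 1 < q -> 1 < r -> p * q + p * r + q * r = p * q * r -> p <= 6.
  move=> p1 q1 r1 H; rewrite leqNgt; apply/negP => p6.
  have [k Ep] : exists k, p = k + 7 by exists (p - 7); lia.
  have [m Eq] : exists m, q = m + 2 by exists (q - 2); lia.
  have [s Er] : exists s, r = s + 2 by exists (r - 2); lia.
  subst p q r; clear p1 q1 r1 p6 E.
  have : (k + 7) * (m * s + (m + s)) = m * s + 2 * (m + s) + 4 by lia.
  have [ms|ms] := posnP (m + s).
    have [-> ->] : m = 0 /\ s = 0 by lia.
    lia.
  have := leq_mul (leq_addl k 7) (leqnn (m * s + (m + s))); lia.
have g2 := big g n1 n2 g0 n10 n20 E.
have n12 : 1 < n1 by apply: (big n1 g n2) => //; lia.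
have n22 : 1 < n2 by apply: (big n2 g n1) => //; lia.
have g6 : g <= 6 by apply: (bound g n1 n2).
have n16 : n1 <= 6 by apply: (bound n1 g n2) => //; lia.
have n26 : n2 <= 6 by apply: (bound n2 g n1) => //; lia.
have mem p : 1 < p -> p <= 6 -> p \in iota 2 5 by rewrite mem_iota; lia.
have /allP/(_ g (mem _ g2 g6))/allP/(_ n1 (mem _ n12 n16))/allP/(_ n2 (mem _ n22 n26)) :
    all (fun g => all (fun n1 => all (fun n2 =>
   (g * n1 + g * n2 + n1 * n2 == g * n1 * n2) ==> ((g, n1, n2) \in [:: (3,3,3); (2,4,4);
   (4,2,4); (4,4,2); (2,3,6); (2,6,3); (3,2,6); (3,6,2); (6,2,3); (6,3,2)]))
   (iota 2 5)) (iota 2 5)) (iota 2 5) by [].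
by rewrite E eqxx.
Qed.

(** [a] and [c] are the sizes of the two halves, [i] and [j] the degrees between the two outside
    sets. The last three equations are two Gram entries of the empty-trace vertex and the double
    count of edges. Of the ten triples only (3,3,3) and (2,4,4) satisfy them. *)
Lemma matched_sizes a c g n1 n2 i j : 0 < a -> 0 < c -> 0 < g -> a + c = g + 2 ->
  0 < n1 -> 0 < n2 -> g * n1 + g * n2 + n1 * n2 = g * n1 * n2 ->
  g * i + g + n2 = n2 * a -> g * n2 * j = g * j + g + n2 * c + n2 * j ->
  n1 * i = n2 * j ->
  [/\ c = 1, n1 = n2, i = n2 - 1, j = n1 - 1 & (a, n1) = (4, 3) \/ (a, n1) = (3, 4)].
Proof.
move=> a0 c0 g0 ac n10 n20 E H1 H2 H3.
have := empty_trace_triples g0 n10 n20 E; rewrite !inE.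
do 9 (case/orP; first by move=> /eqP[? ? ?]; subst g n1 n2;
  split; first [lia | (by left; congr (_, _); lia) | (by right; congr (_, _); lia)]).
by move=> /eqP[? ? ?]; subst g n1 n2; exfalso; lia.
Qed.

(** The norm equation of an empty-trace vertex with one neighbour of its own kind: the term -1 is
    compensated, and a sum of nonnegative terms has to vanish. *)
Lemma paired_trace_zero g n1 n2 h1 h2 : 0 < g -> 0 < n1 -> 0 < n2 -> h1 <= n1 -> h2 <= n2 ->
  ((g * n1 + g * n2 + n1 * n2)%:Z * (h1%:Z + h2%:Z) = g%:Z * (h1%:Z - h2%:Z) ^+ 2
    + n2%:Z * h1%:Z ^+ 2 + n1%:Z * h2%:Z ^+ 2)%R -> h1 = 0 /\ h2 = 0.
Proof.
move=> g0 n10 n20 /subnKC; move: (n1 - h1) => x xE /subnKC; move: (n2 - h2) => y yE.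
rewrite !expr2 => E0.
have E : (g + n2) * (h1 * x) + (g + n1) * (h2 * y)
    + g * (n2 * h1 + n1 * h2 + 2 * h1 * h2) = 0 by subst n1 n2; lia.
move/eqP: E; rewrite !(addn_eq0, muln_eq0) (gtn_eqF g0) (gtn_eqF n10) (gtn_eqF n20) /=.
by move=> /andP[_ /andP[/andP[/eqP-> /eqP->]]].
Qed.

Local Open Scope ring_scope.

(** The case where one half of K is a single vertex. The first equation gives n1 = 1 + j, and then
    the right side of the second exceeds the left by n1 C + n2 (C + n1). *)
Lemma independent_halves_line (C n1 n2 i j : int) : 1 <= C -> 1 <= n1 -> 1 <= n2 ->
  0 <= i -> 0 <= j ->
  C * (1 + i) * (1 + j) = n1 * C * (1 + i) ->
  (C * n1 + C * n2 + n1 * n2) * (C + j) =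
    C * (1 + j) ^+ 2 + n1 * C ^+ 2 + n2 * (C + 1 + j) ^+ 2 -> False.
Proof.
move=> C1 n11 n21 i0 j0 H; rewrite !expr2 => E.
have {H} n1E : n1 = 1 + j.
  have C0 : C * (1 + i) != 0 by rewrite mulf_neq0 //; lia.
  by apply: (mulfI C0); rewrite H; ring.
subst n1; nia.
Qed.

(** A + 1 and C + 1 are the sizes of the halves, and i, j the cross degrees of vertices v, w without
    neighbours in their own outside set. The first equation is the orthogonality of v and w, the
    others are their norms. For A, C >= 1 orthogonality alone forces i = n2 and j = n1 and becomes A
    (1 + j) + C (1 + i) = A C (i + j); its few solutions violate the norms. *)
Lemma independent_halves_false (A C n1 n2 i j : int) : 0 <= A -> 0 <= C -> 1 <= A + C ->
  1 <= n1 -> 1 <= n2 -> 0 <= i <= n2 -> 0 <= j <= n1 ->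
  (A + C) * (1 + i) * (1 + j) = n2 * A * (C + 1 + j) + n1 * C * (A + 1 + i) ->
  ((A + C) * n1 + (A + C) * n2 + n1 * n2) * (A + i) =
    (A + C) * (1 + i) ^+ 2 + n2 * A ^+ 2 + n1 * (A + 1 + i) ^+ 2 ->
  ((A + C) * n1 + (A + C) * n2 + n1 * n2) * (C + j) =
    (A + C) * (1 + j) ^+ 2 + n1 * C ^+ 2 + n2 * (C + 1 + j) ^+ 2 -> False.
Proof.
move=> A0 C0 AC n11 n21 /andP[i0 iE] /andP[j0 jE] H Ev Ew.
have [A_0|A1] : A = 0 \/ 1 <= A by lia.
  by apply: (@independent_halves_line C n1 n2 i j); subst A => //; lia.
have [C_0|C1] : C = 0 \/ 1 <= C by lia.
  apply: (@independent_halves_line A n2 n1 j i); subst C => //; lia.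
rewrite !expr2 in Ev Ew.
have [p [q [x [y [r [s]]]]]] : exists p q x y r s : nat, [/\ A = p%:Z + 1, C = q%:Z + 1,
    n2 = i + x%:Z & [/\ n1 = j + y%:Z, i = r%:Z & j = s%:Z]].
  exists `|A - 1|%N, `|C - 1|%N, `|n2 - i|%N, `|n1 - j|%N, `|i|%N, `|j|%N.
  by split; [lia|lia|lia|split; lia].
case=> ? ? ? [? ? ?]; subst A C n2 n1 i j; clear A0 C0 AC iE jE i0 j0 A1 C1.
case: x H Ev Ew n21 => [|x] H Ev Ew n21.
  case: r H Ev Ew n21 => [|r] H Ev Ew n21; first by [].
  case: y H Ev Ew n11 => [|y] H Ev Ew n11; last first.
    by clear Ev Ew n11 n21; lia.
  case: s H Ev Ew n11 => [|s] H Ev Ew n11; first by [].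
  (* For A = 1 the equation reduces to C (j - 1) = j + 1, so (C, j) is (2, 3) or (3, 2). The case C
     = 1 is symmetric, and A, C >= 2 leaves A = C = 2 with i = j = 1. *)
  case: p H Ev Ew => [|p] H Ev Ew.
    have {}H : (q + 2 = s * q + q)%N by clear Ev Ew; lia.
    have [q1|q2] : q = 1%N \/ q = 2%N.
    - case: s H {Ev Ew n11} => [|s] H; first lia.
      by have /= := leq0n (s * q); case: q H => [|[|[|q]]]; lia.
    - by subst q; have s3 : s = 2%N by [lia]; subst s; clear Ew H; lia.
    by subst q; have s2 : s = 1%N by [lia]; subst s; clear Ew H; lia.
  case: q H Ev Ew => [|q] H Ev Ew.
    have {}H : (p.+1 + 2 = r * p.+1 + p.+1)%N by clear Ev Ew; lia.
    have [q1|q2] : p = 0%N \/ p = 1%N.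
    - case: r H {Ev Ew n21} => [|r] H; first lia.
      by have /= := leq0n (r * p); case: p H => [|[|p]]; lia.
    - by subst p; have s3 : r = 2%N by [lia]; subst r; clear Ev H; lia.
    by subst p; have s2 : r = 1%N by [lia]; subst r; clear Ev H; lia.
  have [p0 [q0 [r0 s0]]] : p = 0%N /\ q = 0%N /\ r = 0%N /\ s = 0%N.
    by clear Ev Ew; lia.
  by clear H; subst p q r s; lia.
case: y H Ev Ew n11 => [|y] H Ev Ew n11.
  case: s H Ev Ew n11 => [|s] H Ev Ew n11; first by [].
  by clear Ev Ew n11 n21; lia.
by clear Ev Ew n11 n21; lia.
Qed.

(** The norm equation of a vertex without partner in an outside set that also contains an edge: the
    opposite half then has two vertices, so g = a. What matters later is that the cross degree i
    must be 0. *)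
Lemma single_beside_pairs (a n1 n2 i : int) : 1 <= a -> 2 <= n1 -> 1 <= n2 -> 0 <= i <= n2 ->
  (a * n1 + a * n2 + n1 * n2) * (a - 1 + i) =
    a * (1 + i) ^+ 2 + n2 * (a - 1) ^+ 2 + n1 * (a + i) ^+ 2 ->
  [/\ a = 2, i = 0 & n2 = 2].
Proof.
move=> a1 n12 n21 /andP[i0 iE]; rewrite !expr2 => E.
have [p [x [r]]] : exists p x r : nat, [/\ a = p%:Z + 1, n2 = i + x%:Z & i = r%:Z].
  by exists `|a - 1|%N, `|n2 - i|%N, `|i|%N; split; lia.
case=> ? ? ?; subst a n2 i; clear a1 i0 iE.
have [m mE] : exists m : nat, n1 = m%:Z + 2 by exists `|n1 - 2|%N; lia.
subst n1; clear n12.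
case: x E n21 => [|[|x]] E n21; last first.
- have {E} E : (m.+2 * (p + r) * x.+1 + (p.+1 * r * x) + (r + x.+2) * p = m.+2 + p.+1)%N by lia.
  case: p E => [|p] E.
    exfalso; case: r E n21 => [|r] E n21; first by lia.
    have [r0 x0] : r = 0%N /\ x = 0%N by lia.
    by subst r x; lia.
  have : (m.+2 * (p * x + p + x + r * x + r)
    + (p * r * x + p + 2 * (r * x) + p * r + p * x + r + x) = 0)%N by lia.
  move=> {}E; have [p0 [r0 x0]] : p = 0%N /\ r = 0%N /\ x = 0%N by lia.
  by subst p r x.
- by exfalso; lia.
- by exfalso; lia.
Qed.

End Arithmetic.

(** * The target structures as vertex sets *)

Definition matching_on (T : finType) (e : rel T) (S : {set T}) :=
  {in S, forall x, #|[set z in S | e x z]| = 1%N}.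

Definition joined (T : finType) (e : rel T) (A B : {set T}) :=
  {in A & B, forall x y, e x y}.

Definition independent (T : finType) (e : rel T) (S : {set T}) :=
  {in S &, forall x y, e x y = false}.

(** Required in both directions, this is the pattern J - I between the two sets. *)
Definition cocktail (T : finType) (e : rel T) (A B : {set T}) :=
  {in A, forall x, #|[set z in B | ~~ e x z]| = 1%N}.

(** The bound on the complement encodes k >= 2, since a perfectly matched set has even size. *)
Definition structure_II (T : finType) (e : rel T) := exists A : {set T},
  [/\ A != set0, (3 < #|~: A|)%N, clique e A, matching_on e (~: A) & joined e A (~: A)].

Definition structure_III (T : finType) (e : rel T) := exists A : {set T},
  [/\ (3 < #|A|)%N, (3 < #|~: A|)%N, matching_on e A, matching_on e (~: A)
    & joined e A (~: A)].

(** [v] is among its own non-neighbours, hence [c.+1]. *)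
Definition structure_V (T : finType) (e : rel T) := exists v, exists a c : nat,
  [/\ clique e [set~ v], #|[set z | e v z]| = a, #|[set z | ~~ e v z]| = c.+1 &
      [\/ (a, c) = (6, 5), (a, c) = (4, 6) | (a, c) = (3, 8)]%N].

Definition structure_VI (T : finType) (e : rel T) := exists A X Y : {set T},
  [/\ [/\ A :|: X :|: Y = setT, [disjoint A & X], [disjoint A & Y] & [disjoint X & Y]],
      [/\ clique e A, independent e X & independent e Y],
      [/\ joined e A X, {in A & Y, forall x y, e x y = false}, cocktail e X Y & cocktail e Y X] &
      (#|A|, #|X|) = (4, 4)%N \/ (#|A|, #|X|) = (3, 5)%N].

(** * Outside vertices over one half of the clique *)

Section TriangleCase.

Variables (T : finType) (e : rel T) (lab : T -> label).
Hypotheses (ge : good_graph e) (hl : clique_labelling e lab).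

Let e_sym : symmetric e := good_sym ge.

Local Notation nK b := #|[set x | lab x == Some (b, true)]|.
Local Notation nV b := #|[set x | lab x == Some (b, false)]|.
Local Notation dV b x := #|[set z | (lab z == Some (b, false)) && e x z]|.
Local Notation dZ x := #|[set z | (lab z == None) && e x z]|.
Local Notation g b := ((nK b)%:Z + (nK (~~ b))%:Z - 2).
Local Notation D b := (g b * (nV b)%:Z + g b * (nV (~~ b))%:Z + (nV b)%:Z * (nV (~~ b))%:Z).

Lemma dV_le (b : bool) x : (dV b x <= nV b)%N.
Proof. by apply: subset_leq_card; apply/subsetP => z; rewrite !inE => /andP[]. Qed.

Lemma g_ge1 (b : bool) : 1 <= g b.
Proof. by have := nK_big hl b; lia. Qed.

Lemma coord_VV (b : bool) v : lab v = Some (b, false) ->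
  D b * ((nK b)%:Z + (dV b v)%:Z + (dV (~~ b) v)%:Z + (dZ v)%:Z - 1) =
  g b * ((dV b v)%:Z - 1 - (dV (~~ b) v)%:Z) ^+ 2
  + (nV (~~ b))%:Z * ((nK b)%:Z - 1 + (dV b v)%:Z) ^+ 2
  + (nV b)%:Z * ((nK b)%:Z + (dV (~~ b) v)%:Z) ^+ 2.
Proof.
move=> vb; have [p pb] := lab_clique_neq0 hl b; have [q qb] := lab_clique_neq0 hl (~~ b).
have /= := gram_coordinates ge hl v v pb qb.
rewrite (gram_VV ge hl vb) (gram_VK ge hl vb pb) (gram_VK' ge hl vb qb) => ->.
by rewrite !expr2; ring.
Qed.

Lemma coord_ZZ (b : bool) u : lab u = None ->
  D b * ((dV b u)%:Z + (dV (~~ b) u)%:Z + (dZ u)%:Z - 1) =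
  g b * ((dV b u)%:Z - (dV (~~ b) u)%:Z) ^+ 2
  + (nV (~~ b))%:Z * (dV b u)%:Z ^+ 2 + (nV b)%:Z * (dV (~~ b) u)%:Z ^+ 2.
Proof.
move=> u0; have [p pb] := lab_clique_neq0 hl b; have [q qb] := lab_clique_neq0 hl (~~ b).
have /= := gram_coordinates ge hl u u pb qb.
rewrite (gram_ZZ ge hl b u0) (gram_ZK ge hl u0 pb) (gram_ZK ge hl u0 qb) => ->.
by rewrite !expr2; ring.
Qed.

Lemma coord_ZV (b : bool) u v : lab u = None -> lab v = Some (b, false) ->
  D b * gram e u v =
  g b * ((dV b u)%:Z - (dV (~~ b) u)%:Z) * ((dV b v)%:Z - 1 - (dV (~~ b) v)%:Z)
  + (nV (~~ b))%:Z * ((dV b u)%:Z * ((nK b)%:Z - 1 + (dV b v)%:Z))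
  + (nV b)%:Z * ((dV (~~ b) u)%:Z * ((nK b)%:Z + (dV (~~ b) v)%:Z)).
Proof.
move=> u0 vb; have [p pb] := lab_clique_neq0 hl b; have [q qb] := lab_clique_neq0 hl (~~ b).
have /= := gram_coordinates ge hl u v pb qb.
rewrite (gram_ZK ge hl u0 pb) (gram_ZK ge hl u0 qb).
rewrite (gram_VK ge hl vb pb) (gram_VK' ge hl vb qb) => ->.
by ring.
Qed.

Lemma coord_VW (b : bool) v w : lab v = Some (b, false) -> lab w = Some (~~ b, false) ->
  D b * gram e v w =
  g b * ((dV b v)%:Z - 1 - (dV (~~ b) v)%:Z) * ((dV b w)%:Z + 1 - (dV (~~ b) w)%:Z)
  + (nV (~~ b))%:Z * (((nK b)%:Z - 1 + (dV b v)%:Z) * ((nK (~~ b))%:Z + (dV b w)%:Z))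
  + (nV b)%:Z * (((nK b)%:Z + (dV (~~ b) v)%:Z) * ((nK (~~ b))%:Z - 1 + (dV (~~ b) w)%:Z)).
Proof.
move=> vb wb; have [p pb] := lab_clique_neq0 hl b; have [q qb] := lab_clique_neq0 hl (~~ b).
have pb' : lab p = Some (~~ ~~ b, true) by rewrite negbK.
have /= := gram_coordinates ge hl v w pb qb.
rewrite (gram_VK ge hl vb pb) (gram_VK' ge hl vb qb).
rewrite (gram_VK ge hl wb qb) (gram_VK' ge hl wb pb') negbK => ->.
by ring.
Qed.

Lemma gram_ge0 x y : x != y -> 0 <= gram e x y.
Proof. by move=> xy; rewrite gram_neq. Qed.

(** K_b and V_{~~ b} have no edges between them, so the adjacent pair K_b and the pairs inside V_{~~
    b} together form a perfect matching. *)
Lemma matching_half (b : bool) : nK b = 2%N ->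
  (forall w, lab w = Some (~~ b, false) -> dV (~~ b) w = 1%N) ->
  matching_on e [set z | (lab z == Some (b, true)) || (lab z == Some (~~ b, false))].
Proof.
move=> n2 d1 x; rewrite inE => /orP[] /eqP xb.
  have := piece_sub1 xb (fun z zb => clique_adj ge hl xb zb).
  rewrite n2 => -[<-]; apply: eq_card => z; rewrite !inE.
  case: eqP => //= zb; case: eqP => //= zV.
  by rewrite (lab_trace hl xb zV); case: (b).
rewrite -(d1 x xb); apply: eq_card => z; rewrite !inE.
case: eqP => [zb|_] //=; rewrite zb.
have zb' : lab z = Some (~~ ~~ b, true) by rewrite negbK.
by rewrite (lab_nadj ge hl zb' xb) andbF.
Qed.

Lemma half_size (b : bool) w x : nK b = 2%N -> lab w = Some (~~ b, false) ->
  lab x = Some (~~ b, false) -> w != x ->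
  (3 < #|[set z | (lab z == Some (b, true)) || (lab z == Some (~~ b, false))]|)%N.
Proof.
move=> n2 wb xb wx.
have U4 : #|[set x | lab x == Some (b, true)] :|: [set w; x]| = 4%N.
  rewrite cardsU n2 cards2 wx [X in (_ - X)%N](_ : _ = 0%N) //.
  apply: eq_card0 => z; rewrite !inE; apply/negP => /andP[/eqP zb /orP[] /eqP zE];
    by move: zb; rewrite zE ?wb ?xb; case: (b).
rewrite -[4%N]U4; apply: subset_leq_card; apply/subsetP => z; rewrite !inE.
by case/or3P => [->//|/eqP->|/eqP->]; rewrite ?wb ?xb eqxx orbT.
Qed.

(** When V_{~~ b} is empty, no vertex has empty trace, and V_b is either perfectly matched or
    independent. The matched case is (ii). In the independent case the vertices of V_b are false
    twins, so there is only one, and its norm equation gives (v). *)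
Lemma one_half (b : bool) : nV (~~ b) = 0%N -> structure_II e \/ structure_V e.
Proof.
move=> V'0; have n2_0 x : dV (~~ b) x = 0%N by apply/eqP; rewrite -leqn0 -V'0 dV_le.
have noV' x : lab x <> Some (~~ b, false).
  by move=> xb; have := cards0_eq V'0 => /setP/(_ x); rewrite !inE xb eqxx.
have [v0 v0b] : exists v, lab v = Some (b, false).
  have [b' [v vb]] := lab_outside hl; exists v; rewrite vb.
  by case: (eqVneq b' b) => [->//|] /negPf; move: vb (noV' v); case: (b) (b') => [] [].
have n1_gt0 : (0 < nV b)%N by apply/card_gt0P; exists v0; rewrite inE v0b.
have g1 := g_ge1 b.
(* If [v] has no neighbour in V_b, the coordinates give D gram(u, v) = - g [dV b u], and a codegree
   is nonnegative, so [u] has no neighbour in V_b. *)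
have noZV u v : lab u = None -> lab v = Some (b, false) -> e u v = false.
  move=> u0 vb; have := coord_ZV u0 vb; rewrite V'0 !n2_0 !(mulr0, mul0r, addr0, subr0).
  have := half_deg ge hl vb; case: (posnP (dV b v)) => [->|].
    move=> _; have uv : u != v by apply: (lab_neq u0 vb).
    have := gram_ge0 uv; rewrite sub0r mulrN1 => G0 H.
    have : g b * (dV b u)%:Z <= 0.
      by rewrite -oppr_ge0 -H mulr_ge0 // mulr_ge0 //; move: g1; lia.
    rewrite pmulr_rle0; last by apply: lt_le_trans g1.
    rewrite lez_nat leqn0 => /eqP.
    by move/cards0_eq/setP/(_ v); rewrite !inE vb eqxx.
  move=> /card_gt0P[x]; rewrite inE => /andP[/eqP xb vx] _ _.
  by rewrite e_sym (half_edge_nadj ge hl vb xb vx u0).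
have noZ x : lab x <> None.
  apply/eqP; have [k kb] := lab_clique_neq0 hl b.
  apply: (closed_set_full ge (S := fun x => lab x != None) (x0 := k)); first by rewrite kb.
  move=> y z y0 yz; apply/eqP => z0; move: y0 yz; case yE: (lab y) => [[b' [|]]|] // _.
    by rewrite (lab_no_trace hl yE z0).
  by rewrite e_sym noZV // yE; move: (noV' y); rewrite yE; case: (b) (b') => [] [].
have f0 v : dZ v = 0%N by apply: piece_none => z /noZ.
(* An edge in V_b makes K_{~~ b} of size two. With a = |K_b| and n1 = |V_b|, a vertex isolated in
   V_b would then satisfy a n1 (a - 1) = a + n1 a^2, which is impossible. *)
have pairs_singles : (forall v, lab v = Some (b, false) -> dV b v = 1%N) \/
    (forall v, lab v = Some (b, false) -> dV b v = 0%N).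
  have c2 v : lab v = Some (b, false) -> dV b v = 1%N -> nK (~~ b) = 2%N.
    move=> vb d1; have /card_gt0P[x] : (0 < dV b v)%N by rewrite d1.
    by rewrite inE => /andP[/eqP xb vx]; apply: (half_edge_size ge hl vb xb vx).
  have d01 v : lab v = Some (b, false) -> dV b v = 0%N \/ dV b v = 1%N.
    by move=> /(half_deg ge hl); case: (dV b v) => [|[|]]; [left|right|].
  case: (d01 _ v0b) => d0; [right|left] => v vb; case: (d01 _ vb) => // d1; exfalso.
    have := coord_VV v0b; rewrite d0 !n2_0 f0 V'0 (c2 v vb d1) !expr2.
    by have := nK_gt0 hl b; move: n1_gt0; nia.
  have := coord_VV vb; rewrite d1 !n2_0 f0 V'0 (c2 v0 v0b d0) !expr2.
  by have := nK_gt0 hl b; move: n1_gt0; nia.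
have NV v : lab v = Some (b, false) -> dV b v = 0%N ->
    forall z, e v z = (lab z == Some (b, true)).
  move=> vb d0 z; case zE: (lab z) => [[b' [|]]|].
  - rewrite e_sym (lab_trace hl zE vb); by case: (b') (b) => [] [].
  - have bE : b' = b by move: (noV' z); rewrite zE; case: (b) (b') => [] [].
    rewrite bE in zE *; rewrite (_ : (_ == _) = false); last by case: (b).
    apply/negP => vz.
    have : z \in [set z | (lab z == Some (b, false)) && e v z] by rewrite inE vz zE eqxx.
    by rewrite (cards0_eq d0) inE.
  - by have := noZ z zE.
case: pairs_singles => [pairs|singles]; [left|right].
  have /card_gt0P[x0] : (0 < dV b v0)%N by rewrite pairs.
  rewrite inE => /andP[/eqP x0b v0x0].
  have c2 : nK (~~ b) = 2%N by apply: (half_edge_size ge hl v0b x0b v0x0).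
  exists [set x | lab x == Some (b, true)].
  have compl : ~: [set x | lab x == Some (b, true)] =
      [set z | (lab z == Some (~~ b, true)) || (lab z == Some (~~ ~~ b, false))].
    apply/setP => z; rewrite !inE negbK.
    move: (noZ z) (noV' z); case: (lab z) => [[b' [|]]|] //; by case: (b) (b') => [] [].
  split.
  - by rewrite -card_gt0 (nK_gt0 hl).
  - rewrite compl; apply: (half_size (w := v0) (x := x0)); rewrite ?negbK //.
    exact: (edge_neq ge v0x0).
  - apply/cliqueP => x y; rewrite !inE => /eqP xb /eqP yb; exact: (lab_clique hl xb yb).
  - by rewrite compl; apply: matching_half; rewrite ?negbK.
  - move=> x y; rewrite compl !inE negbK => /eqP xb /orP[] /eqP yb.
      by rewrite (clique_adj ge hl xb yb); apply: contraTneq isT => yx; move: yb;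
        rewrite yx xb; case: (b).
    exact: (lab_adj hl xb yb).
have n1_1 : nV b = 1%N.
  apply/eqP; rewrite eqn_leq n1_gt0 andbT leqNgt; apply/negP => /card_gt1P[x [y]].
  rewrite !inE => -[/eqP xb /eqP yb /eqP]; apply; apply: (no_false_twins ge).
    by move=> z; rewrite !NV ?singles.
  by have [k kb] := lab_clique_neq0 hl b; exists k; rewrite NV ?singles // kb.
exists v0, (nK b), (nK (~~ b)); split.
- apply/cliqueP => x y; rewrite !inE => xv yv xy.
  have inK z : z != v0 -> exists b', lab z = Some (b', true).
    move=> zv; case zE: (lab z) => [[b' [|]]|]; [by exists b'| |by have := noZ z zE].
    have /eqP/cards1P[v1 /setP vE] := n1_1.
    have := vE v0; have := vE z; rewrite !inE v0b eqxx zE => zv1 /esym/eqP v01.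
    exfalso; move: zv zv1; rewrite v01 => /negPf ->.
    by move: (noV' z); rewrite zE; case: (b) (b') => [] [].
  by have [b1 xb] := inK _ xv; have [b2 yb] := inK _ yv; apply: (lab_clique hl xb yb).
- by apply: eq_card => z; rewrite !inE NV ?singles.
- rewrite (card_split lab b (fun z => ~~ e v0 z)).
  rewrite [X in (X + _ + _ + _ + _)%N]piece_none; last first.
    by move=> z zb; rewrite NV ?singles // zb eqxx.
  rewrite [X in (_ + X + _ + _ + _)%N]piece_all; last first.
    by move=> z zb; rewrite NV ?singles // zb; case: (b).
  rewrite [X in (_ + _ + X + _ + _)%N]piece_all; last first.
    by move=> z zb; rewrite NV ?singles // zb; case: (b).
  rewrite [X in (_ + _ + _ + X + _)%N]piece_none; last by move=> z /noV'.
  rewrite [X in (_ + _ + _ + _ + X)%N]piece_none; last by move=> z /noZ.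
  by rewrite n1_1 add0n !addn0 addn1.
- apply: pendant_sizes; rewrite ?(nK_gt0 hl) ?(nK_big hl) //.
  have := coord_VV v0b; rewrite singles // !n2_0 f0 V'0 n1_1 !expr2 -mulnn.
  have := nK_big hl b; have := nK_gt0 hl b.
  move: (nK b) (nK (~~ b)) => a c; case: a => // a _ ac.
  have [m mE] : exists m, (a.+1 + c = m + 2)%N by exists (a.+1 + c - 2)%N; lia.
  rewrite mE addnK subn1 /= => E.
  have {ac mE} cE : c%:Z = m%:Z + 1 - a%:Z by lia.
  by rewrite cE in E; lia.
Qed.

End TriangleCase.

(** * Outside vertices over both halves of the clique *)

Section BothHalves.

Variables (T : finType) (e : rel T) (lab : T -> label).
Hypotheses (ge : good_graph e) (hl : clique_labelling e lab).

Let e_sym : symmetric e := good_sym ge.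

Local Notation nK b := #|[set x | lab x == Some (b, true)]|.
Local Notation nV b := #|[set x | lab x == Some (b, false)]|.
Local Notation dV b x := #|[set z | (lab z == Some (b, false)) && e x z]|.
Local Notation dZ x := #|[set z | (lab z == None) && e x z]|.
Local Notation g b := ((nK b)%:Z + (nK (~~ b))%:Z - 2).
Local Notation D b := (g b * (nV b)%:Z + g b * (nV (~~ b))%:Z + (nV b)%:Z * (nV (~~ b))%:Z).

Hypothesis nV_gt0 : forall b : bool, (0 < nV b)%N.

Lemma piece0 l x z : #|[set z | (lab z == l) && e x z]| = 0%N -> lab z = l -> e x z = false.
Proof.
move=> /cards0_eq/setP/(_ z); rewrite !inE => + zl; by rewrite zl eqxx.
Qed.

Lemma piece_full l x z : #|[set z | (lab z == l) && e x z]| = #|[set z | lab z == l]| ->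
  lab z = l -> e x z.
Proof.
move=> E zl; have /setP/(_ z) : [set z | (lab z == l) && e x z] = [set z | lab z == l].
  by apply/eqP; rewrite eqEcard E leqnn andbT; apply/subsetP => y; rewrite !inE => /andP[].
by rewrite !inE zl eqxx.
Qed.

Lemma piece_gt0 l x z : lab z = l -> e x z -> (0 < #|[set z | (lab z == l) && e x z]|)%N.
Proof. by move=> zl xz; apply/card_gt0P; exists z; rewrite inE zl eqxx. Qed.

Lemma g_nat (b : bool) : exists2 k : nat, (0 < k)%N & g b = k%:Z.
Proof.
have := nK_big hl b => big; exists (nK b + nK (~~ b) - 2)%N; lia.
Qed.

Lemma V_ex (b : bool) : exists v, lab v = Some (b, false).
Proof. by have /card_gt0P[v] := nV_gt0 b; rewrite inE => /eqP; exists v. Qed.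

(** Two adjacent vertices of empty trace would have no neighbours over either half, by
    [paired_trace_zero], and could not be connected to K. *)
Lemma empty_trace_isolated u : lab u = None -> dZ u = 0%N.
Proof.
move=> u0; apply/eqP; rewrite -leqn0 leqNgt; apply/negP => du.
have := closed_set_full ge (S := fun x => (lab x == None) && (0 < dZ x)%N) (x0 := u).
rewrite u0 du => /(_ isT) H; have [k kb] := lab_clique_neq0 hl true.
have /H/(_ k) : forall x y, (lab x == None) && (0 < dZ x)%N -> e x y ->
    (lab y == None) && (0 < dZ y)%N; last by rewrite kb.
move=> x y /andP[/eqP x0 dx] xy.
have d1 : dZ x = 1%N by apply/eqP; rewrite eqn_leq dx (empty_trace_deg ge hl x0).
have [k0 kgt kE] := g_nat true.
have := coord_ZZ ge hl true x0; rewrite d1 kE addrK => E.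
have [h1 h2] := paired_trace_zero kgt (nV_gt0 true) (nV_gt0 false)
  (dV_le e lab true x) (dV_le e lab false x) E.
case yE: (lab y) => [[b [|]]|].
- by rewrite e_sym (lab_no_trace hl yE x0) in xy.
- by case: b yE => yE; rewrite (piece0 _ yE) in xy.
- by rewrite (piece_gt0 x0) // e_sym.
Qed.

Lemma double_count (A B : {set T}) :
  (\sum_(x in A) #|[set z in B | e x z]| = \sum_(z in B) #|[set x in A | e z x]|)%N.
Proof.
have cE (C : {set T}) x : #|[set z in C | e x z]| = (\sum_(z in C) (e x z : nat))%N.
  rewrite -sum1_card [RHS]big_mkcond [LHS]big_mkcond /=; apply: eq_bigr => z _.
  by rewrite !inE; case: (z \in C); case: (e x z).
under eq_bigr do rewrite cE; rewrite exchange_big /=; apply: eq_bigr => z _.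
by rewrite cE; apply: eq_bigr => x _; rewrite e_sym.
Qed.

Lemma double_count_const (b : bool) i j :
  (forall v, lab v = Some (b, false) -> dV (~~ b) v = i) ->
  (forall w, lab w = Some (~~ b, false) -> dV b w = j) ->
  (nV b * i = nV (~~ b) * j)%N.
Proof.
move=> di dj.
have := double_count [set x | lab x == Some (b, false)] [set x | lab x == Some (~~ b, false)].
rewrite (eq_bigr (fun _ => i)) ?sum_nat_const; last first.
  move=> v; rewrite inE => /eqP vb; rewrite -(di v vb); apply: eq_card => z.
  by rewrite !inE.
rewrite (eq_bigr (fun _ => j)) ?sum_nat_const //.
by move=> v; rewrite inE => /eqP vb; rewrite -(dj v vb); apply: eq_card => z; rewrite !inE.
Qed.

Lemma half_edgeP (b : bool) v : lab v = Some (b, false) -> dV b v <> 0%N ->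
  exists2 x, lab x = Some (b, false) & e v x.
Proof.
move=> vb /eqP; rewrite -lt0n => /card_gt0P[x]; rewrite inE => /andP[/eqP xb vx].
by exists x.
Qed.

Lemma deg_cases (b : bool) v : lab v = Some (b, false) -> dV b v = 0%N \/ dV b v = 1%N.
Proof. by move=> /(half_deg ge hl); case: (dV b v) => [|[|]]; [left|right|]. Qed.

Section NoEmptyTrace.

Hypothesis noZ : forall x, lab x <> None.

Let dZ0 x : dZ x = 0%N. Proof. by apply: piece_none => z /noZ. Qed.

(** [v] sees only K_b and V_{~~ b}, [w] only K_{~~ b} and V_b, so they have no common neighbour. *)
Lemma gram_singles (b : bool) v w : lab v = Some (b, false) -> lab w = Some (~~ b, false) ->
  dV b v = 0%N -> dV (~~ b) w = 0%N -> gram e v w = 0.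
Proof.
move=> vb wb dv dw; rewrite (gram_outside (lab := lab) b).
- rewrite piece_none; last by move=> z zb; rewrite (piece0 dv zb).
  rewrite piece_none; last by move=> z zb; rewrite (piece0 dw zb) andbF.
  by rewrite piece_none // => z /noZ.
- by apply: (lab_neq vb wb); case: (b).
- move=> b' z zb; rewrite ![e _ z]e_sym (lab_trace hl zb vb) (lab_trace hl zb wb).
  by case: (b') (b) => [] [].
Qed.

Lemma coord_single (b : bool) v : lab v = Some (b, false) -> dV b v = 0%N ->
  D b * ((nK b)%:Z - 1 + (dV (~~ b) v)%:Z) =
  g b * (1 + (dV (~~ b) v)%:Z) ^+ 2 + (nV (~~ b))%:Z * ((nK b)%:Z - 1) ^+ 2
  + (nV b)%:Z * ((nK b)%:Z - 1 + 1 + (dV (~~ b) v)%:Z) ^+ 2.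
Proof.
move=> vb dv; have := coord_VV ge hl vb; rewrite dv dZ0 !expr2 => E.
by rewrite (addrAC _ (-1)); move: E; rewrite !addr0 => ->; ring.
Qed.

Lemma coord_singles (b : bool) v w : lab v = Some (b, false) -> lab w = Some (~~ b, false) ->
  dV b v = 0%N -> dV (~~ b) w = 0%N ->
  g b * (1 + (dV (~~ b) v)%:Z) * (1 + (dV b w)%:Z) =
  (nV (~~ b))%:Z * ((nK b)%:Z - 1) * ((nK (~~ b))%:Z - 1 + 1 + (dV b w)%:Z)
  + (nV b)%:Z * ((nK (~~ b))%:Z - 1) * ((nK b)%:Z - 1 + 1 + (dV (~~ b) v)%:Z).
Proof.
move=> vb wb dv dw; have := coord_VW ge hl vb wb.
rewrite (gram_singles vb wb dv dw) dv dw mulr0 => E.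
by apply/esym/eqP; rewrite -subr_eq0 [X in _ == X]E; apply/eqP; ring.
Qed.

Lemma no_two_singles (b : bool) v w : lab v = Some (b, false) -> lab w = Some (~~ b, false) ->
  dV b v = 0%N -> dV (~~ b) w = 0%N -> False.
Proof.
move=> vb wb dv dw; have := coord_singles vb wb dv dw.
have Ev := coord_single vb dv; have Ew := coord_single wb dw; move: Ev Ew; rewrite negbK.
have -> : g b = ((nK b)%:Z - 1) + ((nK (~~ b))%:Z - 1) by ring.
have -> : (nK (~~ b))%:Z + (nK b)%:Z - 2 = ((nK b)%:Z - 1) + ((nK (~~ b))%:Z - 1) by ring.
move=> Ev Ew H; apply: (independent_halves_false _ _ _ _ _ _ _ H Ev).
- by rewrite subr_ge0 lez_nat (nK_gt0 hl).
- by rewrite subr_ge0 lez_nat (nK_gt0 hl).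
- by have := nK_big hl b; move: (nK b) (nK (~~ b)) => {H Ev Ew} A C; lia.
- exact: nV_gt0.
- exact: nV_gt0.
- by rewrite /= lez_nat dV_le.
- by rewrite /= lez_nat dV_le.
- by rewrite -Ew; ring.
Qed.

(** By [no_two_singles] every vertex of V_{~~ b} lies on an edge inside V_{~~ b}, and the ends of
    such an edge are joined to all of V_b. So [v] has positive cross degree, which its norm equation
    does not allow. *)
Lemma single_forces_singles (b : bool) v x y : lab v = Some (b, false) -> dV b v = 0%N ->
  lab x = Some (b, false) -> lab y = Some (b, false) -> e x y -> False.
Proof.
move=> vb dv xb yb xy; have c2 := half_edge_size ge hl xb yb xy.
have n12 : (1 < nV b)%N.
  by apply/card_gt1P; exists x, y; rewrite !inE xb yb eqxx (edge_neq ge xy).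
have [w wb] := V_ex (~~ b).
have [/(no_two_singles vb wb dv) //|dw] := deg_cases wb.
have [z zb wz] : exists2 z, lab z = Some (~~ b, false) & e w z.
  by apply: half_edgeP; rewrite // dw.
have vb' : lab v = Some (~~ ~~ b, false) by rewrite negbK.
have vw : e v w by rewrite e_sym; apply: (half_edge_adj ge hl wb zb wz vb').
have i_gt0 := piece_gt0 wb vw; have i_le := dV_le e lab (~~ b) v.
have := coord_single vb dv; rewrite c2 (_ : (nK b)%:Z + 2%N%:Z - 2 = (nK b)%:Z); last by lia.
rewrite subrK => E.
have [] := single_beside_pairs _ _ _ _ E.
- exact: nK_gt0 hl b.
- exact: n12.
- exact: nV_gt0.
- by rewrite /= lez_nat.
- by move=> _ /eqP; rewrite eqz_nat => /eqP i0; rewrite i0 in i_gt0.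
Qed.

Lemma no_empty_trace_structure : structure_III e.
Proof.
have [b [v0 [x0 [v0b x0b vx0]]]] : exists b v x,
    [/\ lab v = Some (b, false), lab x = Some (b, false) & e v x].
  have [v vt] := V_ex true; have [w wf] := V_ex false.
  case: (deg_cases vt) => dv; last first.
    have [|x xb vx] := half_edgeP vt; first by rewrite dv.
    by exists true, v, x.
  case: (deg_cases wf) => dw; last first.
    have [|x xb vx] := half_edgeP wf; first by rewrite dw.
    by exists false, w, x.
  by case: (no_two_singles vt wf dv dw).
have c2 : nK (~~ b) = 2%N by apply: (half_edge_size ge hl v0b x0b vx0).
have V1 v : lab v = Some (b, false) -> dV b v = 1%N.
  by move=> vb; case: (deg_cases vb) => // dv; case: (single_forces_singles vb dv v0b x0b vx0).
have full v : lab v = Some (b, false) -> forall w, lab w = Some (~~ b, false) -> e v w.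
  move=> vb w wb; have [|x xb vx] := half_edgeP vb; first by rewrite V1.
  exact: (half_edge_adj ge hl vb xb vx wb).
have [w0 w0b] := V_ex (~~ b).
(* A vertex without partner would make all of V_{~~ b} false twins with neighbourhood K_{~~ b} and
   V_b, hence a single vertex; its norm equation then fails. *)
have W1 w : lab w = Some (~~ b, false) -> dV (~~ b) w = 1%N.
  move=> wb; case: (deg_cases wb) => // dw; exfalso.
  have W0 z : lab z = Some (~~ b, false) -> dV (~~ b) z = 0%N.
    move=> zb; case: (deg_cases zb) => // dz.
    have [|x xb zx] := half_edgeP zb; first by rewrite dz.
    by case: (single_forces_singles wb dw zb xb zx).
  have NW z : lab z = Some (~~ b, false) -> forall y, e z y =
      (lab y == Some (~~ b, true)) || (lab y == Some (b, false)).
    move=> zb y; case yE: (lab y) => [[b' [|]]|]; last by have := noZ yE.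
      by rewrite e_sym (lab_trace hl yE zb); case: (b) (b') => [] [].
    have [bE|bE] : b' = b \/ b' = ~~ b by case: (b) (b') => [] []; auto.
      by rewrite bE in yE *; rewrite eqxx orbT e_sym full.
    by rewrite bE in yE *; rewrite (piece0 (W0 _ zb) yE); case: (b).
  have n2_1 : nV (~~ b) = 1%N.
    apply/eqP; rewrite eqn_leq nV_gt0 andbT leqNgt; apply/negP => /card_gt1P[x [y]].
    rewrite !inE => -[/eqP xb /eqP yb /eqP]; apply; apply: (no_false_twins ge).
      by move=> z; rewrite !NW.
    by exists v0; rewrite NW // v0b eqxx orbT.
  have dbw : dV b w = nV b.
    by apply: piece_all => z zb; rewrite NW // zb eqxx orbT.
  have := coord_single wb dw; rewrite negbK c2 n2_1 dbw.
  by move: (nV b) (nK b) => n1 a; rewrite !expr2; clear; lia.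
have [|z0 z0b wz0] := half_edgeP w0b; first by rewrite W1.
have c1 : nK b = 2%N by have := half_edge_size ge hl w0b z0b wz0; rewrite negbK.
have compl : ~: [set z | (lab z == Some (b, true)) || (lab z == Some (~~ b, false))] =
    [set z | (lab z == Some (~~ b, true)) || (lab z == Some (~~ ~~ b, false))].
  apply/setP => z; rewrite !inE negbK; have := noZ (x := z).
  by case: (lab z) => [[b' [|]]|] //; case: (b) (b') => [] [].
(* Each half of K is grouped with the outside vertices not adjacent to it; this makes the two groups
   perfectly matched and completely joined. *)
exists [set z | (lab z == Some (b, true)) || (lab z == Some (~~ b, false))].
rewrite !compl; split.
- exact: (half_size c1 w0b z0b (edge_neq ge wz0)).
- by apply: (half_size c2 (w := v0) (x := x0)); rewrite ?negbK // (edge_neq ge vx0).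
- exact: (matching_half ge hl c1).
- by apply: (matching_half ge hl c2); rewrite negbK.
- move=> x y; rewrite !inE negbK => /orP[] /eqP xb /orP[] /eqP yb.
  + apply: (lab_clique hl xb yb); apply: (lab_neq xb yb); by case: (b).
  + exact: (lab_adj hl xb yb).
  + by rewrite e_sym; apply: (lab_adj hl yb xb).
  + by rewrite e_sym; apply: full.
Qed.

End NoEmptyTrace.

End BothHalves.

Ltac card_lia :=
  repeat match goal with H : context [#|_|] |- _ => revert H end;
  repeat match goal with |- context [#|?A|] => generalize #|A|; intro end;
  clear; lia.

(** * Vertices with empty trace *)

Section EmptyTrace.

Variables (T : finType) (e : rel T) (lab : T -> label).
Hypotheses (ge : good_graph e) (hl : clique_labelling e lab).

Let e_sym : symmetric e := good_sym ge.
Let e_irr : irreflexive e := good_irr ge.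

Local Notation nK b := #|[set x | lab x == Some (b, true)]|.
Local Notation nV b := #|[set x | lab x == Some (b, false)]|.
Local Notation dV b x := #|[set z | (lab z == Some (b, false)) && e x z]|.
Local Notation dZ x := #|[set z | (lab z == None) && e x z]|.

Hypothesis nV_gt0 : forall b : bool, (0 < nV b)%N.

Let dZ0 u : lab u = None -> dZ u = 0%N := empty_trace_isolated ge hl nV_gt0 (u := u).

(** The values of (|K| - 2, |V_b|, |V_{~~ b}|, degree of u) that solve the norm equation although
    [u] is not joined to all of V_b. *)
Definition exceptional_trace (k n1 n2 h : nat) :=
  (k, n1, n2, h) = (1, 4, 1, 3)%N \/ (k, n1, n2, h) = (2, 3, 2, 2)%N.

Lemma trace_cases u : lab u = None -> exists (b : bool) (k : nat),
  [/\ (0 < k)%N, (nK b + nK (~~ b) = k + 2)%N, dV (~~ b) u = 0%N &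
    dV b u = nV b /\ (k * nV b + k * nV (~~ b) + nV b * nV (~~ b)
                       = k * nV b * nV (~~ b))%N
    \/ exceptional_trace k (nV b) (nV (~~ b)) (dV b u)].
Proof.
move=> u0; have [k k_gt0 kE] := g_nat hl true.
have kN : (nK true + nK false = k + 2)%N by move: kE => /=; lia.
have := coord_ZZ ge hl true u0; rewrite dZ0 // kE addr0 => E.
case: (empty_trace_sizes k_gt0 (nV_gt0 true) (nV_gt0 false)
  (dV_le e lab true u) (dV_le e lab false u) E).
- by move=> [h1 h2 H]; exists true, k; split=> //; left.
- move=> [h1 h2 H]; exists false, k; split=> //=; first by rewrite addnC.
  left; split=> //; move: H => /=; move: (nV true) (nV false) => n1 n2; clear; lia.
- case=> -[? ? ? ? ?]; exists true, k; split=> //=; right; [left|right]; congruence.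
- case=> -[? ? ? ? ?]; exists false, k; split=> //=; try (by rewrite addnC); right;
    [left|right]; congruence.
Qed.

Lemma adjacent_single (b : bool) u v : lab u = None -> lab v = Some (b, false) -> e u v ->
  dV b v = 0%N.
Proof.
move=> u0 vb uv; case: (deg_cases ge hl vb) => // dv.
have [|x xb vx] := @half_edgeP _ e _ _ _ vb; first by rewrite dv.
by rewrite e_sym (half_edge_nadj ge hl vb xb vx u0) in uv.
Qed.

(** [u] sees only V_b, where [v] has no neighbour. *)
Lemma gram_traceless (b : bool) u v : lab u = None -> dV (~~ b) u = 0%N ->
  lab v = Some (b, false) -> dV b v = 0%N -> gram e u v = 0.
Proof.
move=> u0 du vb dv; rewrite (gram_outside (lab := lab) b).
- rewrite piece_none; last by move=> z zb; rewrite (piece0 dv zb) andbF.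
  rewrite piece_none; last by move=> z zb; rewrite (piece0 du zb).
  by rewrite piece_none // => z zb; rewrite (piece0 (dZ0 u0) zb).
- exact: (lab_neq u0 vb).
- by move=> b' z zb; rewrite e_sym (lab_no_trace hl zb u0).
Qed.

Lemma gram_opposite (b : bool) u w : lab u = None -> dV (~~ b) u = 0%N ->
  lab w = Some (~~ b, false) -> dV (~~ b) w = 0%N ->
  gram e u w = #|[set z | (lab z == Some (b, false)) && (e u z && e w z)]|%:Z.
Proof.
move=> u0 du wb dw; rewrite (gram_outside (lab := lab) b).
- rewrite [X in (_ + X + _)%N]piece_none; last by move=> z zb; rewrite (piece0 du zb).
  rewrite [X in (_ + _ + X)%N]piece_none ?addn0 //.
  by move=> z zb; rewrite (piece0 (dZ0 u0) zb).
- exact: (lab_neq u0 wb).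
- by move=> b' z zb; rewrite e_sym (lab_no_trace hl zb u0).
Qed.

(** Orthogonality of [u] and [v] in coordinates, divided by the positive degree of [u]. *)
Lemma traceless_eq (b : bool) u k v : lab u = None -> dV (~~ b) u = 0%N -> (0 < dV b u)%N ->
  (nK b + nK (~~ b) = k + 2)%N -> lab v = Some (b, false) -> dV b v = 0%N ->
  (k * dV (~~ b) v + k + nV (~~ b) = nV (~~ b) * nK b)%N.
Proof.
move=> u0 du h_gt0 kE vb dv; have := coord_ZV ge hl u0 vb.
rewrite (gram_traceless u0 du vb dv) dv du mulr0.
have kE' : (nK b)%:Z + (nK (~~ b))%:Z - 2 = k%:Z by lia.
rewrite kE'; move: (dV (~~ b) v) (nV (~~ b)) (nK b) (dV b u) h_gt0 (nV b) => i n2 a h h_gt0 n1.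
clear -h_gt0; move=> E.
have {}E : h%:Z * (k%:Z * i%:Z + k%:Z + n2%:Z - n2%:Z * a%:Z) = 0.
  by rewrite -[RHS]oppr0 [in RHS]E; ring.
move/eqP: E; rewrite mulf_eq0 eqz_nat (gtn_eqF h_gt0) /= => /eqP; lia.
Qed.

Lemma opposite_eq (b : bool) u k w : lab u = None -> dV (~~ b) u = 0%N ->
  (nK b + nK (~~ b) = k + 2)%N -> lab w = Some (~~ b, false) -> dV (~~ b) w = 0%N ->
  ((k * nV b + k * nV (~~ b) + nV b * nV (~~ b))
     * #|[set z | (lab z == Some (b, false)) && (e u z && e w z)]|
   = k * dV b u * (1 + dV b w) + nV (~~ b) * dV b u * (nK (~~ b) + dV b w))%N.
Proof.
move=> u0 du kE wb dw; have := coord_ZV ge hl u0 wb.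
rewrite (gram_opposite u0 du wb dw) dw du negbK.
have kE' : (nK (~~ b))%:Z + (nK b)%:Z - 2 = k%:Z by lia.
rewrite kE'; move: (nV (~~ b)) (nK (~~ b)) (dV b u) (nV b) (dV b w) => n2 c h n1 j.
by move: #|_| => m; clear; lia.
Qed.

Lemma card_nadj l u : (#|[set z | (lab z == l) && e u z]|
  + #|[set z | (lab z == l) && ~~ e u z]| = #|[set z | lab z == l]|)%N.
Proof.
rewrite -(cardsID [set z | e u z] [set z | lab z == l]).
by congr (_ + _)%N; apply: eq_card => z; rewrite !inE // andbC.
Qed.

Lemma opposite_single (b : bool) v0 w : lab v0 = Some (b, false) ->
  (nK b = 2%N -> dV (~~ b) v0 = 0%N) -> lab w = Some (~~ b, false) -> dV (~~ b) w = 0%N.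
Proof.
move=> v0b e0 wb; case: (deg_cases ge hl wb) => // dw; exfalso.
have [|x xb wx] := @half_edgeP _ e _ _ _ wb; first by rewrite dw.
have a2 := half_edge_size ge hl wb xb wx; rewrite negbK in a2.
have v0b' : lab v0 = Some (~~ ~~ b, false) by rewrite negbK.
have := half_edge_adj ge hl wb xb wx v0b'.
by rewrite e_sym (piece0 (e0 a2) wb).
Qed.

(** [u] misses exactly one vertex of V_b, whereas it would miss both ends of an edge inside V_b; so
    V_b is independent. Its vertices then have |K_b| - 2 neighbours in V_{~~ b}, and [opposite_eq]
    fails by divisibility in all cases but one, which falls to parity. *)
Lemma exceptional_false (b : bool) u k : lab u = None -> dV (~~ b) u = 0%N ->
  (nK b + nK (~~ b) = k + 2)%N ->
  exceptional_trace k (nV b) (nV (~~ b)) (dV b u) -> False.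
Proof.
move=> u0 du kE exc.
have h_gt0 : (0 < dV b u)%N by case: exc => -[_ _ _ ->].
have h1 : (dV b u).+1 = nV b by case: exc => -[_ -> _ ->].
have V0 v : lab v = Some (b, false) -> dV b v = 0%N.
  move=> vb; case: (deg_cases ge hl vb) => // dv; exfalso.
  have [|x xb vx] := @half_edgeP _ e _ _ _ vb; first by rewrite dv.
  have : (1 < #|[set z | (lab z == Some (b, false)) && ~~ e u z]|)%N.
    apply/card_gt1P; exists v, x; rewrite !inE vb xb eqxx (edge_neq ge vx) ![e u _]e_sym.
    by rewrite (half_edge_nadj ge hl vb xb vx u0) (half_edge_nadj ge hl xb vb _ u0) // e_sym.
  by have := card_nadj (Some (b, false)) u; rewrite -h1 -addn1 => /addnI ->.
have dvE v : lab v = Some (b, false) -> (dV (~~ b) v + 2 = nK b)%N.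
  move=> vb; have := traceless_eq u0 du h_gt0 kE vb (V0 v vb).
  by case: exc => -[-> _ -> _]; lia.
have [v0 v0b] := V_ex nV_gt0 b; have [w0 w0b] := V_ex nV_gt0 (~~ b).
have W0 w : lab w = Some (~~ b, false) -> dV (~~ b) w = 0%N.
  apply: (opposite_single v0b) => a2; by apply/eqP; rewrite -(eqn_add2r 2) (dvE _ v0b) a2.
have c_gt0 : (0 < nK (~~ b))%N := nK_gt0 hl (~~ b).
have opp w (wb : lab w = Some (~~ b, false)) := opposite_eq u0 du kE wb (W0 w wb).
have j0 w : lab w = Some (~~ b, false) -> nK b = 2%N -> dV b w = 0%N.
  move=> wb a2; apply: piece_none => z zb; rewrite e_sym.
  by apply: piece0 wb; have := dvE _ zb; lia.
have a_ge2 := dvE _ v0b.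
case: exc => -[k_ n1_ n2_ h_]; rewrite k_ n1_ n2_ h_ in opp kE.
  have a2 : nK b = 2%N by clear -a_ge2 kE c_gt0; card_lia.
  by have := opp _ w0b; clear -a2 kE j0 w0b; rewrite (j0 _ w0b a2); card_lia.
have [a2|a3] : nK b = 2%N \/ nK b = 3%N by clear -a_ge2 kE c_gt0; card_lia.
  by have := opp _ w0b; clear -a2 kE j0 w0b; rewrite (j0 _ w0b a2); card_lia.
have c1 : nK (~~ b) = 1%N by clear -a3 kE; card_lia.
(* The last case has k = 2, |K_b| = 3 and |K_{~~ b}| = 1: the three vertices of V_b send one edge
   each to the two vertices of V_{~~ b}, each of which has to receive an odd number. *)
have odd_j w : lab w = Some (~~ b, false) -> odd (dV b w).
  move=> /opp; rewrite c1; move: #|_| (dV b w) => m j H.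
  by have {H} : (2 * m = j + 1)%N by [lia]; lia.
have := double_count ge [set x | lab x == Some (b, false)] [set x | lab x == Some (~~ b, false)].
rewrite (eq_bigr (fun _ => 1%N)) ?sum_nat_const; last first.
  move=> v; rewrite inE => /eqP vb; have := dvE _ vb; rewrite a3.
  rewrite (_ : [set z | (lab z == Some (~~ b, false)) && e v z] =
    [set z in [set x | lab x == Some (~~ b, false)] | e v z]); first lia.
  by apply/setP => z; rewrite !inE.
have /eqP/cards2P[w1 [w2 [w12 WE]]] := n2_.
have w1b : lab w1 = Some (~~ b, false).
  by apply/eqP; have /setP/(_ w1) := WE; rewrite !inE eqxx.
have w2b : lab w2 = Some (~~ b, false).
  by apply/eqP; have /setP/(_ w2) := WE; rewrite !inE eqxx orbT.
rewrite n1_ WE big_setU1 ?inE //= big_set1.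
have dE w : #|[set x in [set x | lab x == Some (b, false)] | e w x]| = dV b w.
  by apply: eq_card => z; rewrite !inE.
by rewrite !dE => /(congr1 odd); rewrite oddD (odd_j _ w1b) (odd_j _ w2b).
Qed.

(** In the resulting form (vi) the clique block is K_b. The vertex [u] is the only one of empty
    trace and completes V_{~~ b}, as the single vertex of K_{~~ b} completes V_b; these two vertices
    are nonadjacent partners in the J - I block. *)
Lemma full_trace_structure (b : bool) u k : lab u = None -> dV (~~ b) u = 0%N -> (0 < k)%N ->
  (nK b + nK (~~ b) = k + 2)%N -> dV b u = nV b ->
  (k * nV b + k * nV (~~ b) + nV b * nV (~~ b) = k * nV b * nV (~~ b))%N ->
  structure_VI e.
Proof.
move=> u0 du k_gt0 kE full DE.
have n1_gt0 : (0 < nV b)%N := nV_gt0 b.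
have n2_gt0 : (0 < nV (~~ b))%N := nV_gt0 (~~ b).
have a_gt0 : (0 < nK b)%N := nK_gt0 hl b.
have c_gt0 : (0 < nK (~~ b))%N := nK_gt0 hl (~~ b).
have uV v : lab v = Some (b, false) -> e u v := piece_full full.
have V0 v : lab v = Some (b, false) -> dV b v = 0%N.
  by move=> vb; apply: (adjacent_single u0 vb (uV v vb)).
have h_gt0 : (0 < dV b u)%N by rewrite full.
have iE v : lab v = Some (b, false) ->
    (k * dV (~~ b) v + k + nV (~~ b) = nV (~~ b) * nK b)%N.
  by move=> vb; apply: (traceless_eq u0 du h_gt0 kE vb (V0 v vb)).
have jE w : lab w = Some (~~ b, false) -> dV (~~ b) w = 0%N ->
    (k * nV (~~ b) * dV b w
       = k * dV b w + k + nV (~~ b) * nK (~~ b) + nV (~~ b) * dV b w)%N.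
  move=> wb dw; have := opposite_eq u0 du kE wb dw; rewrite full DE.
  rewrite (_ : [set z | _ & _] = [set z | (lab z == Some (b, false)) && e w z]); last first.
    by apply/setP => z; rewrite !inE; case: eqP => //= zb; rewrite uV.
  move: n1_gt0; move: (nV b) (nV (~~ b)) (nK (~~ b)) (dV b w) => n1 n2 c j.
  clear; move=> n1_gt0 H; apply/eqP; rewrite -(eqn_pmul2l n1_gt0); apply/eqP; lia.
have [v0 v0b] := V_ex nV_gt0 b; have [w0 w0b] := V_ex nV_gt0 (~~ b).
(* Write n1 = |V_b|, n2 = |V_{~~ b}|. An edge in V_{~~ b} makes |K_b| = 2. If V_{~~ b} is matched,
   it is joined to V_b and k n2 + k + n2 = 2 n2, which fails; otherwise a vertex [z] without partner
   has j <= n1 neighbours in V_b and satisfies n2 j = n1 + n1 n2. *)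
have W0 w : lab w = Some (~~ b, false) -> dV (~~ b) w = 0%N.
  move=> wb; case: (deg_cases ge hl wb) => // dw; exfalso.
  have [|x xb wx] := @half_edgeP _ e _ _ _ wb; first by rewrite dw.
  have a2 : nK b = 2%N by have := half_edge_size ge hl wb xb wx; rewrite negbK.
  have c_k : nK (~~ b) = k by move: kE; rewrite a2; clear; card_lia.
  have [/forallP allpairs|] := boolP [forall w, (lab w == Some (~~ b, false)) ==> (dV (~~ b) w != 0%N)].
    have iv0 : dV (~~ b) v0 = nV (~~ b).
      apply: piece_all => z zb; have /implyP := allpairs z; rewrite zb eqxx => /(_ isT)/eqP dz.
      have [y yb zy] := @half_edgeP _ e _ _ _ zb dz.
      have v0b' : lab v0 = Some (~~ ~~ b, false) by rewrite negbK.
      by rewrite e_sym; apply: (half_edge_adj ge hl zb yb zy v0b').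
    have := iE _ v0b; rewrite iv0 a2; move: k_gt0; clear.
    move: (nV (~~ b)) => n2; case: k => // k _; lia.
  rewrite negb_forall => /existsP[z]; rewrite negb_imply negbK => /andP[/eqP zb /eqP dz].
  have := jE _ zb dz; rewrite c_k; have := dV_le e lab b z; move: n1_gt0 n2_gt0 k_gt0 DE.
  move: (nV b) (nV (~~ b)) (dV b z) => n1 n2 j; clear.
  move=> n1_gt0 n2_gt0 k_gt0 DE jn1 H.
  have {}H : (k * (n2 * j) = k * (n1 + n1 * n2))%N.
    have H1 : (n1 * (k * n2 * j) = n1 * (k * j + k + n2 * k + n2 * j))%N by rewrite H.
    have H2 : ((k * n1 + k * n2 + n1 * n2) * j = (k * n1 * n2) * j)%N by rewrite DE.
    by clear H DE; lia.
  move/eqP: H; rewrite eqn_pmul2l // => /eqP H.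
  by have := leq_mul (leqnn n2) jn1; rewrite H; lia.
have icst v : lab v = Some (b, false) -> dV (~~ b) v = dV (~~ b) v0.
  move=> vb; apply/eqP; rewrite -(eqn_pmul2l k_gt0) -(eqn_add2r (k + nV (~~ b))).
  by rewrite !addnA iE // iE.
have jcst w : lab w = Some (~~ b, false) -> dV b w = dV b w0.
  move=> wb; have := jE _ wb (W0 _ wb); have := jE _ w0b (W0 _ w0b).
  move: n1_gt0 n2_gt0 k_gt0 DE.
  move: (nV b) (nV (~~ b)) (nK (~~ b)) (dV b w) (dV b w0) => n1 n2 c j j'; clear.
  move=> n1_gt0 n2_gt0 k_gt0 DE H1 H2; apply/eqP.
  have kn2 : (0 < k * n2)%N by rewrite muln_gt0 k_gt0.
  rewrite -(eqn_pmul2l kn2); apply/eqP.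
  have E1 : (n1 * (k * n2 * j) = n1 * (k * j + k + n2 * c + n2 * j))%N by rewrite H2.
  have E2 : (n1 * (k * n2 * j') = n1 * (k * j' + k + n2 * c + n2 * j'))%N by rewrite H1.
  have E3 : ((k * n1 + k * n2 + n1 * n2) * j = (k * n1 * n2) * j)%N by rewrite DE.
  have E4 : ((k * n1 + k * n2 + n1 * n2) * j' = (k * n1 * n2) * j')%N by rewrite DE.
  by clear H1 H2 DE; lia.
have ijE := double_count_const ge icst jcst.
have [c1 n12 iN jN an1] := matched_sizes a_gt0 c_gt0 k_gt0 kE n1_gt0 n2_gt0 DE
  (iE _ v0b) (jE _ w0b (W0 _ w0b)) ijE.
have {}icst v : lab v = Some (b, false) -> dV (~~ b) v = (nV (~~ b) - 1)%N.
  by move=> /icst ->.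
have {}jcst w : lab w = Some (~~ b, false) -> dV b w = (nV b - 1)%N.
  by move=> /jcst ->.
have Nu z : e u z = (lab z == Some (b, false)).
  case: eqP => [/uV //|zb]; case zE: (lab z) => [[b' [|]]|].
  - by rewrite e_sym (lab_no_trace hl zE u0).
  - apply: (piece0 du); rewrite zE; move: zb; rewrite zE; by case: (b) (b') => [] [].
  - exact: (piece0 (dZ0 u0) zE).
(* A second vertex of empty trace would be a false twin of [u], or joined to all of V_{~~ b}; the
   latter contradicts [traceless_eq] because |K_{~~ b}| = 1. *)
have Zu x : lab x = None -> x = u.
  move=> x0; have [b' [k' [k'gt k'E dx cx]]] := trace_cases x0.
  have kk : k' = k by case: (eqVneq b' b) k'E kE => [->|]; [lia|case: (b) (b') => [] [] //= _; lia].
  subst k'; case: cx => [[fx _]|/(exceptional_false x0 dx k'E) //].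
  have [bE|bE] : b' = b \/ b' = ~~ b by case: (b) (b') => [] []; auto.
    rewrite {}bE in fx dx *; apply: (no_false_twins ge); last first.
      by exists v0; apply: piece_full fx v0b.
    move=> z; rewrite Nu; case: eqP => [/(piece_full fx) //|zb]; case zE: (lab z) => [[b1 [|]]|].
    - by rewrite e_sym (lab_no_trace hl zE x0).
    - apply: (piece0 dx); rewrite zE; move: zb; rewrite zE; by case: (b) (b1) => [] [].
    - exact: (piece0 (dZ0 x0) zE).
  exfalso; rewrite {}bE in fx dx k'E; have hx : (0 < dV (~~ b) x)%N by rewrite fx.
  have := traceless_eq x0 dx hx k'E w0b (W0 _ w0b); rewrite !negbK c1 muln1.
  by move: k_gt0; clear; card_lia.
have nadj1 l x : (0 < #|[set z | lab z == l]|)%N ->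
    #|[set z | (lab z == l) && e x z]| = (#|[set z | lab z == l]| - 1)%N ->
    #|[set z | (lab z == l) && ~~ e x z]| = 1%N.
  by move=> gt0 H; have := card_nadj l x; rewrite H; move: gt0; clear; card_lia.
exists [set x | lab x == Some (b, true)],
  [set x | (lab x == Some (~~ b, true)) || (lab x == Some (b, false))],
  [set x | (lab x == Some (~~ b, false)) || (lab x == None)].
split.
- split; first by apply/setP => z; rewrite !inE; case: (lab z) (b) => [[[] []]|] [].
  + by apply/pred0P => z /=; rewrite !inE; case: (lab z) (b) => [[[] []]|] [].
  + by apply/pred0P => z /=; rewrite !inE; case: (lab z) (b) => [[[] []]|] [].
  + by apply/pred0P => z /=; rewrite !inE; case: (lab z) (b) => [[[] []]|] [].
- split.
  + by apply/cliqueP => x y; rewrite !inE => /eqP xb /eqP yb; apply: (lab_clique hl xb yb).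
  + have /eqP/cards1P[x0 /setP x0E] := c1.
    move=> x y; rewrite !inE => /orP[]/eqP xb /orP[]/eqP yb.
    * have := x0E x; have := x0E y; rewrite !inE xb yb eqxx => /esym/eqP-> /esym/eqP->.
      exact: e_irr.
    * by rewrite (lab_nadj ge hl xb yb).
    * by rewrite (lab_nadj ge hl yb xb).
    * exact: (piece0 (V0 _ xb) yb).
  + move=> x y; rewrite !inE => /orP[]/eqP xb /orP[]/eqP yb.
    * exact: (piece0 (W0 _ xb) yb).
    * by rewrite (Zu _ yb) e_sym Nu xb; case: (b).
    * by rewrite (Zu _ xb) Nu yb; case: (b).
    * by rewrite (Zu _ xb) (Zu _ yb) e_irr.
- split.
  + move=> x y; rewrite !inE => /eqP xb /orP[]/eqP yb; last exact: (lab_adj hl xb yb).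
    by apply: (lab_clique hl xb yb); apply: (lab_neq xb yb); case: (b).
  + move=> x y; rewrite !inE => /eqP xb /orP[]/eqP yb; last exact: (lab_no_trace hl xb yb).
    by rewrite (lab_trace hl xb yb); case: (b).
  + move=> x; rewrite inE => /orP[]/eqP xb.
      rewrite -(cards1 u); apply: eq_card => z; rewrite !inE.
      case zE: (lab z) => [l|]; last by rewrite (lab_no_trace hl xb zE) (Zu _ zE) !eqxx orbT.
      have -> : (z == u) = false by apply/eqP => zu; rewrite zu u0 in zE.
      rewrite orbF; case: eqP => //= lE; rewrite lE in zE.
      by rewrite (lab_adj hl xb zE).
    rewrite -(nadj1 _ _ n2_gt0 (icst _ xb)); apply: eq_card => z; rewrite !inE.
    case: (lab z =P None) => [z0|_]; last by rewrite orbF.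
    by rewrite (Zu _ z0) e_sym uV // andbF u0.
  + move=> x; rewrite inE => /orP[]/eqP xb; last first.
      rewrite (Zu _ xb) -c1; apply: eq_card => z; rewrite !inE Nu.
      by case: (lab z) (b) => [[[] []]|] [].
    rewrite -(nadj1 _ _ n1_gt0 (jcst _ xb)); apply: eq_card => z; rewrite !inE.
    case: (lab z =P Some (~~ b, true)) => [zb|_] //=.
    by rewrite e_sym (lab_adj hl zb xb) zb; case: (b).
- have -> : #|[set x | (lab x == Some (~~ b, true)) || (lab x == Some (b, false))]| = (nV b).+1.
    have -> : [set x | (lab x == Some (~~ b, true)) || (lab x == Some (b, false))] =
      [set x | lab x == Some (~~ b, true)] :|: [set x | lab x == Some (b, false)].
      by apply/setP => z; rewrite !inE.
    rewrite cardsU c1 [X in (_ - X)%N](_ : _ = 0%N) ?subn0 ?add1n //.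
    by apply: eq_card0 => z; rewrite !inE; case: (lab z) (b) => [[[] []]|] [].
  by case: an1 => -[-> ->]; [left|right].
Qed.

End EmptyTrace.

Lemma triangle_structure (T : finType) (e : rel T) x y z : good_graph e ->
  e x y -> e x z -> e y z ->
  [\/ structure_II e, structure_III e, structure_V e | structure_VI e].
Proof.
move=> ge xy xz yz; have [lab hl] := exists_clique_labelling ge xy xz yz.
have [both|[b nb]] : (forall b : bool, (0 < #|[set x | lab x == Some (b, false)]|)%N) \/
    exists b : bool, #|[set x | lab x == Some (~~ b, false)]| = 0%N.
  have [t0|t0] := posnP #|[set x | lab x == Some (true, false)]|.
    by right; exists false.
  have [f0|f0] := posnP #|[set x | lab x == Some (false, false)]|.
    by right; exists true.
  by left; case.
- have [/existsP[u /eqP u0]|] := boolP [exists u, lab u == None].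
    constructor 4; have [b [k [k_gt0 kE du [[full DE]|exc]]]] := trace_cases ge hl both u0.
      exact: (full_trace_structure ge hl both u0 du k_gt0 kE full DE).
    by case: (exceptional_false ge hl both u0 du kE exc).
  rewrite negb_exists => /forallP noZ; constructor 2.
  by apply: (no_empty_trace_structure ge hl both) => u; apply/eqP.
- by case: (one_half ge hl nb) => ?; [constructor 1|constructor 3].
Qed.

(** * Triangle-free graphs *)

Definition structure_I (T : finType) (e : rel T) := exists U : {set T},
  [/\ (2 < #|U|)%N, independent e U, independent e (~: U), cocktail e U (~: U)
    & cocktail e (~: U) U].

Definition bipartite_blocks (T : finType) (e : rel T) (A1 A2 B1 B2 : {set T}) :=
  [/\ A1 :|: A2 = ~: (B1 :|: B2), [disjoint A1 & A2], [disjoint B1 & B2],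
      independent e (A1 :|: A2) & independent e (B1 :|: B2)].

Definition structure_IV5 (T : finType) (e : rel T) := exists (z y : T) (A B : {set T}),
  [/\ bipartite_blocks e [set z] A [set y] B, (#|A| = 4 /\ #|B| = 4)%N, e z y,
      joined e [set z] B /\ joined e [set y] A &
      {in A, forall x, #|[set w in B | e x w]| = 1%N} /\
      {in B, forall x, #|[set w in A | e x w]| = 1%N}].

Definition structure_IV6 (T : finType) (e : rel T) := exists A1 A2 B1 B2 : {set T},
  [/\ bipartite_blocks e A1 A2 B1 B2,
      [/\ #|A1| = 3, #|A2| = 3, #|B1| = 3 & #|B2| = 3]%N,
      joined e A1 B2, {in A2 & B1, forall x y, e x y = false} &
      [/\ cocktail e A1 B1, cocktail e B1 A1, cocktail e A2 B2 & cocktail e B2 A2]].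

(** For d <= d' the equation squeezes c between d - 1 and d. The value d - 1 gives equal degrees; c
    = d makes d - 1 divide d^2 = (d - 1)(d + 1) + 1, so d = 2 and d' = 5. *)
Lemma parallel_degrees (c d d' : nat) : (c <= d -> c <= d' -> 2 <= d -> 2 <= d' ->
  c ^ 2 = (d - 1) * (d' - 1) ->
  [\/ d = d' /\ c = d - 1, [/\ d = 2, d' = 5 & c = 2] | [/\ d = 5, d' = 2 & c = 2]])%N.
Proof.
wlog dd' : d d' / (d <= d')%N => [H cd cd' d2 d'2 E|].
  have [dd'|/ltnW dd'] := leqP d d'; first exact: H.
  case: (H d' d) => //; first by rewrite mulnC.
  - by move=> [-> ->]; constructor 1.
  - by move=> [-> -> ->]; constructor 3.
  - by move=> [-> -> ->]; constructor 2.
move=> cd _ d2 _; rewrite -mulnn => E.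
have [k kE] : exists k, (d = k + 2)%N by exists (d - 2)%N; lia.
have [m mE] : exists m, (d' = k + m + 2)%N by exists (d' - d)%N; lia.
subst d d'; rewrite (_ : k + 2 - 1 = k.+1)%N in E *; last by lia.
rewrite (_ : k + m + 2 - 1 = (k + m).+1)%N in E; last by lia.
have : (k.+1 <= c)%N.
  rewrite leqNgt; apply/negP => ck; have := leq_mul ck ck;
    have := leq_mul (leqnn k.+1) (leq_addr m k).
  by lia.
rewrite leq_eqVlt => /orP[/eqP cE|ck].
  subst c; constructor 1; split=> //; have : (k.+1 * m = 0)%N by lia.
  by move/eqP; rewrite muln_eq0 /= => /eqP ->; rewrite addn0.
have cE : c = k.+2 by lia.
subst c; constructor 2.
have [k0|k_gt0] := posnP k; first by subst k; split; lia.
exfalso; have : (k * m + m = 2 * k + 3)%N by lia.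
have [m2|m3] := leqP m 2; last first.
  by have := leq_mul (leqnn k) m3; lia.
by have := leq_mul (leqnn k) m2; lia.
Qed.

Section TriangleFree.

Variables (T : finType) (e : rel T).
Hypothesis ge : good_graph e.

Let e_sym : symmetric e := good_sym ge.

Local Notation dg x := #|[set z | e x z]|.

(** A vertex of degree one has Gram norm 0, hence a zero Gram row and no codegree with any other
    vertex. Its neighbour then has no further neighbour, and the whole graph is an edge with zero
    Gram form. *)
Lemma degree_ge2 x : (2 <= dg x)%N.
Proof.
case E: (dg x) => [|[|d]] //; exfalso.
  have full : forall y, pred1 x y.
    apply: (closed_set_full ge (x0 := x)) => //= y z /eqP -> xz.
    by have /setP/(_ z) := cards0_eq E; rewrite !inE xz.
  have [y [z]] := good_rank_ge2 ge.
  by rewrite (eqP (full y)) (eqP (full z)) expr2 eqxx.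
have /eqP/cards1P[w /setP wE] := E.
have Nx z : e x z = (z == w) by have := wE z; rewrite !inE.
have gx y : gram e x y = 0.
  have := good_psd ge x y; rewrite gramxx E subrr mul0r => H.
  by apply/eqP; rewrite -(sqrf_eq0 (gram e x y)) eq_le H sqr_ge0.
have Nw z : e w z = (z == x).
  have [->|zx] := eqVneq z x; first by rewrite e_sym Nx eqxx.
  apply/negP => wz; have := gx z; rewrite gram_neq 1?eq_sym // => /eqP.
  rewrite eqz_nat => /eqP/cards0_eq/setP/(_ w); rewrite !inE Nx eqxx /=.
  by rewrite e_sym wz.
have full : forall y, pred2 x w y.
  apply: (closed_set_full ge (x0 := x)); first by rewrite /= eqxx.
  move=> y z /= /orP[] /eqP ->; first by rewrite Nx => ->; rewrite orbT.
  by rewrite Nw => ->.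
have gw y : gram e w y = 0.
  have := full y => /= /orP[] /eqP ->; first by rewrite gram_sym gx.
  rewrite gramxx; have -> : [set z | e w z] = [set x] by apply/setP => z; rewrite !inE Nw.
  by rewrite cards1 subrr.
have [y [z]] := good_rank_ge2 ge.
by have := full y => /= /orP[] /eqP ->; rewrite !(gx, gw) expr2 !mul0r eqxx.
Qed.

(** The last clause is equality in the Cauchy-Schwarz inequality: Gram vectors on the same side are
    proportional. *)
Definition parallel_sides (U : {set T}) := [/\ U != set0, ~: U != set0,
  forall x y, e x y -> (x \in U) != (y \in U) &
  forall x y, x != y -> (x \in U) = (y \in U) ->
    (codeg e x y ^ 2 = (dg x - 1) * (dg y - 1))%N].

(** Adjacent vertices have no common neighbour, so their Gram vectors are orthogonal. An edge p q
    thus gives two orthogonal axes of the Gram plane; a neighbour of a vertex on one axis lies on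
    the other, and by connectedness every vertex lies on an axis. *)
Lemma triangle_free_sides : (forall x y z, e x y -> e x z -> e y z = false) ->
  exists U, parallel_sides U.
Proof.
move=> tf; have [p [_ _]] := good_rank_ge2 ge.
have /card_gt0P[q] : (0 < dg p)%N by apply: leq_trans (degree_ge2 p).
rewrite inE => pq.
have edge0 x y : e x y -> gram e x y = 0.
  move=> xy; rewrite gram_neq ?(edge_neq ge) //; apply/eqP; rewrite eqz_nat cards_eq0.
  apply/eqP/setP => z; rewrite !inE; apply/negP => /andP[xz yz].
  by rewrite (tf _ _ _ xy xz) in yz.
have pos x : 0 < gram e x x by rewrite gramxx subr_gt0 ltz_nat degree_ge2.
have F x y : gram e p p * gram e q q * gram e x y =
    gram e x p * gram e y p * gram e q q + gram e x q * gram e y q * gram e p p.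
  have := good_rank_le2 ge p q x y; rewrite (edge0 _ _ pq).
  rewrite (gram_sym e p x) (gram_sym e p y) (gram_sym e q y) => H.
  by apply/eqP; rewrite -subr_eq0 -H; apply/eqP; ring.
have pp_neq0 : gram e p p != 0 by rewrite gt_eqF.
have qq_neq0 : gram e q q != 0 by rewrite gt_eqF.
have next x y : e x y -> (gram e x p == 0) != (gram e x q == 0) ->
    (gram e y p == 0) != (gram e y q == 0) /\ (gram e y q == 0) != (gram e x q == 0).
  move=> xy xS; have := F x y; rewrite (edge0 _ _ xy) mulr0.
  have := F y y; have := pos y.
  case: (eqVneq (gram e x p) 0) xS => [->|xp]; case: (eqVneq (gram e x q) 0) => [->|xq] // _;
      rewrite !(mul0r, add0r, addr0) => yy Fyy /esym/eqP;
      rewrite !mulf_eq0 ?(negPf xp) ?(negPf xq) ?(negPf pp_neq0) ?(negPf qq_neq0) ?orbF /=.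
    move=> yq0; rewrite yq0; split=> //; case: (gram e y p =P 0) => // yp0; move: Fyy.
    rewrite yp0 (eqP yq0) !mul0r addr0 => /eqP; rewrite !mulf_eq0 (negPf pp_neq0) (negPf qq_neq0).
    by rewrite (gt_eqF yy).
  move=> yp0; rewrite yp0; case: (gram e y q =P 0) => // yq0; move: Fyy.
  rewrite yq0 (eqP yp0) !mul0r addr0 => /eqP; rewrite !mulf_eq0 (negPf pp_neq0) (negPf qq_neq0).
  by rewrite (gt_eqF yy).
have S : forall x, (gram e x p == 0) != (gram e x q == 0).
  apply: (closed_set_full ge (S := fun x => (gram e x p == 0) != (gram e x q == 0)) (x0 := p)).
    by rewrite (edge0 _ _ pq) eqxx (negPf pp_neq0).
  by move=> x y xS xy; have [] := next x y xy xS.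
exists [set x | gram e x q == 0]; split.
- by apply/set0Pn; exists p; rewrite inE (edge0 _ _ pq).
- by apply/set0Pn; exists q; rewrite !inE.
- by move=> x y xy; rewrite !inE eq_sym; have [] := next x y xy (S x).
- move=> x y xy; rewrite !inE => same.
  have : gram e x y ^+ 2 = gram e x x * gram e y y.
    have D0 : gram e p p * gram e q q != 0 by rewrite mulf_neq0.
    apply: (mulfI (mulf_neq0 D0 D0)).
    transitivity ((gram e p p * gram e q q * gram e x y) ^+ 2); first by ring.
    transitivity ((gram e p p * gram e q q * gram e x x) *
      (gram e p p * gram e q q * gram e y y)); last by ring.
    rewrite !F; have := S x; have := S y; move: same.
    case: (eqVneq (gram e x q) 0) => [->|xq]; case: (eqVneq (gram e y q) 0) => [->|yq] //= _.
      by move=> _ _; ring.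
    by rewrite !eqbF_neg !negbK => /eqP -> /eqP ->; ring.
  rewrite gram_neq // !gramxx; move: (degree_ge2 x) (degree_ge2 y).
  move: (codeg e x y) (dg x) (dg y) => c d d'; clear.
  case: d => // d _; case: d' => // d' _.
  have subS k : k.+1%:Z - 1 = k%:Z by lia.
  by rewrite !subS expr2 !subn1 -mulnn -!PoszM => -[].
Qed.

Section Sides.

Variable U : {set T}.
Hypothesis pU : parallel_sides U.

Lemma parallel_sidesC : parallel_sides (~: U).
Proof.
have [U0 W0 bip par] := pU; split=> //; first by rewrite setCK.
  by move=> x y /bip; rewrite !inE; case: (x \in U) (y \in U) => [] [].
by move=> x y xy; rewrite !inE => /negb_inj; apply: par.
Qed.

Lemma side_cases : (exists d, {in U, forall x, dg x = d}) \/
  [/\ {in U, forall x, dg x = 2%N \/ dg x = 5%N}, exists2 x, x \in U & dg x = 2%N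
    & exists2 x, x \in U & dg x = 5%N].
Proof.
have [U0 W0 bip par] := pU.
have pairs x y : x != y -> (x \in U) = (y \in U) ->
    [\/ dg x = dg y /\ codeg e x y = (dg x - 1)%N,
        [/\ dg x = 2, dg y = 5 & codeg e x y = 2]%N | [/\ dg x = 5, dg y = 2 & codeg e x y = 2]%N].
  move=> xy xyU; apply: parallel_degrees; rewrite ?degree_ge2 //; last exact: par.
    by apply: subset_leq_card; apply/subsetP => z; rewrite !inE => /andP[].
  by apply: subset_leq_card; apply/subsetP => z; rewrite !inE => /andP[].
have /set0Pn[x0 x0U] := U0.
have [/forall_inP cst|] := boolP [forall x in U, dg x == dg x0].
  by left; exists (dg x0) => x /cst/eqP.
rewrite negb_forall_in => /exists_inP[x1 x1U x10]; right.
have x01 : x1 != x0 by apply: contraNneq x10 => ->.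
have [[a aU a2] [c cU c5]] : (exists2 x, x \in U & dg x = 2%N) /\ (exists2 x, x \in U & dg x = 5%N).
  case: (pairs _ _ x01); first by rewrite x0U.
  - by case=> E _; rewrite E eqxx in x10.
  - by case=> E1 E2 _; split; [exists x1|exists x0].
  - by case=> E1 E2 _; split; [exists x0|exists x1].
split; [|by exists a|by exists c] => x xU.
have [->|xa] := eqVneq x a; first by left.
case: (pairs _ _ xa); first by rewrite xU.
- by case=> -> _; left.
- by case=> _; rewrite a2.
- by case=> -> _ _; right.
Qed.

Lemma codeg_equal_deg x y : x != y -> (x \in U) = (y \in U) -> dg x = dg y ->
  codeg e x y = (dg x - 1)%N.
Proof.
have [_ _ _ par] := pU; move=> xy xyU E; have := par x y xy xyU.
by rewrite -E mulnn => /eqP; rewrite eqn_sqr => /eqP.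
Qed.

Lemma codeg_2_5 x y : x != y -> (x \in U) = (y \in U) -> dg x = 2%N -> dg y = 5%N ->
  codeg e x y = 2%N.
Proof.
have [_ _ _ par] := pU; move=> xy xyU E1 E2; have := par x y xy xyU.
by rewrite E1 E2 => /eqP; rewrite (eqn_sqr _ 2) => /eqP.
Qed.

Lemma codegxx x : codeg e x x = dg x.
Proof. by apply: eq_card => z; rewrite !inE andbb. Qed.

(** Two counts of the walks of length two that start at [x]. *)
Lemma codeg_sum x : x \in U ->
  (\sum_(y in U) codeg e x y = \sum_(z in [set z | e x z]) dg z)%N.
Proof.
have [_ _ bip _] := pU; move=> xU.
transitivity (\sum_(y in U) #|[set z in [set z | e x z] | e y z]|)%N.
  by apply: eq_bigr => y _; apply: eq_card => z; rewrite !inE.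
rewrite (double_count ge); apply: eq_bigr => z; rewrite inE => xz.
apply: eq_card => y; rewrite !inE; case: (boolP (e z y)) => zy; rewrite ?andbF // andbT.
by move: (bip _ _ xz) (bip _ _ zy); rewrite xU; case: (z \in U) (y \in U) => [] [].
Qed.

Lemma side_independent : independent e U.
Proof.
have [_ _ bip _] := pU; move=> x y xU yU; apply/negP => /bip.
by rewrite xU yU.
Qed.

Lemma degree_across x : x \in U -> #|[set z in ~: U | e x z]| = dg x.
Proof.
have [_ _ bip _] := pU; move=> xU; apply: eq_card => z; rewrite !inE.
by case: (boolP (e x z)) => [/bip|]; rewrite ?andbF // xU andbT.
Qed.

Lemma constant_sum d x : {in U, forall x, dg x = d} -> x \in U ->
  (\sum_(y in U) codeg e x y = d + #|U|.-1 * (d - 1))%N.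
Proof.
move=> Ud xU; rewrite (bigD1 x) //= codegxx Ud //; congr (_ + _)%N.
rewrite (eq_bigr (fun _ => (d - 1)%N)); last first.
  move=> y /andP[yU yx]; rewrite codeg_equal_deg ?Ud // 1?eq_sym //.
  by rewrite xU yU.
rewrite sum_nat_const (cardsD1 x U) xU add1n /=; congr (_ * _)%N.
by apply: eq_card => y; rewrite !inE andbC.
Qed.

End Sides.

End TriangleFree.

(** * Degree counts on the two sides *)

Section BipartiteCase.

Variables (T : finType) (e : rel T).
Hypothesis ge : good_graph e.

Local Notation dg x := #|[set z | e x z]|.
Local Notation dS S x := #|[set z in S | e x z]|.

Definition mixed_degrees (U : {set T}) :=
  [/\ {in U, forall x, dg x = 2%N \/ dg x = 5%N}, exists2 x, x \in U & dg x = 2%N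
    & exists2 x, x \in U & dg x = 5%N].

Definition deg_part (U : {set T}) k := [set x in U | dg x == k].

Lemma cocktail_full (A B : {set T}) k : #|B| = k.+1 -> {in A, forall x, dS B x = k} ->
  cocktail e A B.
Proof.
move=> Bk Ad x xA; have := cardsID [set z | e x z] B; rewrite Bk.
have -> : B :&: [set z | e x z] = [set z in B | e x z] by apply/setP => z; rewrite !inE.
rewrite Ad // -addn1 => /addnI <-.
by apply: eq_card => z; rewrite !inE andbC.
Qed.

Lemma full_joined (A B : {set T}) : {in A, forall x, dS B x = #|B|} -> joined e A B.
Proof.
move=> Ad x y xA yB; have /setP/(_ y) : [set z in B | e x z] = B.
  by apply/eqP; rewrite eqEcard Ad // leqnn andbT; apply/subsetP => z; rewrite !inE => /andP[].
by rewrite !inE yB.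
Qed.

Lemma constant_structure U d d' : parallel_sides e U -> {in U, forall x, dg x = d} ->
  {in ~: U, forall x, dg x = d'} -> structure_I e.
Proof.
move=> pU Ud Wd; have pW := parallel_sidesC pU.
have [U0 W0 bip _] := pU.
have /set0Pn[x xU] := U0; have /set0Pn[y yW] := W0.
have d2 : (2 <= d)%N by rewrite -(Ud x xU) degree_ge2.
have d'2 : (2 <= d')%N by rewrite -(Wd y yW) degree_ge2.
have nbr (S : {set T}) (c : nat) z : z \in S -> parallel_sides e S ->
    {in ~: S, forall x, dg x = c} ->
    (\sum_(w in [set w | e z w]) dg w = dg z * c)%N.
  move=> zS [_ _ bS _] Sc; rewrite -sum_nat_const; apply: eq_bigr => w; rewrite inE => zw.
  by apply: Sc; rewrite inE; have := bS _ _ zw; rewrite zS; case: (w \in S).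
have EU := constant_sum pU Ud xU; rewrite (codeg_sum ge pU xU) (nbr _ _ _ xU pU Wd) Ud // in EU.
have EW := constant_sum pW Wd yW; rewrite (codeg_sum ge pW yW) in EW.
have Ud' : {in ~: ~: U, forall x, dg x = d} by rewrite setCK.
rewrite (nbr _ _ _ yW pW Ud') Wd // in EW.
have EE : (#|U| * d = #|~: U| * d')%N.
  rewrite -!sum_nat_const.
  rewrite (eq_bigr (fun x => dS (~: U) x)); last by move=> z zU; rewrite (degree_across pU) ?Ud.
  rewrite (double_count ge); apply: eq_bigr => z zW.
  by have := degree_across pW zW; rewrite setCK (Wd z zW).
have u_gt0 : (0 < #|U|)%N by rewrite card_gt0.
have w_gt0 : (0 < #|~: U|)%N by rewrite card_gt0.
(* With W the other side, the counts say |U| (d - 1) = d d' - 1 = |W| (d' - 1) and |U| d = |W| d'.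
   Subtraction gives |U| = |W|, then d = d' and |U| = d + 1. *)
have [uE [wE dd']] : #|U| = d.+1 /\ #|~: U| = d.+1 /\ d' = d.
  move: EU EW EE u_gt0 w_gt0 d2 d'2; move: #|U| #|~: U| => u w; clear.
  case: u => // u; case: w => // w; case: d => [|[|d]] //; case: d' => [|[|d']] //=.
  move=> EU EW EE _ _ _ _; rewrite !subn1 /= in EU EW.
  have uw : u = w by lia.
  subst w; have {EE} dd' : d = d'.
    by have /eqP := EE; rewrite eqn_pmul2l // => /eqP; lia.
  subst d'; have /eqP : (d.+1 * u = d.+1 * d.+2)%N by lia.
  by rewrite eqn_pmul2l // => /eqP ->.
exists U; split.
- by rewrite uE ltnS.
- exact: side_independent pU.
- exact: side_independent pW.
- by apply: (cocktail_full (k := d)) => // z zU; rewrite (degree_across pU) ?Ud.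
- apply: (cocktail_full (k := d)) => // z zW.
  by have := degree_across pW zW; rewrite setCK (Wd z zW) dd'.
Qed.

Lemma mixed_partition U (F : T -> nat) : mixed_degrees U ->
  (\sum_(y in U) F y = \sum_(y in deg_part U 2) F y + \sum_(y in deg_part U 5) F y)%N.
Proof.
move=> [U25 _ _]; rewrite (bigID (fun y => dg y == 2%N)) /=; congr (_ + _)%N.
  by apply: eq_bigl => y; rewrite inE.
apply: eq_bigl => y; rewrite inE; case: (boolP (y \in U)) => //= yU.
by case: (U25 y yU) => ->.
Qed.

Lemma sum_but_one (A : {set T}) (F : T -> nat) x c : x \in A ->
  {in A, forall y, y != x -> F y = c} -> (\sum_(y in A) F y + c = F x + #|A| * c)%N.
Proof.
move=> xA Fc; rewrite (bigD1 x) //= (eq_bigr (fun _ => c)); last first.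
  by move=> y /andP[yA yx]; apply: Fc.
rewrite sum_nat_const -addnA; congr (_ + _)%N; rewrite [#|A|](cardsD1 x) xA mulnDl mul1n addnC.
by congr (_ + _ * _)%N; apply: eq_card => y; rewrite !inE andbC.
Qed.

Lemma mixed_sum2 U x : parallel_sides e U -> mixed_degrees U -> x \in deg_part U 2 ->
  (\sum_(y in U) codeg e x y = 1 + #|deg_part U 2| + 2 * #|deg_part U 5|)%N.
Proof.
move=> pU mU xU2; have := xU2; rewrite inE => /andP[xU /eqP dx].
rewrite mixed_partition //.
have := @sum_but_one (deg_part U 2) (codeg e x) x 1 xU2.
rewrite codegxx dx => E.
have {}E : (\sum_(y in deg_part U 2) codeg e x y + 1 = 2 + #|deg_part U 2| * 1)%N.
  apply: E => y; rewrite inE => /andP[yU /eqP dy] yx.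
  by rewrite (codeg_equal_deg pU) ?dx ?dy 1?eq_sym // xU yU.
rewrite [X in (_ + X)%N](eq_bigr (fun _ => 2%N)) ?sum_nat_const; first by clear -E; lia.
move=> y; rewrite inE => /andP[yU /eqP dy]; apply: (codeg_2_5 pU); rewrite ?xU ?yU //.
by apply/eqP => xy; rewrite -xy dx in dy.
Qed.

Lemma mixed_sum5 U x : parallel_sides e U -> mixed_degrees U -> x \in deg_part U 5 ->
  (\sum_(y in U) codeg e x y = 1 + 4 * #|deg_part U 5| + 2 * #|deg_part U 2|)%N.
Proof.
move=> pU mU xU5; have := xU5; rewrite inE => /andP[xU /eqP dx].
rewrite mixed_partition //.
have := @sum_but_one (deg_part U 5) (codeg e x) x 4 xU5.
rewrite codegxx dx => E.
have {}E : (\sum_(y in deg_part U 5) codeg e x y + 4 = 5 + #|deg_part U 5| * 4)%N.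
  apply: E => y; rewrite inE => /andP[yU /eqP dy] yx.
  by rewrite (codeg_equal_deg pU) ?dx ?dy 1?eq_sym // xU yU.
rewrite [X in (X + _)%N](eq_bigr (fun _ => 2%N)) ?sum_nat_const; first by clear -E; lia.
move=> y; rewrite inE => /andP[yU /eqP dy].
rewrite /codeg; under eq_finset do rewrite andbC.
apply: (codeg_2_5 pU); rewrite ?xU ?yU //.
by apply/eqP => xy; rewrite xy dx in dy.
Qed.

(** If U has a vertices of degree 2 and b of degree 5, the codegree sums give 2d = 1 + a + 2b and 5d
    = 1 + 2a + 4b, so d = -1. *)
Lemma not_half_mixed U d : parallel_sides e U -> mixed_degrees U ->
  {in ~: U, forall x, dg x = d} -> False.
Proof.
move=> pU mU Wd; have [_ [x xU dx] [y yU dy]] := mU.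
have [_ _ bip _] := pU.
have nbr z : z \in U -> (\sum_(w in [set w | e z w]) dg w = dg z * d)%N.
  move=> zU; rewrite -sum_nat_const; apply: eq_bigr => w; rewrite inE => zw.
  by apply: Wd; rewrite inE; have := bip _ _ zw; rewrite zU; case: (w \in U).
have := @mixed_sum2 U x pU mU; rewrite inE xU dx => /(_ isT).
rewrite (codeg_sum ge pU) // nbr // dx.
have := @mixed_sum5 U y pU mU; rewrite inE yU dy => /(_ isT).
rewrite (codeg_sum ge pU) // nbr // dy.
by move: #|_| #|_| => u2 u5; clear; lia.
Qed.

Lemma mixed_neighbours U x : parallel_sides e U -> mixed_degrees (~: U) -> x \in U ->
  (\sum_(z in [set z | e x z]) dg z = 2 * dS (deg_part (~: U) 2) x
     + 5 * dS (deg_part (~: U) 5) x)%N /\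
  (dg x = dS (deg_part (~: U) 2) x + dS (deg_part (~: U) 5) x)%N.
Proof.
move=> [_ _ bip _] [W25 _ _] xU.
have W z : e x z -> z \in ~: U by rewrite inE => /bip; rewrite xU; case: (z \in U).
split.
  rewrite (bigID (fun z => dg z == 2%N)) /= !(mulnC _ #|_|) -!sum_nat_const; congr (_ + _)%N.
    rewrite [LHS](eq_bigr (fun _ => 2%N)); last by move=> z /andP[_ /eqP].
    apply: eq_bigl => z; rewrite !inE; case: (boolP (e x z)) => [/W|]; rewrite ?andbF //.
    by rewrite inE => ->; rewrite andbT.
  rewrite [LHS](eq_bigr (fun _ => 5%N)); last first.
    by move=> z; rewrite inE => /andP[/W/W25[->//|->]].
  apply: eq_bigl => z; rewrite !inE; case: (boolP (e x z)) => [xz|]; rewrite ?andbF //.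
  by have zW := W _ xz; have := zW; rewrite inE => ->; case: (W25 _ zW) => ->.
rewrite -cardsUI [X in (_ + X)%N](_ : _ = 0%N) ?addn0.
  apply: eq_card => z; rewrite !inE; case: (boolP (e x z)) => [xz|]; rewrite ?andbF //.
  by have zW := W _ xz; have := zW; rewrite inE => ->; case: (W25 _ zW) => ->.
by apply: eq_card0 => z; rewrite !inE; case: (dg z =P 2%N) => [->|]; rewrite ?andbF.
Qed.

(** [i] counts the degree-5 neighbours of a degree-2 vertex. Comparing codegree sums shows that a
    degree-5 vertex has 2i - 1 of them, which leaves i = 1 and i = 2; these become the two graphs of
    (iv). *)
Lemma mixed_counts U : parallel_sides e U -> mixed_degrees U -> mixed_degrees (~: U) ->
  exists i, [/\ i = 1%N \/ i = 2%N,
    (#|deg_part U 2| + 2 * #|deg_part U 5| = 3 + 3 * i)%N,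
    {in deg_part U 2, forall x, dS (deg_part (~: U) 5) x = i /\
                                dS (deg_part (~: U) 2) x = (2 - i)%N} &
    {in deg_part U 5, forall x, dS (deg_part (~: U) 5) x = (2 * i - 1)%N /\
                                dS (deg_part (~: U) 2) x = (6 - 2 * i)%N}].
Proof.
move=> pU mU mW.
have E2 x : x \in deg_part U 2 -> (#|deg_part U 2| + 2 * #|deg_part U 5|
      = 3 + 3 * dS (deg_part (~: U) 5) x)%N /\
    (2 = dS (deg_part (~: U) 2) x + dS (deg_part (~: U) 5) x)%N.
  move=> xU2; have := mixed_sum2 pU mU xU2; have := xU2; rewrite inE => /andP[xU /eqP dx].
  rewrite (codeg_sum ge pU xU); have [-> +] := mixed_neighbours pU mW xU; rewrite dx.
  move: #|deg_part U 2| #|deg_part U 5| (dS _ x) (dS (deg_part (~: U) 5) x) => a b c d.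
  by clear; lia.
have E5 x : x \in deg_part U 5 -> (2 * #|deg_part U 2| + 4 * #|deg_part U 5|
      = 9 + 3 * dS (deg_part (~: U) 5) x)%N /\
    (5 = dS (deg_part (~: U) 2) x + dS (deg_part (~: U) 5) x)%N.
  move=> xU5; have := mixed_sum5 pU mU xU5; have := xU5; rewrite inE => /andP[xU /eqP dx].
  rewrite (codeg_sum ge pU xU); have [-> +] := mixed_neighbours pU mW xU; rewrite dx.
  move: #|deg_part U 2| #|deg_part U 5| (dS _ x) (dS (deg_part (~: U) 5) x) => a b c d.
  by clear; lia.
have [_ [x xU dx] [y yU dy]] := mU.
have xU2 : x \in deg_part U 2 by rewrite inE xU dx.
have yU5 : y \in deg_part U 5 by rewrite inE yU dy.
exists (dS (deg_part (~: U) 5) x); have := E2 x xU2; have := E5 y yU5.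
move: (dS (deg_part (~: U) 2) x) (dS (deg_part (~: U) 5) x) => p i.
move: (dS (deg_part (~: U) 2) y) (dS (deg_part (~: U) 5) y) => q j.
move=> H5 H2; split.
- by move: H5 H2; move: #|_| #|_| => a b; clear; lia.
- by move: H2; move: #|_| #|_| => a b; clear; lia.
- move=> z /E2; move: H5 H2; move: #|deg_part U 2| #|deg_part U 5| => a b.
  by move: (dS _ z) (dS (deg_part (~: U) 5) z) => c d; clear; lia.
- move=> z /E5; move: H5 H2; move: #|deg_part U 2| #|deg_part U 5| => a b.
  by move: (dS _ z) (dS (deg_part (~: U) 5) z) => c d; clear; lia.
Qed.

Lemma regular_double_count (A B : {set T}) i j : {in A, forall x, dS B x = i} ->
  {in B, forall x, dS A x = j} -> (#|A| * i = #|B| * j)%N.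
Proof.
move=> Ai Bj; have := double_count ge A B.
rewrite (eq_bigr (fun _ => i)) ?sum_nat_const //.
by rewrite (eq_bigr (fun _ => j)) ?sum_nat_const.
Qed.

Lemma mixed_structure U : parallel_sides e U -> mixed_degrees U -> mixed_degrees (~: U) ->
  structure_IV5 e \/ structure_IV6 e.
Proof.
move=> pU mU mW; have pW := parallel_sidesC pU.
have mU' : mixed_degrees (~: ~: U) by rewrite setCK.
have [i [i12 iU dU2 dU5]] := mixed_counts pU mU mW.
have [j [j12 jW dW2 dW5]] := mixed_counts pW mW mU'; rewrite setCK in dW2 dW5.
set U2 := deg_part U 2 in iU dU2 dU5 dW2 dW5 *; set U5 := deg_part U 5 in iU dU2 dU5 dW2 dW5 *.
set W2 := deg_part (~: U) 2 in jW dU2 dU5 dW2 dW5 *.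
set W5 := deg_part (~: U) 5 in jW dU2 dU5 dW2 dW5 *.
have c25 : (#|U2| * i = #|W5| * (6 - 2 * j))%N.
  by apply: regular_double_count => z zS; [have [] := dU2 z zS|have [] := dW5 z zS].
have c55 : (#|U5| * (2 * i - 1) = #|W5| * (2 * j - 1))%N.
  by apply: regular_double_count => z zS; [have [] := dU5 z zS|have [] := dW5 z zS].
have c22 : (#|U2| * (2 - i) = #|W2| * (2 - j))%N.
  by apply: regular_double_count => z zS; [have [] := dU2 z zS|have [] := dW2 z zS].
have c52 : (#|U5| * (6 - 2 * i) = #|W2| * j)%N.
  by apply: regular_double_count => z zS; [have [] := dU5 z zS|have [] := dW2 z zS].
have Upart : U5 :|: U2 = U.
  have [U25 _ _] := mU; apply/setP => z; rewrite !inE; case: (boolP (z \in U)) => //= zU.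
  by case: (U25 z zU) => ->.
have Wpart : W5 :|: W2 = ~: U.
  have [W25 _ _] := mW; apply/setP => z; rewrite /W5 /W2 !in_setU ![z \in deg_part _ _]inE.
  by case: (boolP (z \in ~: U)) => //= zU; case: (W25 z zU) => ->.
have dis (S : {set T}) : [disjoint deg_part S 5 & deg_part S 2].
  apply/pred0P => z /=; rewrite !inE; case: (dg z =P 2%N) => [->|]; rewrite ?andbF //.
have indU := side_independent pU; have indW := side_independent pW.
have sizes : (i = 1 /\ [/\ #|U5| = 1, #|U2| = 4, #|W5| = 1 & #|W2| = 4] \/
    i = 2 /\ [/\ #|U5| = 3, #|U2| = 3, #|W5| = 3 & #|W2| = 3])%N /\ i = j.
  move: c25 c55 c22 c52 iU jW; move: #|U2| #|U5| #|W2| #|W5| => a b c d.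
  case: i12 => ->; case: j12 => ->; clear => *.
  - by split=> //; left; split=> //; split; lia.
  - by exfalso; lia.
  - by exfalso; lia.
  - by split=> //; right; split=> //; split; lia.
have [[[iE [u5 u2 w5 w2]]|[iE [u5 u2 w5 w2]]] ij] := sizes; [left|right].
  rewrite -{}ij in dW2 dW5; subst i.
  have /eqP/cards1P[z zE] := u5; have /eqP/cards1P[y yE] := w5.
  have zU5 : z \in U5 by rewrite zE set11.
  have yW5 : y \in W5 by rewrite yE set11.
  exists z, y, U2, W2; split.
  - rewrite -zE -yE; split; rewrite ?Upart ?Wpart ?setCK //; exact: dis.
  - by [].
  - have : dS W5 z = #|W5| by rewrite w5; have [->] := dU5 z zU5.
    move=> H; apply: (@full_joined [set z] W5); rewrite ?set11 //.
    by move=> x; rewrite inE => /eqP ->.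
  - split; apply: full_joined => x; rewrite inE => /eqP ->.
      by rewrite w2; have [_ ->] := dU5 z zU5.
    by rewrite u2; have [_ ->] := dW5 y yW5.
  - by split=> x xS; [have [_ ->] := dU2 x xS|have [_ ->] := dW2 x xS].
rewrite -{}ij in dW2 dW5; subst i.
(* Degree 5 comes first on one side and last on the other, which puts the zero block of N in its
   lower left corner. *)
exists U5, U2, W2, W5; split.
- split; rewrite ?Upart 1?[W2 :|: W5]setUC ?Wpart ?setCK //; first exact: dis.
  by rewrite disjoint_sym; apply: dis.
- by [].
- by apply: full_joined => x xS; rewrite w5; have [-> _] := dU5 x xS.
- move=> x y xU2 yW2; have [_ /cards0_eq/setP/(_ y)] := dU2 x xU2.
  by rewrite in_set0 in_set yW2.
- split; apply: (cocktail_full (k := 2)) => // x xS.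
  + by have [_ ->] := dU5 x xS.
  + by have [-> _] := dW2 x xS.
  + by have [-> _] := dU2 x xS.
  + by have [_ ->] := dW5 x xS.
Qed.

Lemma triangle_free_structure : (forall x y z, e x y -> e x z -> e y z = false) ->
  [\/ structure_I e, structure_IV5 e | structure_IV6 e].
Proof.
move=> /(triangle_free_sides ge)[U pU]; have pW := parallel_sidesC pU.
have [[d Ud]|mU] := side_cases ge pU; have [[d' Wd]|mW] := side_cases ge pW.
- constructor 1; exact: constant_structure pU Ud Wd.
- by have := not_half_mixed pW mW (d := d); rewrite setCK => /(_ Ud).
- by have := not_half_mixed pU mU Wd.
- by case: (mixed_structure pU mU mW) => ?; [constructor 2|constructor 3].
Qed.

End BipartiteCase.

(** * From structures to matrices *)

Section Realization.

Variables (T : finType) (e : rel T).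

Definition enumerates m (S : {set T}) (f : 'I_m -> T) :=
  injective f /\ forall x, x \in S <-> exists i, f i = x.

Definition adj_block m n (M : 'M[algC]_(m, n)) (f : 'I_m -> T) (h : 'I_n -> T) :=
  forall i j, M i j = (e (f i) (h j))%:R.

(** The size of the matrix is tied to [T] only through the enumeration, so no cast appears before
    [realizes_reordered]. *)
Definition realizes n (M : 'M[algC]_n) :=
  exists2 f : 'I_n -> T, enumerates setT f & adj_block M f f.

Definition sumf m n (f : 'I_m -> T) (h : 'I_n -> T) (i : 'I_(m + n)) : T :=
  match split i with inl j => f j | inr j => h j end.

Lemma sumf_l m n (f : 'I_m -> T) (h : 'I_n -> T) i : sumf f h (lshift n i) = f i.
Proof. by rewrite /sumf (unsplitK (inl i)). Qed.

Lemma sumf_r m n (f : 'I_m -> T) (h : 'I_n -> T) i : sumf f h (rshift m i) = h i.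
Proof. by rewrite /sumf (unsplitK (inr i)). Qed.

Lemma enumerates_set m (S : {set T}) : #|S| = m -> exists f : 'I_m -> T, enumerates S f.
Proof.
move=> <-; exists (@enum_val _ (mem S)); split; first exact: enum_val_inj.
move=> x; split=> [xS|[i <-]]; last exact: enum_valP.
by exists (enum_rank_in xS x); rewrite enum_rankK_in.
Qed.

Lemma enumerates_in m (S : {set T}) (f : 'I_m -> T) i : enumerates S f -> f i \in S.
Proof. by move=> [_ fS]; apply/fS; exists i. Qed.

Lemma enumerates_sum m n (S1 S2 : {set T}) (f : 'I_m -> T) (h : 'I_n -> T) :
  enumerates S1 f -> enumerates S2 h -> [disjoint S1 & S2] ->
  enumerates (S1 :|: S2) (sumf f h).
Proof.
move=> ef eh dis; have [fi fS] := ef; have [hi hS] := eh.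
have fh i j : f i <> h j.
  move=> E; have /pred0P/(_ (f i)) := dis; rewrite /= (enumerates_in i ef) E.
  by rewrite (enumerates_in j eh).
split.
  move=> i j; case: (split_ordP i) => i' ->; case: (split_ordP j) => j' ->;
    rewrite ?sumf_l ?sumf_r => E.
  - by rewrite (fi _ _ E).
  - by case: (fh _ _ E).
  - by case: (fh _ _ (esym E)).
  - by rewrite (hi _ _ E).
move=> x; split.
  case/setUP=> [/fS|/hS] [i <-]; first by exists (lshift n i); rewrite sumf_l.
  by exists (rshift m i); rewrite sumf_r.
move=> [i <-]; case: (split_ordP i) => i' ->; rewrite ?sumf_l ?sumf_r inE.
  by rewrite (enumerates_in i' ef).
by rewrite (enumerates_in i' eh) orbT.
Qed.

Lemma adj_block_mx m1 m2 n1 n2 (A : 'M_(m1, n1)) (B : 'M_(m1, n2)) (C : 'M_(m2, n1))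
    (D : 'M_(m2, n2)) f1 f2 h1 h2 :
  adj_block A f1 h1 -> adj_block B f1 h2 -> adj_block C f2 h1 -> adj_block D f2 h2 ->
  adj_block (block_mx A B C D) (sumf f1 f2) (sumf h1 h2).
Proof.
move=> HA HB HC HD i j; case: (split_ordP i) => i' ->; case: (split_ordP j) => j' ->;
  by rewrite ?sumf_l ?sumf_r ?block_mxEul ?block_mxEur ?block_mxEdl ?block_mxEdr.
Qed.

Lemma adj_col_mx m1 m2 n (A : 'M_(m1, n)) (C : 'M_(m2, n)) f1 f2 h :
  adj_block A f1 h -> adj_block C f2 h -> adj_block (col_mx A C) (sumf f1 f2) h.
Proof.
move=> HA HC i j; case: (split_ordP i) => i' ->;
  by rewrite ?sumf_l ?sumf_r ?col_mxEu ?col_mxEd.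
Qed.

Lemma adj_row_mx m n1 n2 (A : 'M_(m, n1)) (B : 'M_(m, n2)) f h1 h2 :
  adj_block A f h1 -> adj_block B f h2 -> adj_block (row_mx A B) f (sumf h1 h2).
Proof.
move=> HA HB i j; case: (split_ordP j) => j' ->;
  by rewrite ?sumf_l ?sumf_r ?row_mxEl ?row_mxEr.
Qed.

Hypothesis e_sym : symmetric e.

Lemma adj_tr m n (A : 'M_(m, n)) f h : adj_block A f h -> adj_block A^T h f.
Proof. by move=> HA i j; rewrite mxE HA e_sym. Qed.

Lemma adj_Jm m n (f : 'I_m -> T) (h : 'I_n -> T) (A B : {set T}) :
  enumerates A f -> enumerates B h -> joined e A B -> adj_block (Jm m n) f h.
Proof.
by move=> ef eh AB i j; rewrite mxE (AB _ _ (enumerates_in i ef) (enumerates_in j eh)).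
Qed.

Lemma adj_0 m n (f : 'I_m -> T) (h : 'I_n -> T) (A B : {set T}) :
  enumerates A f -> enumerates B h -> {in A & B, forall x y, e x y = false} ->
  adj_block (0 : 'M_(m, n)) f h.
Proof.
by move=> ef eh AB i j; rewrite mxE (AB _ _ (enumerates_in i ef) (enumerates_in j eh)).
Qed.

Lemma JIE n i j : JI n i j = (i != j)%:R.
Proof. by rewrite !mxE; case: eqVneq => _ /=; rewrite ?subrr ?subr0. Qed.

Hypothesis e_irr : irreflexive e.

Lemma adj_clique m (f : 'I_m -> T) (A : {set T}) :
  enumerates A f -> clique e A -> adj_block (JI m) f f.
Proof.
move=> ef /cliqueP Ac i j; rewrite JIE; congr (_ %:R); have [<-|ij] := eqVneq i j.
  by rewrite e_irr.
by rewrite Ac ?(enumerates_in _ ef) // (inj_eq (proj1 ef)).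
Qed.

(** The second enumeration follows the bijection given by [r]. Taking [r] to be adjacency produces a
    block I, taking non-adjacency a block J - I. *)
Lemma enumerates_matched (r : rel T) m (X Y : {set T}) : #|X| = m ->
  {in X, forall x, #|[set z in Y | r x z]| = 1%N} ->
  {in Y, forall y, #|[set z in X | r z y]| = 1%N} ->
  exists (f h : 'I_m -> T), [/\ enumerates X f, enumerates Y h &
    forall i j, r (f i) (h j) = (i == j)].
Proof.
move=> Xm Xr Yr; have [f ef] := enumerates_set Xm; have [fi fS] := ef.
have pickP i : exists y, (y \in Y) && r (f i) y.
  have /eqP/cards1P[y /setP yE] := Xr _ (enumerates_in i ef).
  by exists y; have := yE y; rewrite !inE eqxx.
pose h i := xchoose (pickP i).
have hP i : h i \in Y /\ r (f i) (h i) by apply/andP; exact: (xchooseP (pickP i)).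
have uniqX y i j : y \in Y -> r (f i) y -> r (f j) y -> i = j.
  move=> yY ri rj; apply: fi; have /eqP/cards1P[x /setP xE] := Yr _ yY.
  have := xE (f i); have := xE (f j); rewrite !inE !(enumerates_in _ ef) ri rj /=.
  by move=> /esym/eqP-> /esym/eqP->.
exists f, h; split=> //; last first.
  move=> i j; have [<-|ij] := eqVneq i j; first by have [] := hP i.
  by apply/negP => rij; have [hY rj] := hP j; rewrite (uniqX _ _ _ hY rij rj) eqxx in ij.
split.
  move=> i j hij; have [hY ri] := hP i; have [_ rj] := hP j.
  by apply: (uniqX _ _ _ hY ri); rewrite hij.
move=> y; split=> [yY|[i <-]]; last by have [] := hP i.
have /eqP/cards1P[x /setP xE] := Yr _ yY; have := xE x; rewrite !inE eqxx => /andP[xX rxy].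
have /fS[i fix_] := xX; exists i; have [hY ri] := hP i.
have /eqP/cards1P[w /setP wE] := Xr _ xX; have := wE y; have := wE (h i).
by rewrite !inE hY yY -fix_ ri fix_ rxy => /esym/eqP-> /esym/eqP->.
Qed.

(** Each matched pair is put at the two ends of the list of the remaining vertices, so that partners
    occupy mirror positions as in R_{2k}. *)
Lemma matching_seq (S : {set T}) : matching_on e S -> exists k (s : seq T),
  [/\ uniq s, size s = (2 * k)%N, s =i S & forall x0 i j, (i < 2 * k)%N -> (j < 2 * k)%N ->
    e (nth x0 s i) (nth x0 s j) = ((i + j)%N == (2 * k).-1)].
Proof.
have [n] := ubnP #|S|; elim: n S => // n IHn S Sn Sm.
have [->|/set0Pn[x xS]] := eqVneq S set0; first by exists 0%N, [::]; split=> // x; rewrite inE.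
have /eqP/cards1P[y /setP yE] := Sm x xS.
have := yE y; rewrite !inE eqxx => /andP[yS xy].
have Nx z : z \in S -> e x z = (z == y) by move=> zS; have := yE z; rewrite !inE zS.
have Ny z : z \in S -> e y z = (z == x).
  move=> zS; have /eqP/cards1P[w /setP wE] := Sm y yS.
  have := wE x; have := wE z; rewrite !inE zS xS e_sym [e y x]e_sym xy /= => + /esym/eqP xw.
  by rewrite -xw e_sym.
have x_y : x != y by apply: contraTneq xy => ->; rewrite e_irr.
pose S' := S :\ x :\ y.
have S'S z : z \in S' -> [/\ z \in S, z != x & z != y].
  by rewrite !inE => /and3P[].
have S'm : matching_on e S'.
  move=> z zS'; have [zS zx zy] := S'S z zS'; rewrite -(Sm z zS); apply: eq_card => w.
  rewrite !inE; have [->|wy] := eqVneq w y; first by rewrite e_sym Ny // (negPf zx) !andbF.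
  have [->|wx] := eqVneq w x; first by rewrite e_sym Nx // (negPf zy) !andbF.
  by [].
have S'n : (#|S'| < n)%N.
  have : (#|S'| < #|S|)%N.
    apply: proper_card; apply/properP; split; last by exists x; rewrite // !inE eqxx andbF.
    by apply/subsetP => z /S'S[].
  by move=> lt; apply: leq_trans lt _; rewrite -ltnS.
have [k [s [us sz sS' se]]] := IHn S' S'n S'm.
exists k.+1, (x :: rcons s y); have szE : size (x :: rcons s y) = (2 * k.+1)%N.
  by rewrite /= size_rcons sz mulnS.
have sP z : (z \in s) = [&& z != y, z != x & z \in S] by rewrite sS' !inE.
split=> //.
- rewrite /= rcons_uniq us mem_rcons in_cons negb_or x_y !sP !eqxx.
  by rewrite !andbF.
- move=> z; rewrite in_cons mem_rcons in_cons sP.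
  have [->|zx] /= := eqVneq z x; first by rewrite xS.
  by have [->|zy] /= := eqVneq z y; rewrite ?yS ?orbF.
- move=> x0; have nthS i : (i < 2 * k)%N -> [/\ nth x0 s i \in S, nth x0 s i != x & nth x0 s i != y].
    by move=> ik; apply: S'S; rewrite -sS' mem_nth // sz.
  have nthE i : nth x0 (x :: rcons s y) i = if i == 0%N then x else
      if (i.-1 < 2 * k)%N then nth x0 s i.-1 else if i.-1 == (2 * k)%N then y else x0.
    by case: i => [|i] //=; rewrite nth_rcons sz.
  have main i j : (i <= j)%N -> (j < 2 * k.+1)%N ->
     e (nth x0 (x :: rcons s y) i) (nth x0 (x :: rcons s y) j) = ((i + j)%N == (2 * k.+1).-1).
    rewrite !nthE => ij jk.
    case: i ij => [|i] ij /=.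
      case: j jk ij => [|j] jk _ /=; first by rewrite e_irr; lia.
      case: (ltnP j (2 * k)) => jk'; first by have [jS _ jy] := nthS j jk'; rewrite Nx // (negPf jy); lia.
      have -> : j = (2 * k)%N by lia.
      by rewrite eqxx Nx // eqxx; lia.
    case: j ij jk => [|j] //= ij jk.
    case: (ltnP i (2 * k)) => ik; case: (ltnP j (2 * k)) => jk'.
    - by rewrite se //; lia.
    - have -> : j = (2 * k)%N by lia.
      rewrite eqxx e_sym; have [iS ix _] := nthS i ik.
      by rewrite Ny // (negPf ix); lia.
    - by exfalso; lia.
    - have -> : j = (2 * k)%N by lia.
      have -> : i = (2 * k)%N by lia.
      by rewrite eqxx e_irr; lia.
  move=> i j ik jk; have [ij|/ltnW ji] := leqP i j; first exact: main.
  by rewrite e_sym addnC main.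
Qed.

Lemma adj_matching (S : {set T}) : (0 < #|S|)%N -> matching_on e S ->
  exists k (f : 'I_(2 * k) -> T),
  [/\ #|S| = (2 * k)%N, enumerates S f & adj_block (Rrev (2 * k)) f f].
Proof.
move=> /card_gt0P[x0 _] Sm; have [k [s [us sz sS se]]] := matching_seq Sm.
exists k, (fun i => nth x0 s i); split.
- by rewrite -sz -(card_uniqP us); apply: eq_card.
- split.
    move=> i j /eqP; rewrite nth_uniq ?sz // => /eqP; exact: val_inj.
  move=> x; rewrite -sS; split=> [xs|[i <-]]; last by rewrite mem_nth ?sz.
  by have /nthP-/(_ x0)[i] := xs; rewrite sz => ik <-; exists (Ordinal ik).
- by move=> i j; rewrite mxE se.
Qed.

End Realization.

(** * Block matrices of the structures *)

Section StructureForms.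

Variables (T : finType) (e : rel T).
Hypotheses (e_sym : symmetric e) (e_irr : irreflexive e).

Lemma joined_sym (A B : {set T}) : joined e A B -> joined e B A.
Proof. by move=> AB x y xA yB; rewrite e_sym AB. Qed.

Lemma not_adj_sym (A B : {set T}) : {in A & B, forall x y, e x y = false} ->
  {in B & A, forall x y, e x y = false}.
Proof. by move=> AB x y xA yB; rewrite e_sym AB. Qed.

Lemma disjointC (A : {set T}) : [disjoint A & ~: A].
Proof. by rewrite -setI_eq0 setICr. Qed.

Lemma structure_II_form : structure_II e ->
  exists a k, [/\ (1 <= a)%N, (2 <= k)%N & realizes e (formII a k)].
Proof.
move=> [A [A0 S4 Ac Sm AS]].
have [|k [h [Sk eh hh]]] := adj_matching e_sym e_irr _ Sm; first exact: leq_trans S4.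
have [f ef] := enumerates_set (erefl #|A|).
exists #|A|, k; split; [by rewrite card_gt0|by lia|].
exists (sumf f h).
  by rewrite -(setUCr A); apply: enumerates_sum => //; apply: disjointC.
apply: adj_block_mx => //.
- exact: (adj_clique e_irr ef Ac).
- exact: (adj_Jm ef eh AS).
- exact: (adj_Jm eh ef (joined_sym AS)).
Qed.

Lemma structure_III_form : structure_III e ->
  exists l m, [/\ (m <= l)%N, (2 <= m)%N & realizes e (formIII l m)].
Proof.
move=> [A [A4 S4 Am Sm AS]].
wlog AleS : A A4 S4 Am Sm AS / (#|~: A| <= #|A|)%N => [H|].
  have [AS'|/ltnW AS'] := leqP #|~: A| #|A|; first exact: H AS'.
  apply: (H (~: A)); rewrite ?setCK //; exact: joined_sym.
have [|l [f [Al ef hf]]] := adj_matching e_sym e_irr _ Am; first exact: leq_trans A4.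
have [|k [h [Sk eh hh]]] := adj_matching e_sym e_irr _ Sm; first exact: leq_trans S4.
exists l, k; split; [by lia|by lia|].
exists (sumf f h).
  by rewrite -(setUCr A); apply: enumerates_sum => //; apply: disjointC.
apply: adj_block_mx => //.
- exact: (adj_Jm ef eh AS).
- exact: (adj_Jm eh ef (joined_sym AS)).
Qed.

Lemma structure_V_form : structure_V e -> exists a c,
  ((a, c) = (6, 5) \/ (a, c) = (4, 6) \/ (a, c) = (3, 8))%N /\ realizes e (formV a c).
Proof.
move=> [v [a [c [/cliqueP vc Na Nc ac]]]]; exists a, c; split; first by case: ac; auto.
pose A := [set z | e v z]; pose C := [set z | ~~ e v z] :\ v.
have Cc : #|C| = c.
  by move: Nc; rewrite (cardsD1 v) inE e_irr add1n => -[].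
have [f ef] := enumerates_set Na; have [h eh] := enumerates_set Cc.
have [w ew] := enumerates_set (cards1 v).
have subc (S : {set T}) : (v \notin S) -> clique e S.
  move=> vS; apply/cliqueP => x y xS yS xy; apply: vc => //; rewrite !inE;
    by apply: contraNneq vS => <-.
have Av : v \notin A by rewrite inE e_irr.
have Cv : v \notin C by rewrite !inE eqxx.
have AC : joined e A C.
  move=> x y xA yC; apply: vc; rewrite ?inE.
  - by apply: contraNneq Av => <-.
  - by apply: contraNneq Cv => <-.
  - by apply: contraTneq xA => ->; move: yC; rewrite !inE => /andP[].
have AV : joined e A [set v].
  by move=> x y xA /set1P ->; rewrite e_sym; move: xA; rewrite inE.
have CV : {in C & [set v], forall x y, e x y = false}.
  by move=> x y xC /set1P ->; rewrite e_sym; move: xC; rewrite !inE => /andP[_ /negPf].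
have VV : {in [set v] & [set v], forall x y, e x y = false}.
  by move=> x y /set1P -> /set1P ->; rewrite e_irr.
have full : A :|: C :|: [set v] = setT.
  apply/setP => z; rewrite !inE; case: (eqVneq z v) => [->|]; rewrite ?orbT //=.
  by case: (e v z).
exists (sumf (sumf f h) w).
  rewrite -full; apply: enumerates_sum => //; last first.
    by rewrite -setI_eq0 -subset0; apply/subsetP => z; rewrite !inE => /andP[/orP[vz|/andP[zv _]]
      /eqP zE]; move: zE; [move=> E; rewrite E e_irr in vz|move/eqP; rewrite (negPf zv)].
  apply: enumerates_sum => //; rewrite -setI_eq0 -subset0; apply/subsetP => z.
  by rewrite !inE => /andP[-> /andP[]].
apply: adj_block_mx.
- apply: adj_block_mx.
  + exact: (adj_clique e_irr ef (subc _ Av)).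
  + exact: (adj_Jm ef eh AC).
  + exact: (adj_Jm eh ef (joined_sym AC)).
  + exact: (adj_clique e_irr eh (subc _ Cv)).
- by apply: adj_col_mx; [apply: (adj_Jm ef ew AV)|apply: (adj_0 eh ew CV)].
- apply: adj_row_mx; first exact: (adj_Jm ew ef (joined_sym AV)).
  exact: (adj_0 ew eh (not_adj_sym CV)).
- exact: (adj_0 ew ew VV).
Qed.

Lemma enumerates_cocktail m (X Y : {set T}) : #|X| = m -> cocktail e X Y -> cocktail e Y X ->
  exists (f h : 'I_m -> T), [/\ enumerates X f, enumerates Y h & adj_block e (JI m) f h].
Proof.
move=> Xm XY YX.
have [||f [h [ef eh fh]]] := @enumerates_matched T (fun x y => ~~ e x y) m X Y Xm.
- by move=> x xX; apply: XY.
- by move=> y yY; rewrite -(YX y yY); apply: eq_card => z; rewrite !inE e_sym.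
exists f, h; split=> // i j; rewrite JIE -fh negbK.
by [].
Qed.

Lemma structure_VI_form : structure_VI e -> exists a m,
  ((a, m) = (3, 5) \/ (a, m) = (4, 4))%N /\ realizes e (formVI a m).
Proof.
move=> [A [X [Y [[full AX AY XY] [Ac Xi Yi] [AXj AYn XYc YXc] am]]]].
exists #|A|, #|X|; split; first by case: am; auto.
have [f ef] := enumerates_set (erefl #|A|).
have [h [w [eh ew hw]]] := enumerates_cocktail (erefl #|X|) XYc YXc.
have wh : adj_block e (JI #|X|) w h.
  by move=> i j; rewrite e_sym -hw !JIE eq_sym.
exists (sumf (sumf f h) w).
  rewrite -full; apply: enumerates_sum => //; first exact: enumerates_sum.
  by rewrite -setI_eq0 setIUl setU_eq0 !setI_eq0 AY XY.
apply: adj_block_mx.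
- apply: adj_block_mx.
  + exact: (adj_clique e_irr ef Ac).
  + exact: (adj_Jm ef eh AXj).
  + exact: (adj_Jm eh ef (joined_sym AXj)).
  + exact: (adj_0 eh eh Xi).
- by apply: adj_col_mx => //; apply: (adj_0 ef ew AYn).
- by apply: adj_row_mx => //; apply: (adj_0 ew ef (not_adj_sym AYn)).
- exact: (adj_0 ew ew Yi).
Qed.

Lemma structure_I_form : structure_I e -> exists2 m, (3 <= m)%N & realizes e (formI m).
Proof.
move=> [U [U3 Ui Wi UW WU]]; exists #|U| => //.
have [f [h [ef eh fh]]] := enumerates_cocktail (erefl #|U|) UW WU.
have hf : adj_block e (JI #|U|) h f.
  by move=> i j; rewrite e_sym -fh !JIE eq_sym.
exists (sumf f h).
  by rewrite -(setUCr U); apply: enumerates_sum => //; apply: disjointC.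
apply: adj_block_mx => //; first exact: (adj_0 ef ef Ui).
exact: (adj_0 eh eh Wi).
Qed.

Lemma structure_IV5_form : structure_IV5 e -> realizes e formIV5.
Proof.
move=> [z [y [A [B [[full zA yB Ui Wi] [A4 B4] zy [zB yA] [AB BA]]]]]].
have [|f [h [ef eh fh]]] := enumerates_matched A4 AB.
  by move=> w wB; rewrite -(BA w wB); apply: eq_card => x; rewrite !inE e_sym.
have [fz ez] := enumerates_set (cards1 z); have [fy ey] := enumerates_set (cards1 y).
have N : adj_block e N5 (sumf fz f) (sumf fy h).
  apply: adj_block_mx.
  - move=> i j; rewrite mxE !ord1.
    have /set1P -> := enumerates_in ord0 ez; have /set1P -> := enumerates_in ord0 ey.
    by rewrite zy.
  - exact: (adj_Jm ez eh zB).
  - exact: (adj_Jm ef ey (joined_sym yA)).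
  - by move=> i j; rewrite mxE fh.
have eU : enumerates (z |: A) (sumf fz f) by apply: enumerates_sum.
have eW : enumerates (y |: B) (sumf fy h) by apply: enumerates_sum.
exists (sumf (sumf fz f : 'I_5 -> T) (sumf fy h : 'I_5 -> T)).
  by rewrite -(setUCr (y |: B)) setUC -full; apply: enumerates_sum => //;
    rewrite full disjoint_sym disjointC.
apply: adj_block_mx => //.
- exact: (adj_0 eU eU).
- exact: adj_tr.
- exact: (adj_0 eW eW).
Qed.

Lemma structure_IV6_form : structure_IV6 e -> realizes e formIV6.
Proof.
move=> [A1 [A2 [B1 [B2 [[full dA dB Ui Wi] [a1 a2 b1 b2] A1B2 A2B1 [c1 c2 c3 c4]]]]]].
have [f1 [h1 [ef1 eh1 fh1]]] := enumerates_cocktail a1 c1 c2.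
have [f2 [h2 [ef2 eh2 fh2]]] := enumerates_cocktail a2 c3 c4.
have N : adj_block e N6 (sumf f1 f2) (sumf h1 h2).
  apply: adj_block_mx => //; first exact: (adj_Jm ef1 eh2 A1B2).
  exact: (adj_0 ef2 eh1 A2B1).
have eU : enumerates (A1 :|: A2) (sumf f1 f2) by apply: enumerates_sum.
have eW : enumerates (B1 :|: B2) (sumf h1 h2) by apply: enumerates_sum.
exists (sumf (sumf f1 f2 : 'I_6 -> T) (sumf h1 h2 : 'I_6 -> T)).
  by rewrite -(setUCr (B1 :|: B2)) setUC -full; apply: enumerates_sum => //;
    rewrite full disjoint_sym disjointC.
apply: adj_block_mx => //.
- exact: (adj_0 eU eU).
- exact: adj_tr.
- exact: (adj_0 eW eW).
Qed.

End StructureForms.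

Lemma realizes_reordered n (e : rel 'I_n) N (B : 'M[algC]_N) : realizes e B ->
  exists (E : N = n) (s : 'S_n), reordered_adj e s = castmx (E, E) B.
Proof.
move=> [f [fi fS] fe].
have E : N = n.
  have fb : bijective f.
    by apply/(inj_card_bij fi); rewrite -(card_codom fi) subset_leq_card //;
      apply/subsetP => x _; have /fS[i <-] := in_setT x; apply: codom_f.
  by have := bij_eq_card fb; rewrite !card_ord.
subst n; exists erefl, (perm fi); rewrite castmx_id.
by apply/matrixP => i j; rewrite !mxE !permE fe.
Qed.

Lemma good_graph_form n (e : rel 'I_n) : good_graph e ->
  exists s : 'S_n, is_form (reordered_adj e s).
Proof.
move=> ge; have e_sym := good_sym ge; have e_irr := good_irr ge.
have [/existsP[x /existsP[y /existsP[z /and3P[xy xz yz]]]]|] :=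
    boolP [exists x, exists y, exists z, [&& e x y, e x z & e y z]].
  case: (triangle_structure ge xy xz yz).
  - move=> /(structure_II_form e_sym e_irr)[a [k [a1 k2 /realizes_reordered[E [s sE]]]]].
    by exists s; right; left; exists a, k, E.
  - move=> /(structure_III_form e_sym e_irr)[l [m [a1 k2 /realizes_reordered[E [s sE]]]]].
    by exists s; do 2 right; left; exists l, m, E.
  - move=> /(structure_V_form e_sym e_irr)[a [c [ac /realizes_reordered[E [s sE]]]]].
    by exists s; do 5 right; left; exists a, c, E.
  - move=> /(structure_VI_form e_sym e_irr)[a [m [ac /realizes_reordered[E [s sE]]]]].
    by exists s; do 6 right; exists a, m, E.
move=> /existsPn notri.
have tf x y z : e x y -> e x z -> e y z = false.
  move=> xy xz; apply/negP => yz; have /existsPn/(_ y)/existsPn/(_ z) := notri x.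
  by rewrite xy xz yz.
case: (triangle_free_structure ge tf).
- move=> /(structure_I_form e_sym)[m m3 /realizes_reordered[E [s sE]]].
  by exists s; left; exists m, E.
- move=> /(structure_IV5_form e_sym)/realizes_reordered[E [s sE]].
  by exists s; do 3 right; left; exists E.
- move=> /(structure_IV6_form e_sym)/realizes_reordered[E [s sE]].
  by exists s; do 4 right; left; exists E.
Qed.

(** * Spectra of the forms *)

Section DeterminantExchange.

Variable R : comNzRingType.

Lemma scalar_mxB n (a b : R) : (a - b)%:M = a%:M - b%:M :> 'M_n.
Proof. exact: raddfB. Qed.

Lemma scalar_mxN n (a : R) : (- a)%:M = - a%:M :> 'M_n.
Proof. exact: raddfN. Qed.

Lemma scalar_mxD n (a b : R) : (a + b)%:M = a%:M + b%:M :> 'M_n.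
Proof. exact: raddfD. Qed.

(** Conjugation by the unipotent matrix with upper right block [u] takes the block matrix with rows
    (a - u c, 0), (c, d) to the one with rows (a, 0), (c, d - c u); the hypothesis is what keeps the
    upper right block zero. *)
Lemma det_exchange n t (a : 'M[R]_n) (d : 'M_t) (u : 'M_(n, t)) (c : 'M_(t, n)) :
  a *m u = u *m d -> \det (a - u *m c) * \det d = \det a * \det (d - c *m u).
Proof.
move=> au.
have E : block_mx 1%:M u 0 1%:M *m block_mx (a - u *m c) 0 c d *m block_mx 1%:M (- u) 0 1%:M
    = block_mx a 0 c (d - c *m u).
  rewrite !mulmx_block !(mul1mx, mulmx1, mul0mx, mulmx0, addr0, add0r) subrK.
  by rewrite !mulmxN au addNr addrC.
have := congr1 determinant E; rewrite !det_mulmx !det_ublock !det_lblock !det1 => <-.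
by rewrite !mul1r !mulr1.
Qed.

End DeterminantExchange.

Section CharPoly.

Variable R : idomainType.
Local Notation "M ^P" := (map_mx polyC M) (at level 8, format "M ^P").

(** When [u] consists of the indicators of vertex classes, P' + c u is the quotient matrix of P + u
    c, and P' carries the eigenvalues of P that the quotient replaces. The product form avoids
    division. *)
Lemma char_poly_exchange n t (P : 'M[R]_n) (P' : 'M_t) (u : 'M_(n, t)) (c : 'M_(t, n)) :
  P *m u = u *m P' ->
  char_poly (P + u *m c) * char_poly P' = char_poly P * char_poly (P' + c *m u).
Proof.
move=> Pu; rewrite /char_poly /char_poly_mx !map_mxD !map_mxM !opprD !addrA /=.
apply: det_exchange.
by rewrite mulmxBl mulmxBr -!map_mxM /= Pu mul_scalar_mx mul_mx_scalar.
Qed.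

Lemma char_poly_mx_block m n (A : 'M[R]_m) B C (D : 'M_n) :
  char_poly_mx (block_mx A B C D) =
  block_mx (char_poly_mx A) (- B^P) (- C^P) (char_poly_mx D).
Proof.
rewrite /char_poly_mx scalar_mx_block map_block_mx opp_block_mx add_block_mx.
by rewrite !add0r.
Qed.

Lemma char_poly_block_diag m n (A : 'M[R]_m) (D : 'M_n) :
  char_poly (block_mx A 0 0 D) = char_poly A * char_poly D.
Proof. by rewrite /char_poly char_poly_mx_block !map_mx0 !oppr0 det_ublock. Qed.

Lemma char_poly_scalar n (a : R) : char_poly (a%:M : 'M_n) = ('X - a%:P) ^+ n.
Proof.
rewrite /char_poly /char_poly_mx map_scalar_mx -scalar_mxB.
exact: det_scalar.
Qed.

Lemma char_poly_bipartite n (N N' : 'M[R]_n) :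
  char_poly (block_mx 0 N N' 0) = \det (('X ^+ 2)%:M - N^P *m N'^P).
Proof.
rewrite /char_poly char_poly_mx_block /char_poly_mx !map_mx0 !subr0.
have Xn_neq0 : \det ('X%:M : 'M[{poly R}]_n) != 0.
  by rewrite det_scalar expf_neq0 // polyX_eq0.
have E : block_mx 'X%:M (- N^P) (- N'^P) 'X%:M *m block_mx 'X%:M 0 N'^P 1%:M =
    block_mx ('X ^+ 2)%:M (- N^P) 0 'X%:M + block_mx (- (N^P *m N'^P)) 0 0 0.
  rewrite mulmx_block !(mulmx1, mulmx0, add0r) add_block_mx !addr0 -scalar_mxM mulNmx.
  by rewrite mulNmx mul_mx_scalar mul_scalar_mx addNr.
apply: (mulIf Xn_neq0); rewrite add_block_mx !addr0 in E.
have := congr1 determinant E; rewrite det_mulmx det_lblock det1 mulr1 => ->.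
by rewrite det_ublock.
Qed.

(** In all the bipartite forms N N^T is the identity plus a matrix of rank one. *)
Lemma char_poly_bipartite_rank1 n (N N' : 'M[R]_n.+1) (u : 'cV_n.+1) (c : 'rV_n.+1) :
  N *m N' = 1%:M + u *m c ->
  char_poly (block_mx 0 N N' 0) = ('X ^+ 2 - 1) ^+ n * ('X ^+ 2 - 1 - ((c *m u) 0 0)%:P).
Proof.
move=> NE; rewrite char_poly_bipartite -map_mxM NE map_mxD map_mxM map_scalar_mx /= polyC1.
rewrite opprD addrA -scalar_mxB.
have X21 : ('X ^+ 2 - 1 : {poly R}) != 0.
  by rewrite -[1](polyC1 R) -size_poly_eq0 size_XnsubC.
have H := @det_exchange _ n.+1 1 (('X ^+ 2 - 1)%:M) (('X ^+ 2 - 1)%:M) u^P c^P.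
apply: (mulIf X21); move: H; rewrite det_scalar1 => ->; last first.
  by rewrite mul_mx_scalar mul_scalar_mx.
rewrite det_scalar -map_mxM det_mx11 !mxE eqxx mulr1n exprS; ring.
Qed.

End CharPoly.

Section SmallDeterminants.

Variable R : idomainType.

Lemma det_block_scalar n (a b c d : R) : d != 0 ->
  \det (block_mx a%:M b%:M c%:M d%:M : 'M_(n + n)) = (a * d - b * c) ^+ n.
Proof.
move=> d0; have E : block_mx a%:M b%:M c%:M d%:M *m block_mx d%:M 0 (- c)%:M 1%:M =
    block_mx (a * d - b * c)%:M b%:M 0 (d%:M : 'M_n).
  rewrite mulmx_block !(mulmx1, mulmx0, add0r) -!scalar_mxM -!raddfD /=.
  by congr block_mx; [congr (_%:M); ring|rewrite (_ : c * d + _ = 0) ?raddf0 //; ring].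
have dn : \det (d%:M : 'M_n) != 0 by rewrite det_scalar expf_neq0.
apply: (mulIf dn); have := congr1 determinant E.
by rewrite det_mulmx det_lblock det1 mulr1 => ->; rewrite det_ublock det_scalar.
Qed.

(** Schur complement with respect to the corner [t]; the nonvanishing conditions allow
    cancellation. *)
Lemma det_bordered (a b c d p q r s t : R) : t != 0 -> t * d - q * s != 0 ->
  t * \det (block_mx (block_mx a%:M b%:M c%:M d%:M)
    (col_mx p%:M q%:M) (row_mx r%:M s%:M) t%:M : 'M_((1 + 1) + 1)) =
  (t * a - p * r) * (t * d - q * s) - (t * b - p * s) * (t * c - q * r).
Proof.
move=> t0 ds0; set M := block_mx a%:M b%:M c%:M d%:M; set P := col_mx _ _; set S := row_mx _ _.
have E : block_mx M P S t%:M *m block_mx t%:M 0 (- S) 1%:M =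
    block_mx (t *: M - P *m S) P 0 t%:M.
  rewrite mulmx_block !(mulmx1, mulmx0, add0r) mulmxN mul_mx_scalar.
  by rewrite mul_scalar_mx mul_mx_scalar scalerN subrr.
have E2 : t *: M - P *m S = block_mx (t * a - p * r)%:M (t * b - p * s)%:M
    (t * c - q * r)%:M (t * d - q * s)%:M.
  rewrite /M /P /S mul_col_row scale_block_mx opp_block_mx add_block_mx.
  by rewrite !scale_scalar_mx -!scalar_mxM -!scalar_mxB.
have := congr1 determinant E; rewrite det_mulmx det_lblock det_ublock det1 mulr1 E2.
rewrite det_block_scalar // expr1 !det_scalar expr1 expr2 => H.
by apply: (mulIf t0); rewrite -H; ring.
Qed.

End SmallDeterminants.

Section FormSpectra.

Local Notation C := algC.

Lemma prod_spectrum (r t : C) k l :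
  \prod_(x <- [:: r; t] ++ nseq k 1 ++ nseq l (-1)) ('X - x%:P) =
  ('X - r%:P) * ('X - t%:P) * ('X - 1) ^+ k * ('X + 1) ^+ l.
Proof.
rewrite /= !big_cons big_cat /= !big_nseq !iter_mulr_1.
by rewrite polyCN opprK polyC1 !mulrA.
Qed.

Lemma mul_Jm m n p : Jm m n *m Jm n p = n%:R *: Jm m p.
Proof.
apply/matrixP => i j; rewrite !mxE (eq_bigr (fun _ => 1)) => [|k _].
  by rewrite sumr_const card_ord mulr1.
by rewrite !mxE mulr1.
Qed.

Lemma Jm_rank1 m n : Jm m 1 *m Jm 1 n = Jm m n.
Proof. by rewrite mul_Jm scale1r. Qed.

Lemma tr_Jm m n : (Jm m n)^T = Jm n m.
Proof. by apply/matrixP => i j; rewrite !mxE. Qed.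

Lemma Jm11 : Jm 1 1 = 1%:M.
Proof. by apply/matrixP => i j; rewrite !mxE !ord1. Qed.

Lemma tr_JI n : (JI n)^T = JI n.
Proof. by rewrite /JI linearB /= tr_Jm trmx1. Qed.

Lemma JI_sqr n : JI n *m JI n = 1%:M + (n%:R - 2) *: Jm n n.
Proof.
rewrite /JI mulmxBl mulmxBr mul_Jm mul1mx mulmx1.
by apply/matrixP => i j; rewrite !mxE; ring.
Qed.

Lemma formI_spectrum m : (3 <= m)%N -> has_spectrum (formI m)
  ([:: (m%:R - 1); - (m%:R - 1)] ++ nseq m.-1 1 ++ nseq m.-1 (-1)).
Proof.
case: m => // m _; rewrite /has_spectrum prod_spectrum.
have E : JI m.+1 *m JI m.+1 = 1%:M + Jm m.+1 1 *m ((m.+1%:R - 2) *: Jm 1 m.+1).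
  by rewrite JI_sqr -scalemxAr Jm_rank1.
rewrite (char_poly_bipartite_rank1 E) -scalemxAl mul_Jm !mxE.
rewrite -mulrA -exprMn (_ : ('X - 1) * ('X + 1) = 'X ^+ 2 - 1); last by ring.
rewrite mulrC; congr (_ * _); rewrite mulr1 !(polyCN, polyCB, polyCM) polyC1; ring.
Qed.

Lemma formIV5_spectrum : has_spectrum formIV5 ([:: 3; -3] ++ nseq 4 1 ++ nseq 4 (-1)).
Proof.
rewrite /has_spectrum prod_spectrum /formIV5.
(* N N^T has the blocks 5, 2 and I + J, so it is I + u u^T with u = (2, 1, 1, 1, 1), of squared norm
   8 = 3^2 - 1. *)
pose u : 'cV[C]_(1 + 4) := col_mx (2%:M : 'M_1) (Jm 4 1).
pose c : 'rV[C]_(1 + 4) := row_mx (2%:M : 'M_1) (Jm 1 4).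
have E : N5 *m N5^T = 1%:M + u *m c.
  rewrite /N5 /u /c tr_block_mx !tr_Jm !trmx1 mulmx_block mul_col_row.
  rewrite [1%:M in RHS](@scalar_mx_block _ 1 4) add_block_mx.
  rewrite !mul_Jm !mulmx1 !mul1mx !mul_mx_scalar !mul_scalar_mx Jm11.
  congr block_mx; apply/matrixP => i j; rewrite !mxE ?ord1 ?eqxx; ring.
have cu : (c *m u) 0 0 = 8.
  rewrite /c /u mul_row_col mul_Jm Jm11 -scalar_mxM !mxE eqxx /= mulr1n mulr1; ring.
rewrite (@char_poly_bipartite_rank1 _ 4 N5 N5^T u c E) cu.
rewrite -mulrA -exprMn (_ : ('X - 1) * ('X + 1) = 'X ^+ 2 - 1); last by ring.
rewrite mulrC; congr (_ * _); rewrite polyCN; ring.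
Qed.

Lemma formIV6_spectrum : has_spectrum formIV6 ([:: 4; -4] ++ nseq 5 1 ++ nseq 5 (-1)).
Proof.
rewrite /has_spectrum prod_spectrum /formIV6.
(* N N^T has the blocks I + 4J, 2J and I + J, so u is 2 on the first three coordinates and 1 on the
   others, of squared norm 15 = 4^2 - 1. *)
pose u : 'cV[C]_(3 + 3) := col_mx (2 *: Jm 3 1) (Jm 3 1).
pose c : 'rV[C]_(3 + 3) := row_mx (2 *: Jm 1 3) (Jm 1 3).
have E : N6 *m N6^T = 1%:M + u *m c.
  rewrite /N6 /u /c tr_block_mx tr_Jm !tr_JI trmx0 mulmx_block mul_col_row.
  rewrite [1%:M in RHS](@scalar_mx_block _ 3 3) add_block_mx !JI_sqr.
  rewrite !mul_Jm !mul0mx !mulmx0 -!scalemxAl -!scalemxAr !Jm_rank1 /JI mulmxBl mulmxBr.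
  rewrite !mul_Jm mul1mx mulmx1.
  congr block_mx; apply/matrixP => i j; rewrite !mxE; ring.
have cu : (c *m u) 0 0 = 15.
  rewrite /c /u mul_row_col -scalemxAl -scalemxAr !mul_Jm Jm11 !mxE eqxx /=; ring.
rewrite (@char_poly_bipartite_rank1 _ 5 N6 N6^T u c E) cu.
rewrite -mulrA -exprMn (_ : ('X - 1) * ('X + 1) = 'X ^+ 2 - 1); last by ring.
rewrite mulrC; congr (_ * _); rewrite polyCN; ring.
Qed.

Lemma RrevE n (i j : 'I_n) : Rrev n i j = (j == rev_ord i)%:R.
Proof.
rewrite mxE -val_eqE /=; congr (nat_of_bool _)%:R.
by have := ltn_ord i; have := ltn_ord j; lia.
Qed.

Lemma Rrev_sqr n : Rrev n *m Rrev n = 1%:M.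
Proof.
apply/matrixP => i j; rewrite !mxE (bigD1 (rev_ord i)) //= !RrevE eqxx rev_ordK mul1r.
rewrite big1 ?addr0 1?eq_sym // => k ki.
by rewrite RrevE (negPf ki) mul0r.
Qed.

Lemma Rrev_Jm n p : Rrev n *m Jm n p = Jm n p.
Proof.
apply/matrixP => i j; rewrite !mxE (bigD1 (rev_ord i)) //= RrevE eqxx mxE mulr1.
by rewrite big1 ?addr0 // => k ki; rewrite RrevE (negPf ki) mul0r.
Qed.

(** Cut in the middle, R_{2k} is bipartite with both off-diagonal blocks R_k, and R_k squares to the
    identity. *)
Lemma char_poly_Rrev k : char_poly (Rrev (2 * k)) = ('X ^+ 2 - 1) ^+ k.
Proof.
have : (2 * k = k + k)%N by rewrite mul2n addnn.
move: (2 * k)%N => n ->.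
have -> : Rrev (k + k) = block_mx 0 (Rrev k) (Rrev k) 0.
  apply/matrixP => i j; case: (split_ordP i) => i' ->; case: (split_ordP j) => j' ->;
    rewrite ?block_mxEul ?block_mxEur ?block_mxEdl ?block_mxEdr !mxE /=;
    have := ltn_ord i'; have := ltn_ord j' => ? ?.
  - by rewrite (_ : (_ == _) = false) //; lia.
  - by congr (nat_of_bool _)%:R; lia.
  - by congr (nat_of_bool _)%:R; lia.
  - by rewrite (_ : (_ == _) = false) //; lia.
rewrite char_poly_bipartite -map_mxM Rrev_sqr map_scalar_mx /= polyC1.
by rewrite -scalar_mxB det_scalar.
Qed.

Definition Jdiag m n : 'M[C]_(m + n, 1 + 1) := block_mx (Jm m 1) 0 0 (Jm n 1).

Lemma char_poly_mx_scalar (x : C) : char_poly_mx (x%:M : 'M_1) = ('X - x%:P)%:M.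
Proof. by rewrite /char_poly_mx map_scalar_mx -scalar_mxB. Qed.

Lemma polyXsubC_neq0 (x : C) : 'X - x%:P != 0.
Proof. by rewrite polyXsubC_eq0. Qed.

Lemma char_poly_11 (a b c d : C) :
  char_poly (block_mx a%:M b%:M c%:M d%:M : 'M_(1 + 1)) =
  ('X - a%:P) * ('X - d%:P) - b%:P * c%:P.
Proof.
rewrite /char_poly char_poly_mx_block !char_poly_mx_scalar !map_scalar_mx /=.
rewrite -!scalar_mxN det_block_scalar ?polyXsubC_neq0 // expr1; ring.
Qed.

(** The last factor is the characteristic polynomial of the 2 x 2 quotient matrix; it replaces the
    eigenvalues e1, e2 of the two all-ones vectors. *)
Lemma char_poly_two_classes m n (P1 : 'M[C]_m) (P2 : 'M[C]_n) (e1 e2 s11 s12 s21 s22 : C) :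
  P1 *m Jm m 1 = e1 *: Jm m 1 -> P2 *m Jm n 1 = e2 *: Jm n 1 ->
  char_poly (block_mx (P1 + s11 *: Jm m m) (s12 *: Jm m n) (s21 *: Jm n m) (P2 + s22 *: Jm n n))
    * (('X - e1%:P) * ('X - e2%:P)) =
  char_poly P1 * char_poly P2 *
    (('X - (e1 + s11 * m%:R)%:P) * ('X - (e2 + s22 * n%:R)%:P)
      - (s12 * n%:R)%:P * (s21 * m%:R)%:P).
Proof.
move=> H1 H2.
pose c : 'M[C]_(1 + 1, m + n) :=
  block_mx (s11 *: Jm 1 m) (s12 *: Jm 1 n) (s21 *: Jm 1 m) (s22 *: Jm 1 n).
pose P' : 'M[C]_(1 + 1) := block_mx e1%:M 0 0 e2%:M.
have PU : block_mx P1 0 0 P2 *m Jdiag m n = Jdiag m n *m P'.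
  by rewrite !mulmx_block !(mul0mx, mulmx0, addr0, add0r) H1 H2 !mul_mx_scalar.
have P'E : char_poly P' = ('X - e1%:P) * ('X - e2%:P).
  by rewrite /P' char_poly_block_diag !char_poly_scalar.
rewrite -P'E; have := char_poly_exchange c PU.
rewrite {1}/c {1}/Jdiag mulmx_block !(mul0mx, mulmx0, addr0, add0r) -!scalemxAr !Jm_rank1.
rewrite add_block_mx !add0r => ->.
rewrite char_poly_block_diag /P'.
rewrite /c /Jdiag mulmx_block !(mul0mx, mulmx0, addr0, add0r) -!scalemxAl !mul_Jm Jm11.
rewrite !scale_scalar_mx !mulr1 add_block_mx !add0r -!scalar_mxD char_poly_11; ring.
Qed.

Lemma JIN n : JI n = (-1)%:M + 1 *: Jm n n.
Proof. by rewrite scale1r scalar_mxN addrC. Qed.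

Lemma formII_char a k : char_poly (formII a k) * (('X + 1) * ('X - 1)) =
  ('X + 1) ^+ a * ('X ^+ 2 - 1) ^+ k *
  ('X ^+ 2 - a%:R * 'X + a%:R - 1 - 2 * k%:R * a%:R).
Proof.
have := @char_poly_two_classes a (2 * k) (-1)%:M (Rrev (2 * k)) (-1) 1 1 1 1 0.
rewrite mul_scalar_mx Rrev_Jm !scale1r scale0r addr0 => /(_ erefl erefl).
rewrite -{1}[Jm a a]scale1r -JIN char_poly_scalar char_poly_Rrev polyCN polyC1 opprK => ->.
congr (_ * _); rewrite !(polyCD, polyCM, polyCN, polyC1, polyC0) -!polyC_natr; ring.
Qed.

Lemma formIII_char l m : char_poly (formIII l m) * (('X - 1) * ('X - 1)) =
  ('X ^+ 2 - 1) ^+ l * ('X ^+ 2 - 1) ^+ m *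
  (('X - 1) ^+ 2 - 4 * l%:R * m%:R).
Proof.
have := @char_poly_two_classes (2 * l) (2 * m) (Rrev (2 * l)) (Rrev (2 * m)) 1 1 0 1 1 0.
rewrite !Rrev_Jm !scale1r !scale0r !addr0 => /(_ erefl erefl).
rewrite !char_poly_Rrev polyC1 => ->.
congr (_ * _); rewrite !(polyCD, polyCM, polyCN, polyC1, polyC0) -!polyC_natr; ring.
Qed.

End FormSpectra.

(** * Forms with three vertex classes *)

Section ThreeClasses.

Local Notation C := algC.

Definition block3 (R : Type) m1 m2 m3 n1 n2 n3
    (A11 : 'M[R]_(m1, n1)) (A12 : 'M[R]_(m1, n2)) (A13 : 'M[R]_(m1, n3))
    (A21 : 'M[R]_(m2, n1)) (A22 : 'M[R]_(m2, n2)) (A23 : 'M[R]_(m2, n3))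
    (A31 : 'M[R]_(m3, n1)) (A32 : 'M[R]_(m3, n2)) (A33 : 'M[R]_(m3, n3)) :
    'M[R]_((m1 + m2) + m3, (n1 + n2) + n3) :=
  block_mx (block_mx A11 A12 A21 A22) (col_mx A13 A23) (row_mx A31 A32) A33.

Definition sJ m n (s : C) : 'M[C]_(m, n) := s *: Jm m n.

Lemma char_poly_three_classes n1 n2 n3 (P : 'M[C]_((n1 + n2) + n3)) (P' : 'M[C]_((1 + 1) + 1))
    (s11 s12 s13 s21 s22 s23 s31 s32 s33 : C) :
  let U : 'M[C]_((n1 + n2) + n3, (1 + 1) + 1) :=
    block_mx (Jdiag n1 n2) 0 0 (Jm n3 1) in
  P *m U = U *m P' ->
  char_poly (P + block3 (sJ n1 n1 s11) (sJ n1 n2 s12) (sJ n1 n3 s13)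
                        (sJ n2 n1 s21) (sJ n2 n2 s22) (sJ n2 n3 s23)
                        (sJ n3 n1 s31) (sJ n3 n2 s32) (sJ n3 n3 s33)) * char_poly P' =
  char_poly P * char_poly (P' +
     block3 (s11 * n1%:R)%:M (s12 * n2%:R)%:M (s13 * n3%:R)%:M
            (s21 * n1%:R)%:M (s22 * n2%:R)%:M (s23 * n3%:R)%:M
            (s31 * n1%:R)%:M (s32 * n2%:R)%:M (s33 * n3%:R)%:M).
Proof.
move=> U PU.
pose c : 'M[C]_((1 + 1) + 1, (n1 + n2) + n3) :=
  block3 (sJ 1 n1 s11) (sJ 1 n2 s12) (sJ 1 n3 s13)
         (sJ 1 n1 s21) (sJ 1 n2 s22) (sJ 1 n3 s23)
         (sJ 1 n1 s31) (sJ 1 n2 s32) (sJ 1 n3 s33).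
have sJl m n p s : Jm m n *m sJ n p s = (s * n%:R) *: Jm m p.
  by rewrite /sJ -scalemxAr mul_Jm scalerA.
have sJr m n p s : sJ m n s *m Jm n p = (s * n%:R) *: Jm m p.
  by rewrite /sJ -scalemxAl mul_Jm scalerA.
have uc : U *m c = block3 (sJ n1 n1 s11) (sJ n1 n2 s12) (sJ n1 n3 s13)
                        (sJ n2 n1 s21) (sJ n2 n2 s22) (sJ n2 n3 s23)
                        (sJ n3 n1 s31) (sJ n3 n2 s32) (sJ n3 n3 s33).
  rewrite /U /c /block3 /Jdiag mulmx_block !mul0mx !addr0 !add0r.
  rewrite mulmx_block mul_block_col mul_mx_row !mul0mx !addr0 !add0r !sJl.
  by rewrite !mulr1.
have cu : c *m U = block3 (s11 * n1%:R)%:M (s12 * n2%:R)%:M (s13 * n3%:R)%:M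
            (s21 * n1%:R)%:M (s22 * n2%:R)%:M (s23 * n3%:R)%:M
            (s31 * n1%:R)%:M (s32 * n2%:R)%:M (s33 * n3%:R)%:M.
  rewrite /U /c /block3 /Jdiag mulmx_block !mulmx0 !addr0 !add0r.
  rewrite mulmx_block mul_col_mx mul_row_block !mulmx0 !addr0 !add0r !sJr.
  by rewrite !Jm11 !scale_scalar_mx !mulr1.
by rewrite -uc -cu; apply: char_poly_exchange.
Qed.

Lemma char_poly_block3 (a b c d p q r s t : C) :
  'X - t%:P != 0 -> ('X - t%:P) * ('X - d%:P) - (q * s)%:P != 0 ->
  ('X - t%:P) * char_poly (block3 a%:M b%:M p%:M c%:M d%:M q%:M r%:M s%:M t%:M : 'M_((1 + 1) + 1)) =
  (('X - t%:P) * ('X - a%:P) - (p * r)%:P) * (('X - t%:P) * ('X - d%:P) - (q * s)%:P)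
  - (('X - t%:P) * (- b%:P) - (p * s)%:P) * (('X - t%:P) * (- c%:P) - (q * r)%:P).
Proof.
move=> t0 ds0; rewrite /char_poly /block3 char_poly_mx_block char_poly_mx_block.
rewrite !char_poly_mx_scalar map_col_mx map_row_mx !map_scalar_mx /= opp_col_mx opp_row_mx.
by rewrite -!scalar_mxN det_bordered // ?mulrNN -?polyCM.
Qed.

Lemma sJ1 m n : sJ m n 1 = Jm m n. Proof. exact: scale1r. Qed.
Lemma sJ0 m n : sJ m n 0 = 0. Proof. exact: scale0r. Qed.

Lemma scalar_block3 n1 n2 n3 (x : C) :
  (x%:M : 'M_((n1 + n2) + n3)) = block3 x%:M 0 0 0 x%:M 0 0 0 x%:M.
Proof. by rewrite /block3 !scalar_mx_block col_mx0 row_mx0. Qed.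

Lemma add_block3 (n1 n2 n3 : nat) (A11 B11 : 'M[C]_n1) (A12 B12 : 'M_(n1, n2))
    (A13 B13 : 'M_(n1, n3)) (A21 B21 : 'M_(n2, n1)) (A22 B22 : 'M_n2) (A23 B23 : 'M_(n2, n3))
    (A31 B31 : 'M_(n3, n1)) (A32 B32 : 'M_(n3, n2)) (A33 B33 : 'M_n3) :
  block3 A11 A12 A13 A21 A22 A23 A31 A32 A33 + block3 B11 B12 B13 B21 B22 B23 B31 B32 B33 =
  block3 (A11 + B11) (A12 + B12) (A13 + B13) (A21 + B21) (A22 + B22) (A23 + B23)
         (A31 + B31) (A32 + B32) (A33 + B33).
Proof. by rewrite /block3 !add_block_mx add_col_mx add_row_mx. Qed.

Lemma polyX_neq0 : ('X : {poly C}) != 0. Proof. by rewrite polyX_eq0. Qed.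

Lemma formV_char a b : char_poly (formV a b) * ('X + 1) ^+ 3 =
  ('X + 1) ^+ (a + b + 1) *
  (('X * ('X + 1 - a%:R) - a%:R) * ('X + 1 - b%:R) - 'X * (a%:R * b%:R)).
Proof.
(* The matrix is -I plus multiples of all-ones blocks; the last diagonal entry 0 is written -1 + 1,
   whence the final coefficient 1. *)
have := @char_poly_three_classes a b 1 (-1)%:M (-1)%:M 1 1 1 1 1 0 1 0 1.
rewrite /= mul_scalar_mx mul_mx_scalar => /(_ erefl).
rewrite !sJ1 !sJ0 !char_poly_scalar polyCN polyC1 opprK !mul1r !mul0r !scalar_block3 !add_block3.
rewrite !add0r -!scalar_mxD Jm11 -scalar_mxD addNr !raddf0 -(scale1r (Jm a a)) -JIN.
rewrite -(scale1r (Jm b b)) -JIN -/(formV a b) => ->; congr (_ * _).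
apply: (mulfI polyX_neq0).
have := @char_poly_block3 (-1 + a%:R) b%:R a%:R (-1 + b%:R) 1 0 a%:R 0 0.
rewrite mulr0 !polyC0 !subr0 raddf0 => ->; first last.
- by rewrite mulf_neq0 ?polyX_neq0 ?polyXsubC_neq0.
- exact: polyX_neq0.
rewrite !(polyCD, polyCM, polyCN, polyC1, polyC0) -!polyC_natr; ring.
Qed.

(** What remains of [formVI] without the all-ones blocks: -I on the clique and, from J - I, the
    negated swap of the two other classes. *)
Lemma char_poly_scalar_swap n m :
  char_poly (block3 (-1)%:M 0 0 0 0 (-1)%:M 0 (-1)%:M 0 : 'M[C]_((n + m) + m)) =
  ('X + 1) ^+ n * ('X ^+ 2 - 1) ^+ m.
Proof.
have Xm : ('X : {poly C}) ^+ m != 0 by rewrite expf_neq0 ?polyX_neq0.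
have E : char_poly_mx (block3 (-1)%:M 0 0 0 0 (-1)%:M 0 (-1)%:M 0 : 'M[C]_((n + m) + m)) *m
    block3 1%:M 0 0 0 'X%:M 0 0 (-1)%:M 1%:M =
    block3 ('X + 1)%:M 0 0 0 ('X ^+ 2 - 1)%:M 1%:M 0 0 'X%:M.
  rewrite /block3 char_poly_mx_block char_poly_mx_block !col_mx0 !row_mx0.
  rewrite map_col_mx map_row_mx opp_col_mx opp_row_mx !map_mx0 !map_scalar_mx !oppr0.
  rewrite /char_poly_mx !map_mx0 !map_scalar_mx /= !subr0 polyCN polyC1 -!scalar_mxN opprK.
  rewrite !mulmx_block mul_col_row mul_row_block mul_col_mx !mulmx0 !mul0mx.
  rewrite mul_mx_row add_block_mx !mulmx0 -!scalar_mxM !mulmx1 !addr0 !add0r add_row_mx.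
  rewrite -!scalar_mxD !(mulrN1, mul1r, mulr1) addrN !raddf0 add_col_mx !addr0 add0r.
  by congr block_mx; apply: row_mx0.
have := congr1 determinant E; rewrite det_mulmx => H.
apply: (mulIf Xm); move: H; rewrite /block3 !col_mx0 !row_mx0 !(det_lblock, det_ublock).
by rewrite !det_scalar !expr1n !mulr1 !mul1r.
Qed.

Lemma formVI_char a m : char_poly (formVI a m) * (('X + 1) * ('X ^+ 2 - 1)) =
  ('X + 1) ^+ a * ('X ^+ 2 - 1) ^+ m *
  (('X + 1 - a%:R) * ('X ^+ 2 - (m%:R - 1) ^+ 2) - a%:R * m%:R * 'X).
Proof.
pose S n1 n2 : 'M[C]_((n1 + n2) + n2) := block3 (-1)%:M 0 0 0 0 (-1)%:M 0 (-1)%:M 0.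
have PU : S a m *m block_mx (Jdiag a m) 0 0 (Jm m 1) =
    block_mx (Jdiag a m) 0 0 (Jm m 1) *m S 1 1.
  have Jcomm n : (-1)%:M *m Jm n 1 = Jm n 1 *m (-1)%:M.
    by rewrite mul_scalar_mx mul_mx_scalar.
  rewrite /S /block3 /Jdiag !mulmx_block !mul_row_block !mul_col_mx !mul_row_col !mul_mx_row.
  by rewrite !(mulmx0, mul0mx, add0r, addr0) !(col_mx0, row_mx0) ?add0r !Jcomm.

have FE : S a m + block3 (sJ a a 1) (sJ a m 1) (sJ a m 0) (sJ m a 1) (sJ m m 0) (sJ m m 1)
    (sJ m a 0) (sJ m m 1) (sJ m m 0) = formVI a m.
  have JIE n : (-1)%:M + Jm n n = JI n by rewrite JIN scale1r.
  by rewrite /S add_block3 !sJ1 !sJ0 !addr0 !add0r !JIE.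
have := char_poly_three_classes 1 1 0 1 0 1 0 1 0 PU.
rewrite FE !char_poly_scalar_swap !expr1 => ->; congr (_ * _).
rewrite /S add_block3 !mul1r !mul0r -!scalar_mxD !raddf0 !addr0 !add0r.
apply: (mulfI polyX_neq0).
have := @char_poly_block3 (-1 + a%:R) m%:R a%:R 0 0 (-1 + m%:R) 0 (-1 + m%:R) 0.
rewrite !polyC0 !subr0 !raddf0 => ->; first last.
- by rewrite -expr2 -size_poly_eq0 size_XnsubC.
- exact: polyX_neq0.
rewrite !(polyCD, polyCM, polyCN, polyC1, polyC0) -!polyC_natr; ring.
Qed.

End ThreeClasses.

(** * Explicit eigenvalues *)

Section Quadratics.

Local Notation C := algC.

Lemma split_quadratic (r t p q : C) : r + t = p -> r * t = q ->
  ('X - r%:P) * ('X - t%:P) = 'X ^+ 2 - p%:P * 'X + q%:P.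
Proof. by move=> <- <-; rewrite polyCD polyCM; ring. Qed.

Lemma X1_neq0 : ('X + 1 : {poly C}) != 0.
Proof. by rewrite -(opprK 1) -polyC1 -polyCN polyXsubC_neq0. Qed.

Lemma Xsub1_neq0 : ('X - 1 : {poly C}) != 0.
Proof. by rewrite -polyC1 polyXsubC_neq0. Qed.

Lemma formII_spectrum (a k : nat) : (1 <= a)%N -> (2 <= k)%N ->
  has_spectrum (formII a k)
    ([:: a%:R / 2 + sqrtC (a%:R ^+ 2 + 8 * a%:R * k%:R - 4 * a%:R + 4) / 2;
         a%:R / 2 - sqrtC (a%:R ^+ 2 + 8 * a%:R * k%:R - 4 * a%:R + 4) / 2]
     ++ nseq (k - 1) 1 ++ nseq (a + k - 1) (-1)).
Proof.
case: k => // k _ _; rewrite /has_spectrum prod_spectrum.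
set D := _ + 4; set s := sqrtC D.
have sE : s ^+ 2 = D by rewrite sqrtCK.
rewrite (@split_quadratic _ _ a%:R (a%:R - 1 - 2 * k.+1%:R * a%:R)); first last.
- by transitivity ((a%:R ^+ 2 - s ^+ 2) / 4); [field|rewrite sE /D; field].
- by field.
have DX : ('X + 1 : {poly C}) * ('X - 1) != 0 by rewrite mulf_neq0 ?X1_neq0 ?Xsub1_neq0.
apply: (mulIf DX); rewrite formII_char addnS !subn1 /= exprD.
rewrite !(polyCD, polyCM, polyCN, polyC1) -!polyC_natr.
rewrite (_ : 'X ^+ 2 - 1 = ('X + 1) * ('X - 1)) ?exprMn ?exprSr; ring.
Qed.

Lemma formIII_spectrum (l m : nat) : (m <= l)%N -> (2 <= m)%N ->
  has_spectrum (formIII l m)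
    ([:: 1 + 2 * sqrtC (l%:R * m%:R); 1 - 2 * sqrtC (l%:R * m%:R)]
     ++ nseq (l + m - 2) 1 ++ nseq (l + m) (-1)).
Proof.
move=> ml m2; have [l' ->] : exists l', l = l'.+1 by exists l.-1; lia.
have [m' ->] : exists m', m = m'.+1 by exists m.-1; lia.
rewrite /has_spectrum prod_spectrum; set D : C := l'.+1%:R * m'.+1%:R; set s := sqrtC D.
have sE : s ^+ 2 = D by rewrite sqrtCK.
rewrite (@split_quadratic _ _ 2 (1 - 4 * l'.+1%:R * m'.+1%:R)); first last.
- by transitivity (1 - 4 * s ^+ 2); [ring|rewrite sE /D; ring].
- by ring.
have DX : ('X - 1 : {poly C}) * ('X - 1) != 0 by rewrite mulf_neq0 ?Xsub1_neq0.
apply: (mulIf DX); rewrite formIII_char (_ : (l'.+1 + m'.+1 - 2 = l' + m')%N); last by lia.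
rewrite !(polyCD, polyCM, polyCN, polyC1) -!polyC_natr.
rewrite (_ : 'X ^+ 2 - 1 = ('X + 1) * ('X - 1)) ?exprMn ?exprD ?exprS; ring.
Qed.

(** The single eigenvalue 1 is a root of the cubic of the quotient matrix, and the last hypothesis
    records that factorization for the sizes at hand. *)
Lemma formV_spectrum a b (r t p q : C) : (2 <= a + b)%N -> r + t = p -> r * t = q ->
  ('X * ('X + 1 - a%:R) - a%:R) * ('X + 1 - b%:R) - 'X * (a%:R * b%:R) =
    ('X - 1) * ('X ^+ 2 - p%:P * 'X + q%:P) :> {poly C} ->
  has_spectrum (formV a b) ([:: r; t] ++ nseq 1 1 ++ nseq (a + b - 2) (-1)).
Proof.
move=> ab2 rp rq E; rewrite /has_spectrum prod_spectrum (split_quadratic rp rq).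
have DX : ('X + 1 : {poly C}) ^+ 3 != 0 by rewrite expf_neq0 ?X1_neq0.
apply: (mulIf DX); rewrite formV_char E expr1 (_ : a + b + 1 = (a + b - 2) + 3)%N; last by lia.
by rewrite exprD; ring.
Qed.

Lemma formVI_spectrum a m (r t p q : C) : (2 <= a + m)%N -> (1 <= m)%N ->
  r + t = p -> r * t = q ->
  ('X + 1 - a%:R) * ('X ^+ 2 - (m%:R - 1) ^+ 2) - a%:R * m%:R * 'X =
    ('X - 1) * ('X ^+ 2 - p%:P * 'X + q%:P) :> {poly C} ->
  has_spectrum (formVI a m) ([:: r; t] ++ nseq m 1 ++ nseq (a + m - 2) (-1)).
Proof.
case: m => // m am2 _ rp rq E; rewrite /has_spectrum prod_spectrum (split_quadratic rp rq).
have X2 : 'X ^+ 2 - 1 = ('X + 1) * ('X - 1) :> {poly C} by ring.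
have DX : ('X + 1 : {poly C}) * ('X ^+ 2 - 1) != 0.
  by rewrite X2 !mulf_neq0 ?X1_neq0 ?Xsub1_neq0.
apply: (mulIf DX); rewrite formVI_char E X2 exprMn.
set K := (a + m.+1 - 2)%N; transitivity (('X + 1 : {poly C}) ^+ (a + m.+1) *
  ('X - 1) ^+ m.+1 * (('X - 1) * ('X ^+ 2 - p%:P * 'X + q%:P))).
  by rewrite exprD; ring.
by rewrite (_ : a + m.+1 = K + 2)%N ?exprD; [ring|rewrite /K; lia].
Qed.

Lemma sum_conj (x y z : C) : (x + y * sqrtC z) + (x - y * sqrtC z) = 2 * x.
Proof. by ring. Qed.

Lemma mul_conj (x y z : C) : (x + y * sqrtC z) * (x - y * sqrtC z) = x ^+ 2 - y ^+ 2 * z.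
Proof. by rewrite -{3}(sqrtCK z); ring. Qed.

Lemma sum_conj_half (x z : C) : (x + sqrtC z) / 2 + (x - sqrtC z) / 2 = x.
Proof. by field. Qed.

Lemma mul_conj_half (x z : C) : (x + sqrtC z) / 2 * ((x - sqrtC z) / 2) = (x ^+ 2 - z) / 4.
Proof. by rewrite -{3}(sqrtCK z); field. Qed.

Lemma formV65_spectrum : has_spectrum (formV 6 5)
  ([:: 4 + 2 * sqrtC 10; 4 - 2 * sqrtC 10] ++ nseq 1 1 ++ nseq 9 (-1)).
Proof.
apply: (@formV_spectrum 6 5 _ _ 8 (-24)); rewrite ?sum_conj ?mul_conj //; [by ring|by ring|].
rewrite polyCN -!polyC_natr; ring.
Qed.

Lemma formV46_spectrum : has_spectrum (formV 4 6)
  ([:: (7 + sqrtC 129) / 2; (7 - sqrtC 129) / 2] ++ nseq 1 1 ++ nseq 8 (-1)).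
Proof.
apply: (@formV_spectrum 4 6 _ _ 7 (-20)); rewrite ?sum_conj_half ?mul_conj_half //; first by field.
rewrite polyCN -!polyC_natr; ring.
Qed.

Lemma formV38_spectrum : has_spectrum (formV 3 8)
  ([:: 4 + sqrtC 37; 4 - sqrtC 37] ++ nseq 1 1 ++ nseq 9 (-1)).
Proof.
rewrite -[sqrtC 37]mul1r.
apply: (@formV_spectrum 3 8 _ _ 8 (-21)); rewrite ?sum_conj ?mul_conj //; [by ring|by ring|].
rewrite polyCN -!polyC_natr; ring.
Qed.

Lemma formVI35_spectrum : has_spectrum (formVI 3 5)
  ([:: (1 + sqrtC 129) / 2; (1 - sqrtC 129) / 2] ++ nseq 5 1 ++ nseq 6 (-1)).
Proof.
apply: (@formVI_spectrum 3 5 _ _ 1 (-32)); rewrite ?sum_conj_half ?mul_conj_half //; first by field.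
rewrite polyCN -!polyC_natr; ring.
Qed.

Lemma formVI44_spectrum : has_spectrum (formVI 4 4)
  ([:: 1 + 2 * sqrtC 7; 1 - 2 * sqrtC 7] ++ nseq 4 1 ++ nseq 6 (-1)).
Proof.
apply: (@formVI_spectrum 4 4 _ _ 2 (-27)); rewrite ?sum_conj ?mul_conj //; [by ring|by ring|].
rewrite polyCN -!polyC_natr; ring.
Qed.

End Quadratics.

(** * Connectedness of the forms *)

Section Connectivity.

Variables (T : finType) (e : rel T).
Hypothesis e_sym : symmetric e.

Definition linked m n (f : 'I_m -> T) (h : 'I_n -> T) := forall i j, connect e (f i) (h j).
Definition rooted x m (f : 'I_m -> T) := forall i, connect e x (f i).

Lemma adj_block_mxK m1 m2 n1 n2 (A : 'M_(m1, n1)) (B : 'M_(m1, n2)) (C : 'M_(m2, n1))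
    (D : 'M_(m2, n2)) f h :
  adj_block e (block_mx A B C D) f h ->
  [/\ adj_block e A (f \o @lshift _ _) (h \o @lshift _ _),
      adj_block e B (f \o @lshift _ _) (h \o @rshift _ _),
      adj_block e C (f \o @rshift _ _) (h \o @lshift _ _) &
      adj_block e D (f \o @rshift _ _) (h \o @rshift _ _)].
Proof.
move=> H; split=> i j /=; rewrite -H.
- by rewrite block_mxEul.
- by rewrite block_mxEur.
- by rewrite block_mxEdl.
- by rewrite block_mxEdr.
Qed.

Lemma adj_col_mxK m1 m2 n (A : 'M_(m1, n)) (C : 'M_(m2, n)) f h :
  adj_block e (col_mx A C) f h ->
  adj_block e A (f \o @lshift _ _) h /\ adj_block e C (f \o @rshift _ _) h.
Proof. by move=> H; split=> i j /=; rewrite -H ?col_mxEu ?col_mxEd. Qed.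

Lemma adj_block_edge m n (M : 'M_(m, n)) f h i j : adj_block e M f h -> M i j = 1 -> e (f i) (h j).
Proof.
move=> H M1; have := H i j; rewrite M1; case: (e _ _) => // /eqP.
by rewrite oner_eq0.
Qed.

Lemma linked_sym m n (f : 'I_m -> T) (h : 'I_n -> T) : linked f h -> linked h f.
Proof. by move=> fh i j; rewrite (sym_connect_sym e_sym). Qed.

Lemma linked_Jm m n (f : 'I_m -> T) (h : 'I_n -> T) : adj_block e (Jm m n) f h -> linked f h.
Proof. by move=> H i j; apply/connect1/(adj_block_edge H); rewrite mxE. Qed.

(** A third index is needed for the pairs that J - I leaves nonadjacent: the walk f i, h j, f k, h i
    joins them. *)
Lemma linked_JI m (f h : 'I_m -> T) : (3 <= m)%N -> adj_block e (JI m) f h -> linked f h.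
Proof.
move=> m3 H; have fh i j : i != j -> connect e (f i) (h j).
  by move=> ij; apply/connect1/(adj_block_edge H); rewrite JIE ij.
move=> i j0; have [<- {j0}|/fh//] := eqVneq i j0.
have /card_gt1P[j [k [ji ki jk]]] : (1 < #|[set~ i]|)%N by rewrite cardsC1 card_ord; lia.
rewrite !in_setC1 in ji ki; have ij : i != j by rewrite eq_sym.
apply: connect_trans (fh _ _ ij) _; apply: connect_trans (fh _ _ ki).
by rewrite (sym_connect_sym e_sym) fh // eq_sym.
Qed.

Lemma rooted_linked x m n (f : 'I_m.+1 -> T) (h : 'I_n -> T) :
  rooted x f -> linked f h -> rooted x h.
Proof. by move=> xf fh j; apply: connect_trans (xf ord0) (fh ord0 j). Qed.

Lemma rooted_sum x m n (f : 'I_(m + n) -> T) :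
  rooted x (f \o @lshift _ _) -> rooted x (f \o @rshift _ _) -> rooted x f.
Proof. by move=> fl fr i; case: (split_ordP i) => j ->; [exact: fl|exact: fr]. Qed.

Lemma linked_rooted m n (f : 'I_m.+1 -> T) (h : 'I_n.+1 -> T) : linked f h ->
  rooted (f ord0) f /\ rooted (f ord0) h.
Proof.
move=> fh; have xh : rooted (f ord0) h by move=> j.
by split=> //; apply: rooted_linked xh (linked_sym fh).
Qed.

Definition connected := forall x y, connect e x y.

Lemma rooted_connected x m (f : 'I_m -> T) : enumerates setT f -> rooted x f -> connected.
Proof.
move=> [_ fT] xf y z; have [/fT[i <-] /fT[j <-]] := (in_setT y, in_setT z).
by apply: connect_trans (xf j); rewrite (sym_connect_sym e_sym).
Qed.

Lemma formI_connected m : (3 <= m)%N -> realizes e (formI m) -> connected.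
Proof.
case: m => // m m3 [f fT /adj_block_mxK[_ /(linked_JI m3)/linked_rooted[fl fr] _ _]].
by apply: (rooted_connected fT); apply: rooted_sum fl fr.
Qed.

Lemma formII_connected a k : (1 <= a)%N -> (2 <= k)%N -> realizes e (formII a k) -> connected.
Proof.
case: a => // a _; case: k => // k _.
rewrite /formII (_ : 2 * k.+1 = (2 * k).+2)%N; last by lia.
move=> [f fT /adj_block_mxK[_ /linked_Jm/linked_rooted[fl fr] _ _]].
by apply: (rooted_connected fT); apply: rooted_sum fl fr.
Qed.

Lemma formIII_connected l m : (m <= l)%N -> (2 <= m)%N -> realizes e (formIII l m) -> connected.
Proof.
case: m => // m; case: l => // l _ _.
rewrite /formIII (_ : 2 * l.+1 = (2 * l).+2)%N; last by lia.
rewrite (_ : 2 * m.+1 = (2 * m).+2)%N; last by lia.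
move=> [f fT /adj_block_mxK[_ /linked_Jm/linked_rooted[fl fr] _ _]].
by apply: (rooted_connected fT); apply: rooted_sum fl fr.
Qed.

Lemma formIV5_connected : realizes e formIV5 -> connected.
Proof.
move=> [f fT /adj_block_mxK[_ /(@adj_block_mxK 1 4 1 4)[H11 /linked_Jm H12 /linked_Jm H21 _] _ _]].
have /linked_Jm/linked_rooted[xl xr] : adj_block e (Jm 1 1)
    (f \o @lshift 5 5 \o @lshift 1 4) (f \o @rshift 5 5 \o @lshift 1 4) by rewrite Jm11.
apply: (rooted_connected fT); apply: rooted_sum.
  exact: (rooted_sum xl (rooted_linked xr (linked_sym H21))).
exact: (rooted_sum xr (rooted_linked xl H12)).
Qed.

Lemma formIV6_connected : realizes e formIV6 -> connected.
Proof.
move=> [f fT /adj_block_mxK[_ /(@adj_block_mxK 3 3 3 3)[H11 /linked_Jm H12 _ H22] _ _]].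
have [xl xr] := linked_rooted (@linked_JI 3 _ _ isT H11).
have yr := rooted_linked xl H12.
apply: (rooted_connected fT); apply: rooted_sum; last exact: (rooted_sum xr yr).
exact: (rooted_sum xl (rooted_linked yr (linked_sym (@linked_JI 3 _ _ isT H22)))).
Qed.

Lemma formV_connected a b : (1 <= a)%N -> (1 <= b)%N -> realizes e (formV a b) -> connected.
Proof.
case: a => // a _; case: b => // b _.
move=> [f fT /adj_block_mxK[/adj_block_mxK[_ /linked_Jm/linked_rooted[xl xr] _ _]
  /adj_col_mxK[/linked_Jm H _] _ _]].
apply: (rooted_connected fT); apply: rooted_sum; first exact: rooted_sum xl xr.
exact: rooted_linked xl H.
Qed.

Lemma formVI_connected a m : (1 <= a)%N -> (3 <= m)%N -> realizes e (formVI a m) -> connected.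
Proof.
case: a => // a _; case: m => // m m3.
move=> [f fT /adj_block_mxK[/adj_block_mxK[_ /linked_Jm/linked_rooted[xl xr] _ _]
  /adj_col_mxK[_ /(linked_JI m3) H] _ _]].
apply: (rooted_connected fT); apply: rooted_sum; first exact: rooted_sum xl xr.
exact: rooted_linked xr H.
Qed.

End Connectivity.

(** * From the forms back to the spectral condition *)

Lemma reordered_realizes n (e : rel 'I_n) N (B : 'M[algC]_N) (s : 'S_n) (E : N = n) :
  reordered_adj e s = castmx (E, E) B -> realizes e B.
Proof.
subst n; rewrite castmx_id => eB; exists s; last by move=> i j; rewrite -eB !mxE.
split; first exact: perm_inj.
by move=> x; split=> // _; exists ((s^-1)%g x); rewrite permKV.
Qed.

(** For eigenvalues x + y and x - y with x, y >= 0, both r > 1 and t < -1 follow from x + 1 < y. The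
    condition is squared because y is mostly a multiple of a square root. *)
Lemma inG_of_spectrum n (e : rel 'I_n) N (B : 'M[algC]_N) (s : 'S_n) (E : N = n) x y r t k l :
  reordered_adj e s = castmx (E, E) B -> connected e ->
  has_spectrum B ([:: r; t] ++ nseq k 1 ++ nseq l (-1)) ->
  r = x + y -> t = x - y -> 0 <= x -> 0 <= y -> (x + 1) ^+ 2 < y ^+ 2 -> inG e.
Proof.
move=> eB e_conn Bsp rE tE x0 y0 xy2.
have xy : x + 1 < y by move: xy2; rewrite ltr_pXn2r // nnegrE ?addr_ge0.
have r1 : 1 < r.
  by rewrite rE -[1]add0r ler_ltD // (le_lt_trans _ xy) // lerDr.
have t1 : t < -1 by rewrite tE ltrBlDr addrC -ltrBlDr opprK.
have N11 : -1 < 1 :> algC by rewrite -subr_gt0 opprK addr_gt0.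
split=> //; exists ([:: r; t] ++ nseq k 1 ++ nseq l (-1)); split.
  by rewrite /has_spectrum -Bsp -(castmx_char_poly E) -eB char_poly_reorder.
exists r, t; do 2![split=> //].
rewrite /= filter_cat !filter_nseq eqxx /= (gt_eqF r1) (gt_eqF (lt_trans N11 r1)) /=.
by rewrite (lt_eqF t1) (lt_eqF (lt_trans t1 N11)) eqxx andbF.
Qed.

Lemma half_gap (x D : algC) : (x + 2) ^+ 2 < D -> (x / 2 + 1) ^+ 2 < (sqrtC D / 2) ^+ 2.
Proof.
rewrite expr_div_n sqrtCK (_ : (x / 2 + 1) ^+ 2 = (x + 2) ^+ 2 / 2 ^+ 2); last by field.
by rewrite ltr_pM2r // invr_gt0 exprn_gt0.
Qed.

Lemma form_inG n (e : rel 'I_n) (s : 'S_n) :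
  symmetric e -> is_form (reordered_adj e s) -> inG e.
Proof.
move=> e_sym; case=> [[m [E [m3 eB]]]|].
  have := formI_connected e_sym m3 (reordered_realizes eB).
  move=> e_conn; apply: (inG_of_spectrum (x := 0) (y := m%:R - 1) eB e_conn (formI_spectrum m3));
    rewrite ?add0r //.
  - by rewrite subr_ge0 ler1n; lia.
  - case: m m3 {E eB} => // m m3; rewrite -natr1 addrK expr1n -natrX ltr1n.
    by nia.
case=> [[a [k [E [a1 [k2 eB]]]]]|].
  have := formII_connected e_sym a1 k2 (reordered_realizes eB).
  move=> e_conn.
  apply: (inG_of_spectrum eB e_conn (formII_spectrum a1 k2) erefl erefl);
    rewrite ?divr_ge0 ?sqrtC_ge0 //.
  (* The discriminant exceeds (a + 2)^2 by 8 a (k - 1), which is also what the strict gap below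
     needs. *)
  - rewrite (_ : _ + 4 = 8 * a%:R * (k%:R - 1) + (a%:R + 2) ^+ 2); last by ring.
    by rewrite addr_ge0 ?exprn_ge0 ?addr_ge0 // !mulr_ge0 // subr_ge0 ler1n ltnW.
  - apply: half_gap; rewrite -subr_gt0 (_ : _ - _ = 8 * a%:R * (k%:R - 1)); last by ring.
    by rewrite !mulr_gt0 ?ltr0n // subr_gt0 ltr1n.
case=> [[l [m [E [ml [m2 eB]]]]]|].
  have := formIII_connected e_sym ml m2 (reordered_realizes eB).
  move=> e_conn.
  apply: (inG_of_spectrum eB e_conn (formIII_spectrum ml m2) erefl erefl);
    rewrite ?mulr_ge0 ?sqrtC_ge0 //.
  - by rewrite mulr_ge0.
  - rewrite exprMn sqrtCK -(natrM _ l m) -!natrX -natrM ltr_nat.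
    by nia.
case=> [[E eB]|].
  have := formIV5_connected e_sym (reordered_realizes eB).
  move=> e_conn.
  apply: (inG_of_spectrum (x := 0) (y := 3) eB e_conn formIV5_spectrum); rewrite ?add0r //.
  by rewrite expr1n -natrX ltr1n.
case=> [[E eB]|].
  have := formIV6_connected e_sym (reordered_realizes eB).
  move=> e_conn.
  apply: (inG_of_spectrum (x := 0) (y := 4) eB e_conn formIV6_spectrum); rewrite ?add0r //.
  by rewrite expr1n -natrX ltr1n.
case=> [[a [b [E [ab eB]]]]|[a [m [E [am eB]]]]].
  have e_conn : connected e.
    by apply: (formV_connected e_sym _ _ (reordered_realizes eB)); case: ab => [|[]] []; lia.
  case: ab => [|[]] [aE bE]; subst a b.
  - apply: (inG_of_spectrum eB e_conn formV65_spectrum erefl erefl);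
    rewrite ?mulr_ge0 ?sqrtC_ge0 //.
    by rewrite exprMn sqrtCK -natrX -natrM natr1 -natrX ltr_nat.
  - apply: (inG_of_spectrum (x := 7 / 2) (y := sqrtC 129 / 2) eB e_conn formV46_spectrum);
      [by field|by field|by rewrite divr_ge0|by rewrite divr_ge0 ?sqrtC_ge0|].
    by apply: half_gap; rewrite -natrD -natrX ltr_nat.
  - apply: (inG_of_spectrum eB e_conn formV38_spectrum erefl erefl); rewrite ?sqrtC_ge0 //.
    by rewrite sqrtCK natr1 -natrX ltr_nat.
have e_conn : connected e.
  by apply: (formVI_connected e_sym _ _ (reordered_realizes eB)); case: am => [] []; lia.
case: am => [] [aE bE]; subst a m.
- apply: (inG_of_spectrum (x := 1 / 2) (y := sqrtC 129 / 2) eB e_conn formVI35_spectrum);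
    [by field|by field|by rewrite divr_ge0|by rewrite divr_ge0 ?sqrtC_ge0|].
  by apply: half_gap; rewrite -(natrD _ 1) -natrX ltr_nat.
- apply: (inG_of_spectrum eB e_conn formVI44_spectrum erefl erefl);
    rewrite ?mulr_ge0 ?sqrtC_ge0 //.
  by rewrite exprMn sqrtCK -!natrX -natrM ltr_nat.
Qed.

Theorem theorem3p1 :
  (forall (n : nat) (e : rel 'I_n), symmetric e -> irreflexive e ->
     (inG e <-> exists s : 'S_n, is_form (reordered_adj e s)))
  /\ (forall m : nat, (3 <= m)%N ->
        has_spectrum (formI m)
          ([:: (m%:R - 1); - (m%:R - 1)] ++ nseq m.-1 1 ++ nseq m.-1 (-1)))
  /\ (forall a k : nat, (1 <= a)%N -> (2 <= k)%N ->
        has_spectrum (formII a k)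
          ([:: a%:R / 2 + sqrtC (a%:R ^+ 2 + 8 * a%:R * k%:R - 4 * a%:R + 4) / 2;
               a%:R / 2 - sqrtC (a%:R ^+ 2 + 8 * a%:R * k%:R - 4 * a%:R + 4) / 2]
           ++ nseq (k - 1) 1 ++ nseq (a + k - 1) (-1)))
  /\ (forall l m : nat, (m <= l)%N -> (2 <= m)%N ->
        has_spectrum (formIII l m)
          ([:: 1 + 2 * sqrtC (l%:R * m%:R); 1 - 2 * sqrtC (l%:R * m%:R)]
           ++ nseq (l + m - 2) 1 ++ nseq (l + m) (-1)))
  /\ has_spectrum formIV5 ([:: 3; -3] ++ nseq 4 1 ++ nseq 4 (-1))
  /\ has_spectrum formIV6 ([:: 4; -4] ++ nseq 5 1 ++ nseq 5 (-1))
  /\ has_spectrum (formV 6 5)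
        ([:: 4 + 2 * sqrtC 10; 4 - 2 * sqrtC 10] ++ nseq 1 1 ++ nseq 9 (-1))
  /\ has_spectrum (formV 4 6)
        ([:: (7 + sqrtC 129) / 2; (7 - sqrtC 129) / 2] ++ nseq 1 1 ++ nseq 8 (-1))
  /\ has_spectrum (formV 3 8)
        ([:: 4 + sqrtC 37; 4 - sqrtC 37] ++ nseq 1 1 ++ nseq 9 (-1))
  /\ has_spectrum (formVI 3 5)
        ([:: (1 + sqrtC 129) / 2; (1 - sqrtC 129) / 2] ++ nseq 5 1 ++ nseq 6 (-1))
  /\ has_spectrum (formVI 4 4)
        ([:: 1 + 2 * sqrtC 7; 1 - 2 * sqrtC 7] ++ nseq 4 1 ++ nseq 6 (-1)).
Proof.
split.
  move=> n e e_sym e_irr; split=> [eG|[s]]; last exact: form_inG.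
  exact/good_graph_form/inG_good_graph.
split; first exact: formI_spectrum.
split; first exact: formII_spectrum.
split; first exact: formIII_spectrum.
split; first exact: formIV5_spectrum.
split; first exact: formIV6_spectrum.
split; first exact: formV65_spectrum.
split; first exact: formV46_spectrum.
split; first exact: formV38_spectrum.
split; first exact: formVI35_spectrum.
exact: formVI44_spectrum.
Qed.
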